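(* Let $H\in(0,1)$ and consider the equation $$du(t)=(\mathcal{A}_0+\theta\mathcal{A}_1)u(t)\,dt+\mathcal{M}u(t)\,dW^H(t),\qquad u(0)=u_0,$$ with true parameter value $\theta=\theta_0\in\Theta$. Assume that the equation is diagonalizable and parabolic in the triple $(\mathbf{H}^{\gamma+m},\mathbf{H}^\gamma,\mathbf{H}^{\gamma-m})$ for some $\gamma\in\mathbb{R}$, $m>0$, and that $u_0\in\mathbf{H}^\gamma$ is deterministic. Assume $u_k(0)\ne0$ and $\nu_k\neq0$ for all $k\ge1$. For $k\ge1$ and $T>0$ let $$\widehat\theta_{k,T}=\frac{\widetilde v_k(T)}{\nu_kb_1T^{2-2H}}+\frac{Hb_2\mu_k^2}{\nu_kb_1T^{1-2H}}-\frac{\rho_k}{\nu_k},$$ where $v_k(t)=\ln(u_k(t)/u_k(0))$ and $\widetilde v_k(t)=\int_0^tl_H(t,s)\,dv_k(s)$, $u_k$ being the Fourier coefficients of the solution for $\theta=\theta_0$. Then: (1) For every $k\ge1$ and $T>0$, $\widehat\theta_{k,T}$ is an unbiased estimator of $\theta_0$, i.e. $\mathbb{E}\,\widehat\theta_{k,T}=\theta_0$. (2) For every fixed $k\ge1$, as $T\to\infty$, the estimator $\widehat\theta_{k,T}$ converges to $\theta_0$ with probability one, and $T^{1-H}(\widehat\theta_{k,T}-\theta_0)$ converges in distribution to a Gaussian random variable with zero mean and variance $\mu_k^2/(b_1^2\nu_k^2)$. (3) If, in addition, $\lim_{k\to\infty}|\mu_k/\nu_k|=0$, then for every fixed $T>0$,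 $\lim_{k\to\infty}\widehat\theta_{k,T}=\theta_0$ with probability one, and (with $\mu_k\ne0$ for all $k$, so that the normalization is defined) $|\nu_k/\mu_k|(\widehat\theta_{k,T}-\theta_0)$ converges in distribution, as $k\to\infty$, to a Gaussian random variable with zero mean and variance $T^{2H-2}/b_1^2$.
   Context: $W^H$ is a fractional Brownian motion with Hurst parameter $H\in(0,1)$: a zero-mean Gaussian process with $\mathbb{E}W^H(t)W^H(s)=\frac12(t^{2H}+s^{2H}-|t-s|^{2H})$, $t,s\ge0$. $\mathbf{H}$ is a separable Hilbert space with norm $\|\cdot\|_0$. $\Lambda$ is a densely defined linear operator on $\mathbf{H}$ for which there is $c>0$ with $\|\Lambda u\|_0\ge c\|u\|_0$ for all $u$ in its domain, and whose powers $\Lambda^\gamma$, $\gamma\in\mathbb{R}$, are well defined. For $\gamma>0$, $\mathbf{H}^\gamma$ is the domain of $\Lambda^\gamma$; $\mathbf{H}^0=\mathbf{H}$; for $\gamma<0$, $\mathbf{H}^\gamma$ is the completion of $\mathbf{H}$ with respect to $\|\cdot\|_\gamma:=\|\Lambda^\gamma\cdot\|_0$. $\mathcal{A}_0,\mathcal{A}_1,\mathcal{M}$ are known linear operators in $\mathbf{H}$, and $\theta$ is a real parameter belonging to a bounded open set $\Theta\subset\mathbb{R}$. The equation is called diagonalizable if $\mathcal{A}_0,\mathcal{A}_1,\mathcal{M}$ have point spectrum and a common system of eigenfunctions $\{h_k,\ k\ge1\}$, which is a complete orthonormal system in $\mathbf{H}$. Write $\mathcal{A}_0h_k=\rho_kh_k$,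 $\mathcal{A}_1h_k=\nu_kh_k$, $\mathcal{M}h_k=\mu_kh_k$, $\alpha_k(\theta)=\rho_k+\theta\nu_k$. It is assumed that $\Lambda h_k=\lambda_kh_k$ with $\lambda_k>0$, $k\ge1$. The equation is called parabolic in the triple $(\mathbf{H}^{\gamma+m},\mathbf{H}^\gamma,\mathbf{H}^{\gamma-m})$ if there exist positive reals $\delta,C_1$ and a real $C_2$ such that for all $k\ge1$ and all $\theta\in\Theta$: $\lambda_k^{-2m}|\rho_k+\theta\nu_k|\le C_1$ and $2(\rho_k+\theta\nu_k)+\mu_k^2+\delta\lambda_k^{2m}\le C_2$. By definition, the solution of the equation is $u(t)=\sum_{k\ge1}u_k(t)h_k$ with Fourier coefficients $$u_k(t)=u_k(0)\exp\left(\alpha_k(\theta)t-\tfrac12\mu_k^2t^{2H}+\mu_kW^H(t)\right),\qquad u_0=\sum_{k\ge1}u_k(0)h_k .$$ With $\Gamma$ and $\mathrm{B}$ the Euler Gamma and Beta functions, $$C_H=\left(\frac{\Gamma(3-2H)}{2H\,\Gamma(\frac32-H)^3\,\Gamma(\frac12+H)}\right)^{1/2},\qquad l_H(t,s)=C_H\,s^{\frac12-H}(t-s)^{\frac12-H}\mathbb{I}_{0<s<t},$$ $$b_1=C_H\,\mathrm{B}(\tfrac32-H,\tfrac32-H),\qquad b_2=C_H\,\mathrm{B}(\tfrac12+H,\tfrac32-H).$$ Integrals of deterministic functions with respect to $W^H$ are Wiener integrals; since $v_k(t)=\alpha_k(\theta)t-\frac12\mu_k^2t^{2H}+\mu_kW^H(t)$,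 the integral $\int_0^tl_H(t,s)\,dv_k(s)$ means $\int_0^tl_H(t,s)(\alpha_k(\theta)-\mu_k^2Hs^{2H-1})\,ds+\mu_k\int_0^tl_H(t,s)\,dW^H(s)$.
   Formalization: In (2), convergence with probability one as T→∞ is stated for versions of the process ṽ_k whose paths are almost surely continuous on (0,∞), since Wiener integrals are defined only up to null sets for each T and the claim fails for arbitrary versions. *)

(* Defs.v *)
From HB Require Import structures.
From mathcomp Require Import all_boot all_order all_algebra.
From mathcomp Require Import all_classical all_reals all_analysis.

Set Implicit Arguments.
Unset Strict Implicit.
Unset Printing Implicit Defensive.

Import Order.TTheory GRing.Theory Num.Theory.
Import numFieldNormedType.Exports.

Local Open Scope classical_set_scope.
Local Open Scope ring_scope.

(* The library has no Hilbert-space structure: a real separable Hilbert space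
   is a complete normed module whose norm comes from an inner product [ip].
   Sequences (h_k), k >= 1, are indexed by [nat] starting from 0 throughout. *)
Section hilbert_scale.
Variables (R : realType) (V : completeNormedModType R) (ip : V -> V -> R).

Definition separable_hilbert : Prop :=
  [/\ forall x y, ip x y = ip y x,
      forall (a : R) x y z, ip (a *: x + y) z = a * ip x z + ip y z,
      forall x, ip x x = `|x| ^+ 2 &
      exists D : set V, countable D /\ dense D].

Record linear_operator := LinearOperator {
  op_dom : set V ;
  op_fun :> V -> V ;
  op_dom0 : op_dom 0 ;
  op_domP : forall (a : R) x y, op_dom x -> op_dom y -> op_dom (a *: x + y) ;
  op_linear : forall (a : R) x y, op_dom x -> op_dom y ->
    op_fun (a *: x + y) = a *: op_fun x + op_fun y }.

Definition eigensystem (A : linear_operator) (h : nat -> V) (a : nat -> R) :=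
  forall k, op_dom A (h k) /\ A (h k) = a k *: h k.

Definition complete_orthonormal (h : nat -> V) : Prop :=
  (forall i j, ip (h i) (h j) = (i == j)%:R) /\
  (forall x, (forall k, ip x (h k) = 0) -> x = 0).

Definition diagonalizable_equation (A0 A1 M : linear_operator) (h : nat -> V)
    (rho nu mu : nat -> R) : Prop :=
  [/\ complete_orthonormal h,
      eigensystem A0 h rho, eigensystem A1 h nu & eigensystem M h mu].

Definition densely_defined_bounded_below (L : linear_operator) : Prop :=
  dense (op_dom L) /\
  exists2 c : R, 0 < c & forall x, op_dom L x -> c * `|x| <= `|L x|.

Section powers.
Variables (h : nat -> V) (lam : nat -> R).

(* The power of exponent g of the operator Lambda with Lambda h_k = lam_k h_k,
   h a complete orthonormal system, given by the spectral calculus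
   Lambda^g x = \sum_k lam_k^g <x, h_k> h_k wherever the series converges. *)
Definition Lambda_power_series (g : R) (x : V) : V ^nat :=
  series (fun k => (lam k `^ g * ip x (h k)) *: h k).

Definition Lambda_power_dom (g : R) : set V :=
  [set x | cvgn (Lambda_power_series g x)].

Definition Lambda_power (g : R) (x : V) : V := limn (Lambda_power_series g x).

(* [initial_condition g a]: the series \sum_k a_k h_k is an element u_0 of H^g.
   For g < 0, E with the embedding j is a completion of V for the norm
   |Lambda^g x|, and the series converges in E. *)
Definition initial_condition (g : R) (a : nat -> R) : Prop :=
  if 0 <= g then
    exists2 u0 : V, (0 < g -> Lambda_power_dom g u0) &
      series (fun k => a k *: h k) @ \oo --> u0
  else
    exists (E : completeNormedModType R) (j : {linear V -> E}) (u0 : E),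
      [/\ forall x, `|j x| = `|Lambda_power g x|,
          dense (range j) &
          series (fun k => a k *: j (h k)) @ \oo --> u0].

End powers.
End hilbert_scale.

Definition parabolic (R : realType) (lam rho nu mu : nat -> R)
    (Theta : set R) (m : R) : Prop :=
  exists delta C1 C2 : R, [/\ 0 < delta, 0 < C1 &
    forall k theta, Theta theta ->
      lam k `^ (- (2 * m)) * `|rho k + theta * nu k| <= C1 /\
      2 * (rho k + theta * nu k) + mu k ^+ 2 + delta * lam k `^ (2 * m) <= C2].

(* The normal law of mean m and variance v >= 0, degenerate when v = 0
   (the library's [normal_prob m 0] is not the Dirac mass). *)
Definition gaussian_law (R : realType) (m v : R) (A : set R) : \bar R :=
  if v == 0 then \d_m A else normal_prob m (Num.sqrt v) A.

Section probability.
Context (d : measure_display) (Omega : measurableType d) (R : realType)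
  (P : probability Omega R).

(* Only the values at t >= 0 matter. *)
Definition fractional_brownian_motion (H : R) (W : R -> {RV P >-> R}) : Prop :=
  (forall (n : nat) (t c : 'I_n -> R), (forall i, 0 <= t i) ->
    exists2 v : R, 0 <= v & forall A : set R, measurable A ->
      P [set w | A (\sum_(i < n) c i * W (t i) w)] = gaussian_law 0 v A) /\
  (forall t s : R, 0 <= t -> 0 <= s ->
    'E_P[fun w => (W t w * W s w)%R]%E =
    (2^-1 * (t `^ (2 * H) + s `^ (2 * H) - `|t - s| `^ (2 * H)))%:E).

(* The step function \sum_i a_i 1_(s_i, t_i], 0 <= s_i <= t_i, is represented
   by the list of the ((a_i, s_i), t_i). *)
Definition step_wf (s : seq (R * R * R)) : bool :=
  all (fun p => 0 <= p.1.2 <= p.2) s.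

Definition step_fun (s : seq (R * R * R)) (x : R) : R :=
  \sum_(p <- s) p.1.1 * \1_`]p.1.2, p.2] x.

Definition step_integral (W : R -> {RV P >-> R}) (s : seq (R * R * R))
    (w : Omega) : R :=
  \sum_(p <- s) p.1.1 * (W p.2 w - W p.1.2 w).

Local Notation leb := (@lebesgue_measure R).

(* Squared norm on deterministic integrands vanishing on the negative
   half-line. On step functions f it is the variance of \int f dW^H when
   H <= 1/2; when H > 1/2 that variance is
   H (2 H - 1) \int \int f(x) f(y) |x - y|^(2 H - 2) dx dy, and the usual
   dominating norm with absolute values is taken. *)
Definition integrand_norm2 (H : R) (f : R -> R) : \bar R :=
  if H < 2^-1 then
    ((H * (1 - 2 * H) / 2)%:E *
     \int[leb]_x \int[leb]_y
       ((f x - f y) ^+ 2 * `|x - y| `^ (2 * H - 2))%:E)%E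
  else if H == 2^-1 then
    (\int[leb]_x (f x ^+ 2)%:E)%E
  else
    ((H * (2 * H - 1))%:E *
     \int[leb]_x \int[leb]_y
       (`|f x| * `|f y| * `|x - y| `^ (2 * H - 2))%:E)%E.

(* X is (a version of) \int f dW^H: the limit in L^2(P) of the integrals of
   step functions converging to f. *)
Definition is_wiener_integral (H : R) (W : R -> {RV P >-> R}) (f : R -> R)
    (X : {RV P >-> R}) : Prop :=
  exists s : nat -> seq (R * R * R),
    [/\ forall n, step_wf (s n),
        integrand_norm2 H (fun x => step_fun (s n) x - f x) @[n --> \oo]
          --> 0%E &
        'E_P[fun w => ((step_integral W (s n) w - X w) ^+ 2)%R]%E @[n --> \oo]
          --> 0%E].

(* X is (a version of) \int_0^t f(s) dv(s) for a process of the form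
   v(s) = \int_0^s g(r) dr + c W^H(s), 0 <= s <= t. The pair (g, c) is
   determined by v up to a Lebesgue-null modification of g. *)
Definition is_integral_dv (H : R) (W : R -> {RV P >-> R}) (t : R)
    (f : R -> R) (v : R -> Omega -> R) (X : {RV P >-> R}) : Prop :=
  exists (g : R -> R) (c : R) (I : {RV P >-> R}),
    [/\ leb.-integrable `[0, t] (EFin \o g),
        leb.-integrable `[0, t] (fun s => (f s * g s)%:E),
        (forall s w, 0 <= s <= t ->
          v s w = \int[leb]_(r in `[0, s]) g r + c * W s w),
        is_wiener_integral H W f I &
        forall w, X w = \int[leb]_(s in `[0, t]) (f s * g s) + c * I w].

Definition cvg_in_distribution (I : Type) (F : set_system I)
    (X : I -> Omega -> R) (Q : set R -> \bar R) : Prop :=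
  forall x : R, {for x, continuous (fun y : R => Q `]-oo, y]%classic)} ->
    P [set w | X i w <= x] @[i --> F] --> Q `]-oo, x]%classic.

(* The k-th Fourier coefficient at time t of the solution of
   du = (A_0 + theta A_1) u dt + M u dW^H, with rho, nu, mu the k-th
   eigenvalues of A_0, A_1, M and a = u_k(0). *)
Definition fourier_coef (H : R) (W : R -> {RV P >-> R})
    (theta rho nu mu a : R) (t : R) (w : Omega) : R :=
  a * expR ((rho + theta * nu) * t - 2^-1 * mu ^+ 2 * t `^ (2 * H)
            + mu * W t w).

End probability.

Section estimator.
Variable R : realType.
Local Notation leb := (@lebesgue_measure R).

Definition Gamma (x : R) : R :=
  \int[leb]_(t in `]0, +oo[) (t `^ (x - 1) * expR (- t)).

(* The library's [beta_fun] only takes natural-number arguments. *)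
Definition Beta (x y : R) : R :=
  \int[leb]_(t in `]0, 1[) (t `^ (x - 1) * (1 - t) `^ (y - 1)).

Variable H : R.

Definition C_H : R :=
  Num.sqrt (Gamma (3 - 2 * H) /
    (2 * H * Gamma (3 / 2 - H) ^+ 3 * Gamma (1 / 2 + H))).

Definition l_H (t s : R) : R :=
  if 0 < s < t then
    C_H * s `^ (1 / 2 - H) * (t - s) `^ (1 / 2 - H)
  else 0.

Definition b1 : R := C_H * Beta (3 / 2 - H) (3 / 2 - H).
Definition b2 : R := C_H * Beta (1 / 2 + H) (3 / 2 - H).

(* The estimator as a function of the observed value vt = \tilde v_k(T). *)
Definition theta_hat (rho nu mu T vt : R) : R :=
  vt / (nu * b1 * T `^ (2 - 2 * H))
  + H * b2 * mu ^+ 2 / (nu * b1 * T `^ (1 - 2 * H))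
  - rho / nu.

End estimator.

(* Main.v *)
Require Import Defs.
From HB Require Import structures.
From mathcomp Require Import all_boot all_order all_algebra.
From mathcomp Require Import all_classical all_reals all_analysis.
From mathcomp Require Import measurable_realfun.
From mathcomp Require Import ring lra.

Set Implicit Arguments.
Unset Strict Implicit.
Unset Printing Implicit Defensive.

Import Order.TTheory GRing.Theory Num.Theory.
Import numFieldNormedType.Exports.

Local Open Scope classical_set_scope.
Local Open Scope ring_scope.

(** Write a = H - 1/2 and let I_T be the Wiener integral of l_H(T, .), so that
    the observation vt(T) is the sum of a deterministic drift and mu I_T. The
    drift is the integral of l_H(T, s) (alpha - mu^2 H s^(2H-1)) over ]0, T[;
    two Beta integrals evaluate it to alpha b1 T^(2-2H) - mu^2 H b2 T, where
    alpha = rho + theta0 nu. The estimator is the expression in vt(T) that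
    solves for theta0 when I_T is neglected, whence
    theta_hat - theta0 = mu I_T / (nu b1 T^(2-2H)) ([theta_hatE]). The drift
    of the observed process is only known through its primitive; it is
    recovered by Lebesgue differentiation ([drift_identification]), after
    observing that the coefficient of W^H must be mu since W^H_T is not
    deterministic.

    All three claims thus concern the centred Gaussian family (I_T), and the
    central fact is E(I_s I_t) = s^(2-2H) for s <= t ([wiener_cov]). It is
    proved by testing I_t against the process first. The derivative in x of
    E(W_x W_r) is H phi_r(x), hence E(I_t W_r) is H times the integral of
    l_H(t, .) phi_r. An identity for the two Abel-type integrals of l_H on
    either side of r ([abel_identity]) shows that this is linear in r on
    [0, t] ([covM_below]). So r |-> E(I_t W_r) has on ]0, s[ a constant
    density, and testing I_s against it gives a constant times the integral of
    l_H(s, .), that is s^(2-2H) once C_H is inserted ([C_H_normalization]).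

    Wiener integrals are only known as L^2 limits of integrals of step
    functions f_n converging to the integrand in a norm which depends on the
    sign of a. Each test above therefore requires that the integral of
    (f_n - l_H) psi tends to 0, for psi = phi_r and psi = the density of
    r |-> E(I_t W_r). When the functions psi decay suitably, this is a weighted
    Cauchy-Schwarz or L^1 estimate ([testable_cvg0]). For H < 1/2 the function
    phi_r may be too singular at r, and the integral of g phi_r is instead
    written as a Gagliardo form over pairs of points separated by the ends of
    ]0, r[ ([gagliardo_cvg]).

    A limit of Gaussian variables is Gaussian with the limiting variance, and
    has the fourth-power tails of a Gaussian ([gauss_limit_law],
    [gauss_limit_tail]). This yields the mean in (1) and the limit laws in (2)
    and (3), where the law of the normalized error does not even depend on T,
    respectively on k. In (3) the integrals attached to the various k are
    versions of the same variable ([wiener_unique]), so the error is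
    mu_k / nu_k times a random variable that does not depend on k. In (2), the time change tau = T^(2-2H) turns (I_T) into a
    process whose increments have variance |tau - sigma|; chaining over dyadic
    points and the Borel-Cantelli lemma show that it is o(tau)
    ([strong_law_of_increments]). *)

(** * Measurability of explicit real functions *)

(** Integrals over intervals are written as integrals over the whole line with
    a 0/1 factor: measurability then follows from the syntax of the integrand,
    and Tonelli's theorem applies without domain conditions. *)
Local Notation "\I[ b ]" := (nat_of_bool b%R)%:R (at level 0, b at level 200, format "\I[ b ]").

Section measurability.
Context d (T : measurableType d) (R : realType).
Implicit Types f g : T -> R.

Lemma measR_D f g : measurable_fun setT f -> measurable_fun setT g ->
  measurable_fun setT (fun x => f x + g x).
Proof. exact: measurable_funD. Qed.

Lemma measR_N f : measurable_fun setT f -> measurable_fun setT (fun x => - f x).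
Proof. by move=> mf; apply: measurableT_comp. Qed.

Lemma measR_M f g : measurable_fun setT f -> measurable_fun setT g ->
  measurable_fun setT (fun x => f x * g x).
Proof. exact: measurable_funM. Qed.

Lemma measR_X f n : measurable_fun setT f ->
  measurable_fun setT (fun x => f x ^+ n).
Proof. exact: measurable_funX. Qed.

Lemma measR_norm f : measurable_fun setT f -> measurable_fun setT (fun x => `|f x|).
Proof. by move=> mf; apply: measurableT_comp. Qed.

Lemma measR_powR f c : measurable_fun setT f ->
  measurable_fun setT (fun x => f x `^ c).
Proof. by move=> mf; apply: (measurableT_comp (measurable_powR c)). Qed.

Lemma measR_expR f : measurable_fun setT f -> measurable_fun setT (fun x => expR (f x)).
Proof. by move=> mf; apply: measurableT_comp. Qed.

Lemma measR_bool (b : T -> bool) : measurable_fun setT b ->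
  measurable_fun setT (fun x => (b x)%:R : R).
Proof.
move=> mb; rewrite [X in measurable_fun _ X](_ : _ = fun x => if b x then 1 else 0).
  exact: measurable_fun_ifT.
by apply/funext => x; case: (b x).
Qed.

Lemma measR_lt f g : measurable_fun setT f -> measurable_fun setT g ->
  measurable_fun setT (fun x => f x < g x).
Proof. exact: measurable_fun_ltr. Qed.

Lemma measR_le f g : measurable_fun setT f -> measurable_fun setT g ->
  measurable_fun setT (fun x => f x <= g x).
Proof. exact: measurable_fun_ler. Qed.

Lemma measR_and (b c : T -> bool) : measurable_fun setT b -> measurable_fun setT c ->
  measurable_fun setT (fun x => b x && c x).
Proof. exact: measurable_and. Qed.

Lemma measR_not (b : T -> bool) : measurable_fun setT b ->
  measurable_fun setT (fun x => ~~ b x).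
Proof. exact: measurable_neg. Qed.

Lemma measR_if (b : T -> bool) f g : measurable_fun setT b ->
  measurable_fun setT f -> measurable_fun setT g ->
  measurable_fun setT (fun x => if b x then f x else g x).
Proof. exact: measurable_fun_ifT. Qed.

Lemma measR_EFin f : measurable_fun setT f -> measurable_fun setT (fun x => (f x)%:E).
Proof. by move=> mf; apply/measurable_EFinP. Qed.

End measurability.

(** Partial applications of the operations arise by eta-reduction. *)
Section measurability_eta.
Variables (R : realType) (c : R).

Lemma measR_lt_cst : measurable_fun [set: R] (Order.lt c).
Proof. exact: (@measR_lt _ R R (fun=> c) id). Qed.

Lemma measR_le_cst : measurable_fun [set: R] (Order.le c).
Proof. exact: (@measR_le _ R R (fun=> c) id). Qed.

Lemma measR_D_cst : measurable_fun [set: R] (GRing.add c).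
Proof. exact: (@measR_D _ R R (fun=> c) id). Qed.

Lemma measR_M_cst : measurable_fun [set: R] (GRing.mul c).
Proof. exact: (@measR_M _ R R (fun=> c) id). Qed.

End measurability_eta.

Ltac meas_step :=
  match goal with
  | |- @measurable_fun _ _ _ _ _ ?f =>
    lazymatch f with
    | (fun x => x) => exact: measurable_id
    | (fun x => fst x) => exact: measurable_fst
    | (fun x => snd x) => exact: measurable_snd
    | fst => exact: measurable_fst
    | snd => exact: measurable_snd
    | Order.lt _ => exact: measR_lt_cst
    | Order.le _ => exact: measR_le_cst
    | GRing.add _ => exact: measR_D_cst
    | GRing.mul _ => exact: measR_M_cst
    | GRing.opp => exact: oppr_measurable
    | Num.norm => exact: normr_measurable
    | expR => exact: measurable_expR
    | (fun _ => ?c) => exact: measurable_cst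
    | (fun x => EFin _) => apply: measR_EFin
    | (fun x => GRing.natmul _ (nat_of_bool _)) => apply: measR_bool
    | (fun x => GRing.add _ _) => apply: measR_D
    | (fun x => GRing.opp _) => apply: measR_N
    | (fun x => GRing.mul _ _) => apply: measR_M
    | (fun x => GRing.exp _ _) => apply: measR_X
    | (fun x => Num.norm _) => apply: measR_norm
    | (fun x => powR _ _) => apply: measR_powR
    | (fun x => expR _) => apply: measR_expR
    | (fun x => Order.lt _ _) => apply: measR_lt
    | (fun x => Order.le _ _) => apply: measR_le
    | (fun x => andb _ _) => apply: measR_and
    | (fun x => negb _) => apply: measR_not
    | (fun x => if _ then _ else _) => apply: measR_if
    end
  end.
Ltac meas := repeat first [ assumption | meas_step ].

(** * Affine changes of variable *)

Section affine.
Variable R : realType.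
Local Notation leb := (@lebesgue_measure R).

Lemma lebesgue_measure_affine (a b : R) (A : set R) : a != 0 -> measurable A ->
  leb A = (`|a|%:E * leb ((fun x => a * x + b)%R @^-1` A))%E.
Proof.
move=> a0 mA.
pose phi := (fun x : measurableTypeR R => a * x + b : measurableTypeR R).
have mphi : measurable_fun setT phi.
  by apply: measR_D; [apply: measR_M|].
have [m mE] : exists m : {measure set (measurableTypeR R) -> \bar R},
    forall A, m A = (`|a|%:E * pushforward leb phi A)%E.
  have [m' m'E] : exists m : {measure set (measurableTypeR R) -> \bar R},
      forall A, m A = pushforward leb phi A.
    by exists (measure_function_pushforward__canonical__measure_function_Measure
      leb mphi).
  by exists (mscale (NngNum (normr_ge0 a)) m') => B; rewrite -m'E.
rewrite -[RHS]mE; apply: lebesgue_measure_unique => // _ [[x y]] _ <-.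
rewrite mE /pushforward /phi/=.
rewrite lebesgue_measure_itv/= lte_fin.
have [a_gt0|a_le0] := ltP 0 a.
  rewrite (_ : _ @^-1` _ = `](x - b) / a, (y - b) / a]%classic); last first.
    apply/seteqP; split=> z /=; rewrite !in_itv/= ltr_pdivrMr// ler_pdivlMr//;
      rewrite ltrBlDr lerBrDr [z * a]mulrC//.
  rewrite lebesgue_measure_itv/= lte_fin ltr_pM2r ?invr_gt0// ltrD2r.
  case: ifPn => _; last by rewrite mule0.
  by rewrite -!EFinD -EFinM gtr0_norm// -mulrBl mulrC divfK//; congr EFin; ring.
have a_lt0 : a < 0 by rewrite lt_neqAle a0.
rewrite (_ : _ @^-1` _ = `[(y - b) / a, (x - b) / a[%classic); last first.
  apply/seteqP; split=> z /=; rewrite !in_itv/= ler_ndivrMr// ltr_ndivlMr//;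
    rewrite ltrBlDr lerBrDr [z * a]mulrC// andbC//.
rewrite lebesgue_measure_itv/= lte_fin ltr_nM2r ?invr_lt0// ltrD2r.
case: ifPn => _; last by rewrite mule0.
rewrite -!EFinD -EFinM ltr0_norm// -mulrBl mulNr mulrC divfK//; congr EFin; ring.
Qed.

Lemma ge0_integral_affine (a b : R) (f : R -> \bar R) : a != 0 ->
  measurable_fun setT f -> (forall x, 0 <= f x)%E ->
  (\int[leb]_x f (a * x + b)%R = `|a|^-1%:E * \int[leb]_x f x)%E.
Proof.
move=> a0 mf f0.
pose phi := (fun x : measurableTypeR R => a * x + b : measurableTypeR R).
have mphi : measurable_fun setT phi.
  by apply: measR_D; [apply: measR_M|].
have -> : (\int[leb]_x f x = `|a|%:E * \int[leb]_x f (a * x + b)%R)%E.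
  have [m mE] : exists m : {measure set (measurableTypeR R) -> \bar R},
      forall A, m A = pushforward leb phi A.
    by exists (measure_function_pushforward__canonical__measure_function_Measure
      leb mphi).
  transitivity (\int[mscale (NngNum (normr_ge0 a)) m]_x f x)%E.
    apply: eq_measure_integral => // A mA _.
    by rewrite [LHS](lebesgue_measure_affine b a0 mA) /mscale/=; congr (_ * _)%E.
  rewrite ge0_integral_mscale//; congr (_ * _)%E.
  rewrite (eq_measure_integral (pushforward leb phi)).
    by rewrite ge0_integral_pushforward.
  by move=> A mA _; rewrite mE.
by rewrite muleA -EFinM mulVf ?mul1e// normr_eq0.
Qed.

Lemma ge0_integral_shift (b : R) (f : R -> \bar R) :
  measurable_fun setT f -> (forall x, 0 <= f x)%E ->
  (\int[leb]_x f (x + b)%R = \int[leb]_x f x)%E.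
Proof.
move=> mf f0; rewrite -[RHS]mul1e -[in RHS](invr1 R) -[in RHS](normr1 R).
rewrite -(@ge0_integral_affine 1 b) ?oner_eq0//.
by apply: eq_integral => x _; rewrite mul1r.
Qed.

End affine.

(** * Integrals of powers *)

Section power_integrals.
Variable R : realType.
Local Notation leb := (@lebesgue_measure R).
Implicit Types c u v : R.

(** Bridge between an integral over a set and its form with a 0/1 factor. *)
Lemma integral_ind d (T : measurableType d) (m : {measure set T -> \bar R}) (D : set T)
    (b : T -> bool) (f : T -> R) : (forall x, D x <-> b x) ->
  (\int[m]_x (\I[b x] * f x)%:E = \int[m]_(x in D) (f x)%:E)%E.
Proof.
move=> Db; rewrite [RHS]integral_mkcond; apply: eq_integral => x _.
rewrite patchE; case: ifPn => [/set_mem/Db ->|]; first by rewrite mul1r.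
by move=> /negP xD; case: (boolP (b x)) => [/Db/mem_set//|_]; rewrite mul0r.
Qed.

Lemma derivable_powR_gt0 c x : 0 < x -> derivable (@powR R ^~ c) x 1.
Proof. by move=> x0; apply: derivable_powR; rewrite in_itv/= x0. Qed.

Lemma continuous_powR_gt0 c x : 0 < x -> {for x, continuous (@powR R ^~ c)}.
Proof.
move=> x0; apply: differentiable_continuous.
exact/derivable1_diffP/derivable_powR_gt0.
Qed.

Let der_pow c (x : R) : c != 0 -> 0 < x -> is_derive x 1 (fun x => x `^ c / c) (x `^ (c - 1)).
Proof.
move=> c0 x0.
have -> : (fun x => x `^ c / c) = c^-1 \*: (@powR R ^~ c).
  by apply/funext => z /=; rewrite /GRing.scale/= mulrC.
have := is_deriveZ _ (@is_derive1_powR R c x x0) => /(_ c^-1).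
by rewrite /GRing.scale/= mulrA mulVf// mul1r.
Qed.

Lemma integral_powR_cc c u v : c != 0 -> 0 < u -> u < v ->
  (\int[leb]_(x in `[u, v]) (x `^ (c - 1))%:E = ((v `^ c - u `^ c) / c)%:E)%E.
Proof.
move=> c0 u0 uv.
have cont e x : u <= x -> {for x, continuous (@powR R ^~ e)}.
  by move=> ux; apply: continuous_powR_gt0; exact: lt_le_trans ux.
have contF x : u <= x -> {for x, continuous (fun x => x `^ c / c)}.
  by move=> ux; apply: continuousM; [exact: cont|exact: cvg_cst].
rewrite (@continuous_FTC2 _ _ (fun x => x `^ c / c) u v)//.
- by rewrite -EFinB mulrBl.
- by apply: continuous_in_subspaceT => x /set_mem/=; rewrite in_itv/= => /andP[ux _]; exact: cont.
- split.
  + move=> x; rewrite in_itv/= => /andP[ux _].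
    by have [] := der_pow c0 (lt_trans u0 ux).
  + by apply: cvg_at_right_filter; apply: contF.
  + by apply: cvg_at_left_filter; apply: contF; exact: ltW.
- move=> x; rewrite in_itv/= => /andP[ux _].
  by rewrite derive1E; have [_ ->] := der_pow c0 (lt_trans u0 ux).
Qed.

Lemma integral_powR c u v : c != 0 -> 0 < u -> u <= v ->
  (\int[leb]_x (\I[u < x < v] * x `^ (c - 1))%:E = ((v `^ c - u `^ c) / c)%:E)%E.
Proof.
move=> c0 u0; rewrite le_eqVlt => /predU1P[<-|uv].
  rewrite subrr mul0r integral0_eq// => x _.
  by have [ux|] := ltP u x; rewrite ?mul0r//= ltNge ltW//= mul0r.
rewrite (@integral_ind _ (measurableTypeR R) leb `]u, v[%classic); last by move=> x /=; rewrite in_itv.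
rewrite -integral_powR_cc// integral_itv_bndoo//.
by apply: measurable_funTS; meas.
Qed.

(** The integrand may be unbounded at 0, where the fundamental theorem of
    calculus does not apply; the interval is exhausted from the right. *)
Lemma integral_powR0 c v : 0 < c -> 0 <= v ->
  (\int[leb]_x (\I[0 < x < v] * x `^ (c - 1))%:E = (v `^ c / c)%:E)%E.
Proof.
move=> c0; rewrite le_eqVlt => /predU1P[<-|v0].
  rewrite powR0 ?gt_eqF// mul0r integral0_eq// => x _.
  by have [ux|] := ltP 0 x; rewrite ?mul0r//= ltNge ltW//= mul0r.
rewrite (@integral_ind _ (measurableTypeR R) leb `]0, v[%classic); last by move=> x /=; rewrite in_itv.
pose F n := `]v / n.+2%:R, v[%classic : set R.
have FU : `]0, v[%classic = \bigcup_n F n.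
  apply/seteqP; split=> x /=; rewrite in_itv/=.
    move=> /andP[x0 xv].
    exists (Num.truncn (v / x)) => //=; rewrite /F/= in_itv/= xv andbT.
    rewrite ltr_pdivrMr// mulrC -ltr_pdivrMr//.
    by rewrite (lt_le_trans (truncnS_gt _))// ler_nat.
  by move=> [n _]; rewrite /F/= !in_itv/= => /andP[+ ->]; rewrite andbT; apply: lt_trans; rewrite divr_gt0.
have Fc : (\int[leb]_(x in F n) (x `^ (c - 1))%:E)%E @[n --> \oo] -->
    (\int[leb]_(x in \bigcup_n F n) (x `^ (c - 1))%:E)%E.
  apply: ge0_nondecreasing_set_cvg_integral.
  - move=> n m nm; apply/subsetPset => x; rewrite /F/= !in_itv/= => /andP[+ ->].
    rewrite andbT; apply: le_lt_trans; rewrite ler_pM2l// lef_pV2 ?posrE//.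
    by rewrite ler_nat !ltnS.
  - by move=> n; exact: measurable_itv.
  - by move=> n; apply: measurable_funTS; meas.
  - by move=> n x _; rewrite lee_fin powR_ge0.
rewrite FU; apply: cvg_unique Fc _ => //.
rewrite (_ : (fun n => _) = fun n => ((v `^ c - (v / n.+2%:R) `^ c) / c)%:E); last first.
  apply/funext => n.
  rewrite -(@integral_powR c) ?gt_eqF//; last 2 first.
  - by rewrite divr_gt0.
  - by rewrite ler_pdivrMr// ler_pMr// ler1n.
  by rewrite (@integral_ind _ (measurableTypeR R) leb (F n))// => x; rewrite /F /= in_itv.
apply: cvg_EFin; first by near=> n.
apply: cvgM; last exact: cvg_cst.
rewrite -[X in _ --> X]subr0; apply: cvgB; first exact: cvg_cst.
have -> : (fun n => (v / n.+2%:R) `^ c) =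
    (fun n => v `^ c * (n.+2%:R^-1 `^ c)).
  by apply/funext => n; rewrite powRM// ltW.
rewrite -[X in _ --> X](mulr0 (v `^ c)); apply: cvgM; first exact: cvg_cst.
apply: (cvg_at_rightP _ _ _).1 (powR_cvg0 c0) (fun n => n.+2%:R^-1) _.
split=> [n|]; first by rewrite invr_gt0.
by have := @cvg_harmonic R; rewrite -(@cvg_shiftS _ (@harmonic R)).
Unshelve. all: by end_near. Qed.

Lemma integral_powR_itv c u v : c != 0 -> (0 < c) || (0 < u) -> 0 <= u -> u <= v ->
  (\int[leb]_x (\I[u < x < v] * x `^ (c - 1))%:E = ((v `^ c - u `^ c) / c)%:E)%E.
Proof.
move=> c0 cu; rewrite le_eqVlt => /predU1P[u0|u0]; last exact: integral_powR.
move: cu; rewrite -u0 ltxx orbF => c_gt0 v0.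
by rewrite integral_powR0// powR0// subr0.
Qed.

Lemma integral_powR_right c y u v : c != 0 -> (0 < c) || (y < u) -> y <= u -> u <= v ->
  (\int[leb]_x (\I[u < x < v] * (x - y) `^ (c - 1))%:E =
   (((v - y) `^ c - (u - y) `^ c) / c)%:E)%E.
Proof.
move=> c0 cu yu uv; rewrite -(@integral_powR_itv c (u - y) (v - y)); last 4 first.
- by [].
- by rewrite subr_gt0.
- by rewrite subr_ge0.
- by rewrite lerB.
have <- := @ge0_integral_shift R (- y)
  (fun x => (\I[u - y < x < v - y] * x `^ (c - 1))%:E).
- by apply: eq_integral => x _; rewrite !ltrD2r.
- by meas.
- by move=> x; rewrite lee_fin mulr_ge0 ?powR_ge0.
Qed.

Lemma integral_powR_left c y u v : c != 0 -> (0 < c) || (v < y) -> v <= y -> u <= v ->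
  (\int[leb]_x (\I[u < x < v] * (y - x) `^ (c - 1))%:E =
   (((y - u) `^ c - (y - v) `^ c) / c)%:E)%E.
Proof.
move=> c0 cu yu uv.
rewrite -(@integral_powR_itv c (y - v) (y - u)); last 4 first.
- by [].
- by rewrite subr_gt0.
- by rewrite subr_ge0.
- by rewrite lerB.
have := @ge0_integral_affine R (-1) y
  (fun x => (\I[y - v < x < y - u] * x `^ (c - 1))%:E).
rewrite normrN1 invr1 mul1e => <-.
- apply: eq_integral => x _; have -> : -1 * x + y = y - x by ring.
  by rewrite !ltrD2l !ltrN2 andbC.
- by rewrite oppr_eq0 oner_eq0.
- by meas.
- by move=> x; rewrite lee_fin mulr_ge0 ?powR_ge0.
Qed.

Lemma integral_powR_tail c z : 0 < c -> 0 < z ->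
  (\int[leb]_x (\I[z < x] * x `^ (- c - 1))%:E = (z `^ (- c) / c)%:E)%E.
Proof.
move=> c0 z0.
have Nc0 : - c != 0 by rewrite oppr_eq0 gt_eqF.
have cont e x : z <= x -> {for x, continuous (@powR R ^~ e)}.
  by move=> ux; apply: continuous_powR_gt0; exact: lt_le_trans ux.
rewrite (@integral_ind _ (measurableTypeR R) leb `]z, +oo[%classic); last first.
  by move=> x /=; rewrite in_itv/= andbT.
rewrite integral_itv_obnd_cbnd; last by apply: measurable_funTS; meas.
rewrite (@ge0_continuous_FTC2y _ _ (fun x => x `^ (- c) / (- c)) z 0).
- by rewrite -EFinB sub0r invrN mulrN opprK.
- by move=> x _; exact: powR_ge0.
- by apply: continuous_in_subspaceT => x /set_mem/=; rewrite in_itv/= andbT; exact: cont.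
- rewrite -[X in _ --> X](mul0r (- c)^-1); apply: cvgM; last exact: cvg_cst.
  have : (fun x : R => x `^ (-c)) @ +oo --> (0 : R).
    have -> : (fun x : R => x `^ (-c)) = (fun x => (x `^ c)^-1).
      by apply/funext => x; rewrite powRN.
    apply/gtr0_cvgV0; first by near=> x; rewrite powR_gt0.
    apply/cvgryPge => A; near=> x.
    apply: (@le_trans _ _ (((`|A| + 1) `^ c^-1) `^ c)).
      rewrite -powRrM mulVf ?gt_eqF// powRr1 ?addr_ge0//.
      by rewrite (le_trans (ler_norm A))// lerDl.
    by rewrite ge0_ler_powR ?nnegrE ?powR_ge0 ?(ltW c0).
  by [].
- by move=> x zx; have [] := der_pow Nc0 (lt_trans z0 zx).
- apply: cvg_at_right_filter.
  by apply: cvgM; [exact: cont|exact: cvg_cst].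
- move=> x; rewrite in_itv/= andbT => zx.
  by rewrite derive1E; have [_ ->] := der_pow Nc0 (lt_trans z0 zx).
Unshelve. all: by end_near. Qed.

End power_integrals.

(** * The Gamma and Beta integrals *)

Section nonneg_integrals.
Context d (T : measurableType d) (R : realType) (m : {measure set T -> \bar R}).
Implicit Types f g : T -> R.

Lemma int_ge0 f : (forall x, 0 <= f x) -> (0 <= \int[m]_x (f x)%:E)%E.
Proof. by move=> f0; apply: integral_ge0 => x _; rewrite lee_fin. Qed.

Lemma int_le f g : measurable_fun setT f -> measurable_fun setT g ->
  (forall x, 0 <= f x) -> (forall x, f x <= g x) ->
  (\int[m]_x (f x)%:E <= \int[m]_x (g x)%:E)%E.
Proof.
move=> mf mg f0 fg.
have g0 x : 0 <= g x by exact: le_trans (fg x).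
by apply: ge0_le_integral => //; do ?exact: measR_EFin; move=> x _; rewrite lee_fin.
Qed.

Lemma int_Zl (k : R) f : 0 <= k -> measurable_fun setT f -> (forall x, 0 <= f x) ->
  (\int[m]_x (k * f x)%:E = k%:E * \int[m]_x (f x)%:E)%E.
Proof.
move=> k0 mf f0; under eq_integral do rewrite EFinM.
apply: ge0_integralZl_EFin => //; first by move=> x _; rewrite lee_fin.
exact: measR_EFin.
Qed.

Lemma int_D f g : measurable_fun setT f -> measurable_fun setT g ->
  (forall x, 0 <= f x) -> (forall x, 0 <= g x) ->
  (\int[m]_x (f x + g x)%:E = \int[m]_x (f x)%:E + \int[m]_x (g x)%:E)%E.
Proof.
move=> mf mg f0 g0; under eq_integral do rewrite EFinD.
apply: ge0_integralD => //; try by move=> x _; rewrite lee_fin.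
- exact: measR_EFin.
- exact: measR_EFin.
Qed.

End nonneg_integrals.

Section tonelli.
Variable R : realType.
Local Notation leb := (@lebesgue_measure R).

Lemma tonelli (f : R -> R -> R) : measurable_fun setT (fun z : R * R => f z.1 z.2) ->
  (forall x y, 0 <= f x y) ->
  (\int[leb]_x \int[leb]_y (f x y)%:E = \int[leb]_y \int[leb]_x (f x y)%:E)%E.
Proof.
move=> mf f0.
have := @fubini_tonelli _ _ (measurableTypeR R) (measurableTypeR R) R leb leb
  (fun z => (f z.1 z.2)%:E).
by apply; [exact: measR_EFin|move=> z; rewrite lee_fin].
Qed.

End tonelli.

Section gamma_beta.
Variable R : realType.
Local Notation leb := (@lebesgue_measure R).
Implicit Types p q t : R.

(** The Euler integrals are handled in the extended reals, where Tonelli's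
    theorem needs no integrability; finiteness comes afterwards. *)
Definition Gamma_integrand p (x : R) : R := \I[0 < x] * (x `^ (p - 1) * expR (- x)).

Definition Beta_integrand p q (x : R) : R :=
  \I[0 < x < 1] * (x `^ (p - 1) * (1 - x) `^ (q - 1)).

Lemma measurable_Gamma_integrand p : measurable_fun setT (Gamma_integrand p).
Proof. by rewrite /Gamma_integrand; meas. Qed.

Lemma measurable_Beta_integrand p q : measurable_fun setT (Beta_integrand p q).
Proof. by rewrite /Beta_integrand; meas. Qed.

Lemma Gamma_integrand_ge0 p x : 0 <= Gamma_integrand p x.
Proof. by rewrite !mulr_ge0 ?powR_ge0 ?expR_ge0. Qed.

Lemma Beta_integrand_ge0 p q x : 0 <= Beta_integrand p q x.
Proof. by rewrite !mulr_ge0 ?powR_ge0. Qed.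

Definition eGamma p := (\int[leb]_x (Gamma_integrand p x)%:E)%E.
Definition eBeta p q := (\int[leb]_x (Beta_integrand p q x)%:E)%E.

Lemma GammaE p : Gamma p = fine (eGamma p).
Proof.
rewrite /Gamma /Rintegral /eGamma /Gamma_integrand; congr fine.
rewrite (@integral_ind R _ (measurableTypeR R) leb `]0, +oo[%classic)//.
by move=> x /=; rewrite in_itv/= andbT.
Qed.

Lemma BetaE p q : Beta p q = fine (eBeta p q).
Proof.
rewrite /Beta /Rintegral /eBeta /Beta_integrand; congr fine.
rewrite (@integral_ind R _ (measurableTypeR R) leb `]0, 1[%classic)//.
Qed.

Lemma powR_expRN_le (c x : R) : 0 < c -> 0 < x -> x `^ c * expR (- x) <= c `^ c.
Proof.
move=> c0 x0; rewrite expRN ler_pdivrMr ?expR_gt0//.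
have -> : expR x = expR (x / c) `^ c by rewrite -expRM divfK ?gt_eqF.
rewrite -powRM ?expR_ge0 ?(ltW c0)// ge0_ler_powR ?nnegrE ?(ltW c0) ?(ltW x0)//.
  by rewrite mulr_ge0 ?expR_ge0 ?(ltW c0).
rewrite -ler_pdivrMl// mulrC; apply: le_trans (expR_ge1Dx _).
by rewrite lerDr.
Qed.

Lemma eGamma_lty p : 0 < p -> (eGamma p < +oo)%E.
Proof.
move=> p0; set C := (p + 1) `^ (p + 1).
apply: (@le_lt_trans _ _ (\int[leb]_x (\I[0 < x < 1] * x `^ (p - 1) +
    C * (\I[2^-1 < x] * x `^ (- 1 - 1)))%:E)%E).
  apply: int_le; first exact: measurable_Gamma_integrand.
  - by meas.
  - exact: Gamma_integrand_ge0.
  move=> x; rewrite /Gamma_integrand; have [x0|x0] := ltP 0 x; last first.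
    by rewrite !mul0r addr_ge0// !mulr_ge0// powR_ge0.
  have [x1|x1] := ltP x 1; rewrite /= ?mul1r ?mul0r ?add0r.
    rewrite ler_wpDr ?mulr_ge0 ?powR_ge0//.
    by rewrite ler_piMr ?powR_ge0// expR_le1 oppr_le0 ltW.
  have -> : 2^-1 < x by lra.
  rewrite mul1r -ler_pdivrMr ?powR_gt0// mulrAC -powRB; last first.
    by rewrite (gt_eqF x0) implybT.
  rewrite (_ : p - 1 - (-1 - 1) = p + 1); last by ring.
  by rewrite powR_expRN_le// addr_gt0.
rewrite int_D; last 4 first.
- by meas.
- by meas.
- by move=> x; rewrite mulr_ge0// powR_ge0.
- by move=> x; rewrite !mulr_ge0// powR_ge0.
rewrite int_Zl; last 3 first.
- exact: powR_ge0.
- by meas.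
- by move=> x; rewrite mulr_ge0// powR_ge0.
by rewrite integral_powR0// integral_powR_tail// -EFinM -EFinD ltry.
Qed.

Lemma eGamma_gt0 p : 0 < p -> (0 < eGamma p)%E.
Proof.
move=> p0; apply: (@lt_le_trans _ _ (\int[leb]_x
    (expR (- 2) * 2^-1 * (\I[1 < x < 2] * x `^ (1 - 1)))%:E)%E).
  rewrite int_Zl; last 3 first.
  - by rewrite mulr_ge0// expR_ge0.
  - by meas.
  - by move=> x; rewrite mulr_ge0// powR_ge0.
  rewrite integral_powR ?oner_eq0// ?ler1n// -EFinM lte_fin.
  by rewrite !powRr1//; rewrite !mulr_gt0 ?expR_gt0//; lra.
apply: int_le.
- by meas.
- exact: measurable_Gamma_integrand.
- by move=> x; rewrite !mulr_ge0// ?powR_ge0// expR_ge0.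
move=> x; rewrite subrr powRr0 mulr1.
have [/andP[x1 x2]|_] := boolP (1 < x < 2); last first.
  by rewrite mulr0 Gamma_integrand_ge0.
rewrite /Gamma_integrand (lt_trans ltr01 x1) mulr1 mul1r mulrC.
rewrite ler_pM ?expR_ge0//; last by rewrite ler_expR lerN2 ltW.
apply: (@le_trans _ _ (x `^ (-1))).
  rewrite powR_inv1; last by lra.
  by rewrite lef_pV2 ?posrE; lra.
by rewrite ler_powR; lra.
Qed.

(** Substituting x = t y. *)
Lemma integral_Beta_scale p q t : 0 < t ->
  (\int[leb]_x (\I[0 < x < t] * (x `^ (p - 1) * (t - x) `^ (q - 1)))%:E =
   (t `^ (p + q - 1))%:E * eBeta p q)%E.
Proof.
move=> t0.
pose f (x : R) : R := \I[0 < x < t] * (x `^ (p - 1) * (t - x) `^ (q - 1)).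
have f0 x : 0 <= f x by rewrite !mulr_ge0// powR_ge0.
have mf : measurable_fun setT f by rewrite /f; meas.
have tE : (\int[leb]_x (f x)%:E = t%:E * \int[leb]_x (f (t * x + 0)%R)%:E)%E.
  have -> := @ge0_integral_affine R t 0 (fun x => (f x)%:E); last 3 first.
  - by rewrite gt_eqF.
  - exact: measR_EFin.
  - by move=> x; rewrite lee_fin.
  by rewrite muleA -EFinM gtr0_norm// divff ?gt_eqF// mul1e.
rewrite [LHS]tE /eBeta -int_Zl; last 3 first.
- exact: ltW.
- by rewrite /f; meas.
- by [].
rewrite -int_Zl; last 3 first.
- exact: powR_ge0.
- exact: measurable_Beta_integrand.
- exact: Beta_integrand_ge0.
apply: eq_integral => x _; congr EFin.
rewrite /f /Beta_integrand addr0 pmulr_rgt0// gtr_pMr//.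
have [/andP[x0 x1]|_] := boolP (0 < x < 1); last by rewrite !mul0r !mulr0.
rewrite !mul1r.
have -> : t - t * x = t * (1 - x) by ring.
rewrite !powRM ?(ltW t0) ?(ltW x0)//; last by lra.
rewrite (_ : p + q - 1 = 1 + (p - 1) + (q - 1)); last by ring.
rewrite (@powRD _ t (1 + (p - 1))) ?(gt_eqF t0) ?implybT//.
rewrite (@powRD _ t 1) ?(gt_eqF t0) ?implybT//.
by rewrite (powRr1 (ltW t0)); ring.
Qed.

(** Euler's argument: in the product of the two Gamma integrals put z = x + y
    and exchange the integrals; the inner one is a scaled Beta integral. *)
Lemma eGammaM p q : (eGamma p * eGamma q = eBeta p q * eGamma (p + q))%E.
Proof.
have mG := measurable_Gamma_integrand.
pose F (x z : R) := Gamma_integrand p x * Gamma_integrand q (z - x).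
transitivity (\int[leb]_x \int[leb]_z (F x z)%:E)%E.
  transitivity (\int[leb]_x ((Gamma_integrand p x)%:E * eGamma q))%E.
    rewrite ge0_integralZr; last 4 first.
    - exact: measurableT.
    - by apply: measR_EFin; exact: measurable_Gamma_integrand.
    - by move=> x _; rewrite lee_fin Gamma_integrand_ge0.
    - by apply: int_ge0 => x; exact: Gamma_integrand_ge0.
    by [].
  apply: eq_integral => x _.
  rewrite /F int_Zl; last 3 first.
  - exact: Gamma_integrand_ge0.
  - by apply: (measurableT_comp (mG q)); meas.
  - by move=> z; exact: Gamma_integrand_ge0.
  congr (_ * _)%E.
  rewrite (@ge0_integral_shift R (- x) (fun z => (Gamma_integrand q z)%:E))//.
  - by apply: measR_EFin; exact: measurable_Gamma_integrand.
  - by move=> z; rewrite lee_fin Gamma_integrand_ge0.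
rewrite tonelli; last 2 first.
- rewrite /F /Gamma_integrand; meas.
- by move=> x z; rewrite mulr_ge0// Gamma_integrand_ge0.
transitivity (\int[leb]_z (eBeta p q * (Gamma_integrand (p + q) z)%:E))%E; last first.
  rewrite ge0_integralZl; first by [].
  - exact: measurableT.
  - by apply: measR_EFin; exact: measurable_Gamma_integrand.
  - by move=> x _; rewrite lee_fin Gamma_integrand_ge0.
  - by apply: int_ge0 => x; exact: Beta_integrand_ge0.
apply: eq_integral => z _.
have [z0|z0] := ltP 0 z; last first.
  rewrite [Gamma_integrand (p + q) z]/Gamma_integrand ltNge z0 mul0r mule0.
  rewrite integral0_eq// => x _; rewrite /F /Gamma_integrand subr_gt0.
  have [x0|] := ltP 0 x; last by rewrite !mul0r.
  by rewrite (ltNge x) (le_trans z0 (ltW x0)) mul0r mulr0.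
rewrite muleC /Gamma_integrand z0 mul1r mulrC EFinM -muleA.
rewrite -(integral_Beta_scale p q z0) -int_Zl; last 3 first.
- exact: expR_ge0.
- by meas.
- by move=> x; rewrite !mulr_ge0// powR_ge0.
apply: eq_integral => x _; congr EFin; rewrite /F /Gamma_integrand subr_gt0.
have [x0|] := ltP 0 x; last by rewrite !mul0r mulr0.
have [xz|] := ltP x z; last by rewrite !mul0r !mulr0.
have -> : expR (- z) = expR (- x) * expR (- (z - x)) by rewrite -expRD; congr expR; ring.
by rewrite !mul1r; ring.
Qed.

(** Read off from the product formula: an infinite Beta integral would make a
    product of finite Gamma integrals infinite. *)
Lemma eBeta_lty p q : 0 < p -> 0 < q -> (eBeta p q < +oo)%E.
Proof.
move=> p0 q0; rewrite ltNge leye_eq; apply/negP => /eqP B.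
have := eGammaM p q; rewrite B gt0_mulye ?eGamma_gt0 ?addr_gt0// => G.
suff : (eGamma p * eGamma q < +oo)%E by rewrite G.
by apply: lte_mul_pinfty; rewrite ?ge0_fin_numE ?eGamma_lty// ltW// eGamma_gt0.
Qed.

Lemma eBeta_fin p q : 0 < p -> 0 < q -> eBeta p q = (Beta p q)%:E.
Proof.
move=> p0 q0; rewrite BetaE fineK// ge0_fin_numE ?eBeta_lty//.
by apply: int_ge0 => x; exact: Beta_integrand_ge0.
Qed.

Lemma eGamma_fin p : 0 < p -> eGamma p = (Gamma p)%:E.
Proof.
move=> p0; rewrite GammaE fineK// ge0_fin_numE ?eGamma_lty//.
by apply: int_ge0 => x; exact: Gamma_integrand_ge0.
Qed.

Lemma Gamma_gt0 p : 0 < p -> 0 < Gamma p.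
Proof. by move=> p0; rewrite -lte_fin -eGamma_fin// eGamma_gt0. Qed.

Lemma GammaM p q : 0 < p -> 0 < q -> Gamma p * Gamma q = Beta p q * Gamma (p + q).
Proof.
move=> p0 q0; move: (eGammaM p q).
rewrite (eGamma_fin p0) (eGamma_fin q0) (eGamma_fin (addr_gt0 p0 q0)).
by rewrite (eBeta_fin p0 q0) -!EFinM => -[].
Qed.

Lemma Beta_gt0 p q : 0 < p -> 0 < q -> 0 < Beta p q.
Proof.
move=> p0 q0; have pq0 : 0 < Gamma (p + q) by rewrite Gamma_gt0 ?addr_gt0.
by rewrite -(pmulr_lgt0 _ pq0) -GammaM// mulr_gt0 ?Gamma_gt0.
Qed.

Lemma Gamma1 : Gamma 1 = 1 :> R.
Proof.
apply: EFin_inj; rewrite -eGamma_fin// -(integral_exponential_pdf (@ltr01 R)).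
rewrite /eGamma /Gamma_integrand.
rewrite (@integral_ind R _ (measurableTypeR R) leb `]0, +oo[%classic); last first.
  by move=> x /=; rewrite in_itv/= andbT.
rewrite integral_itv_obnd_cbnd; last by apply: measurable_funTS; meas.
rewrite integral_mkcond; apply: eq_integral => x _.
rewrite /exponential_pdf !patchE; case: ifP => // _.
by rewrite subrr powRr0 mul1r mul1r mulN1r.
Qed.

Lemma Gamma2 : Gamma 2 = 1 :> R.
Proof.
have B11 : Beta 1 1 = 1 :> R.
  apply: EFin_inj; rewrite -eBeta_fin ?ltr01//.
  transitivity (\int[leb]_x (\I[0 < x < 1] * x `^ (1 - 1))%:E)%E.
    by apply: eq_integral => x _; rewrite /Beta_integrand subrr !powRr0 mul1r.
  by rewrite integral_powR0// powRr1// divr1.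
have := @GammaM 1 1 ltr01 ltr01; rewrite Gamma1 B11 mulr1 mul1r.
by rewrite (_ : 1 + 1 = 2).
Qed.

End gamma_beta.

(** * An identity for two Abel-type integrals *)

Section abel_identity.
Variable R : realType.
Local Notation leb := (@lebesgue_measure R).

(** The kernel l_H without its constant, for a = H - 1/2. *)
Definition ell (a t x : R) : R := \I[0 < x < t] * (x `^ (- a) * (t - x) `^ (- a)).

Lemma ell_ge0 a t x : 0 <= ell a t x.
Proof. by rewrite !mulr_ge0// powR_ge0. Qed.

Lemma measurable_ell a t : measurable_fun setT (ell a t).
Proof. by rewrite /ell; meas. Qed.

(** The two halves of the kernel tested against |x - r|^(2a). *)
Definition ellL a t r x : R := \I[x < r] * (ell a t x * (r - x) `^ (2 * a)).
Definition ellR a t r x : R := \I[r < x] * (ell a t x * (x - r) `^ (2 * a)).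

Lemma ellL_ge0 a t r x : 0 <= ellL a t r x.
Proof. by rewrite !mulr_ge0// ?powR_ge0// ell_ge0. Qed.

Lemma ellR_ge0 a t r x : 0 <= ellR a t r x.
Proof. by rewrite !mulr_ge0// ?powR_ge0// ell_ge0. Qed.

Lemma measurable_ellL a t r : measurable_fun setT (ellL a t r).
Proof. by rewrite /ellL /ell; meas. Qed.

Lemma measurable_ellR a t r : measurable_fun setT (ellR a t r).
Proof. by rewrite /ellR /ell; meas. Qed.

(** The roots in x of (x - r)^2 = z x (t - x). They surround r and stay in
    [0, t], and their sum is free of the discriminant. The inverse of 1 + z is
    written as a power to keep the roots syntactically measurable in z. *)
Section roots.
Variables (t r z : R).
Hypotheses (r0 : 0 <= r) (rt : r <= t) (z0 : 0 < z).

Definition disc := Num.sqrt (z ^+ 2 * t ^+ 2 + 4 * z * r * (t - r)).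
Definition rootL := (2 * r + z * t - disc) * (2^-1 * (1 + z) `^ (-1)).
Definition rootR := (2 * r + z * t + disc) * (2^-1 * (1 + z) `^ (-1)).

Let inv1z : (1 + z) `^ (-1) = (1 + z)^-1.
Proof. by rewrite powR_inv1// ltW// addr_gt0. Qed.

Let z1 : 1 + z != 0. Proof. by rewrite gt_eqF// addr_gt0. Qed.

Let disc2 : disc ^+ 2 = z ^+ 2 * t ^+ 2 + 4 * z * r * (t - r).
Proof.
by rewrite sqr_sqrtr// addr_ge0 ?(mulr_ge0 (sqr_ge0 _) (sqr_ge0 _))// !mulr_ge0 ?subr_ge0// ltW.
Qed.

Lemma root_factor x :
  (x - r) ^+ 2 - z * (x * (t - x)) = (1 + z) * ((x - rootL) * (x - rootR)).
Proof.
rewrite /rootL /rootR inv1z.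
have -> : (1 + z) * ((x - (2 * r + z * t - disc) * (2^-1 * (1 + z)^-1)) *
      (x - (2 * r + z * t + disc) * (2^-1 * (1 + z)^-1))) =
  (1 + z) * x ^+ 2 - (2 * r + z * t) * x +
   ((2 * r + z * t) ^+ 2 - disc ^+ 2) * (4^-1 * (1 + z)^-1) by field.
rewrite disc2; field.
exact: z1.
Qed.

Lemma rootD : rootL + rootR = (2 * r + z * t) * (1 + z) `^ (-1).
Proof. by rewrite /rootL /rootR; field. Qed.

Let pos1z : 0 < 1 + z. Proof. by rewrite addr_gt0. Qed.

Lemma rootLR : rootL <= rootR.
Proof.
rewrite ler_pM2r; last by rewrite mulr_gt0// powR_gt0.
by rewrite lerD2l (le_trans (y := 0))// ?oppr_le0 ?sqrtr_ge0.
Qed.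

Lemma rootL_ge0 : 0 <= rootL.
Proof.
have := root_factor 0; rewrite mul0r mulr0 subr0 !sub0r mulrNN sqrrN => E.
have : 0 <= rootL * rootR by rewrite -(pmulr_rge0 _ pos1z) -E sqr_ge0.
have : 0 <= rootL + rootR.
  by rewrite rootD mulr_ge0 ?powR_ge0// addr_ge0 ?mulr_ge0 ?(ltW z0)// (le_trans r0).
have := rootLR; nra.
Qed.

Lemma root_between : rootL <= r <= rootR.
Proof.
have := root_factor r; rewrite subrr expr0n sub0r => E.
have : (r - rootL) * (r - rootR) <= 0.
  by rewrite -(pmulr_rle0 _ pos1z) -E oppr_le0 !mulr_ge0 ?subr_ge0// ltW.
have := rootLR; nra.
Qed.

Lemma rootR_le : rootR <= t.
Proof.
have := root_factor t; rewrite subrr !mulr0 subr0 => E.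
have : 0 <= (t - rootL) * (t - rootR) by rewrite -(pmulr_rge0 _ pos1z) -E sqr_ge0.
have : 0 <= (t - rootL) + (t - rootR).
  have -> : (t - rootL) + (t - rootR) = (2 * t + z * t - 2 * r) * (1 + z) `^ (-1).
    have -> : (t - rootL) + (t - rootR) = 2 * t - (rootL + rootR) by ring.
    by rewrite rootD inv1z; field.
  have zt : 0 <= z * t by rewrite mulr_ge0 ?(ltW z0)// (le_trans r0).
  rewrite mulr_ge0 ?powR_ge0//.
  have -> : 2 * t + z * t - 2 * r = 2 * (t - r) + z * t by ring.
  by rewrite addr_ge0// mulr_ge0// subr_ge0.
have := rootLR; nra.
Qed.

Lemma root_sublevel x : ((x - r) ^+ 2 < z * (x * (t - x))) = (rootL < x < rootR).
Proof.
rewrite -subr_lt0 root_factor pmulr_rlt0//; have LR := rootLR.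
apply/idP/idP => [h|/andP[]]; last by nra.
by apply/andP; split; rewrite ltNge; apply/negP => ?; nra.
Qed.

Lemma root_suplevelL x : x < r -> (z * (x * (t - x)) < (x - r) ^+ 2) = (x < rootL).
Proof.
move=> xr; rewrite -subr_gt0 root_factor pmulr_rgt0//; have /andP[? ?] := root_between.
by apply/idP/idP => h; rewrite ltNge; apply/negP => ?; nra.
Qed.

Lemma root_suplevelR x : r < x -> (z * (x * (t - x)) < (x - r) ^+ 2) = (rootR < x).
Proof.
move=> xr; rewrite -subr_gt0 root_factor pmulr_rgt0//; have /andP[? ?] := root_between.
by apply/idP/idP => h; rewrite ltNge; apply/negP => ?; nra.
Qed.

End roots.

Lemma int_len (u v : R) : u <= v -> (\int[leb]_x (\I[u < x < v])%:E = (v - u)%:E)%E.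
Proof.
move=> uv; transitivity (\int[leb]_x (\I[u < x < v] * (x - u) `^ (1 - 1))%:E)%E.
  by apply: eq_integral => x _; rewrite subrr powRr0 mulr1.
rewrite integral_powR_right ?oner_eq0 ?ltr01//.
by rewrite subrr powRr1 ?subr_ge0// powR0 ?oner_eq0// subr0 divr1.
Qed.

(** Tonelli's theorem, where F x is read as the w-mass of the levels z at which
    B x z holds and len z as the length of a slice. *)
Lemma layer_cake (D : R -> bool) (B : R -> R -> bool) (w F len : R -> R) :
  measurable_fun setT D -> measurable_fun setT (fun p : R * R => B p.1 p.2) ->
  measurable_fun setT w -> (forall z, 0 <= w z) ->
  (forall x, D x -> (\int[leb]_z (w z * \I[B x z])%:E = (F x)%:E)%E) ->
  (forall z, w z != 0 -> (\int[leb]_x (\I[D x && B x z])%:E = (len z)%:E)%E) ->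
  (\int[leb]_x (\I[D x] * F x)%:E = \int[leb]_z (w z * len z)%:E)%E.
Proof.
move=> mD mB mw w0 FE lenE.
have mB1 z : measurable_fun setT (B^~ z).
  have -> : B^~ z = (fun p : R * R => B p.1 p.2) \o (fun x => (x, z)) by [].
  exact: (measurableT_comp mB (measurable_pair2 z)).
have mB2 x : measurable_fun setT (B x).
  have -> : B x = (fun p : R * R => B p.1 p.2) \o (fun z => (x, z)) by [].
  exact: (measurableT_comp mB (measurable_pair1 x)).
pose G (x z : R) : R := w z * \I[D x && B x z].
transitivity (\int[leb]_x \int[leb]_z (G x z)%:E)%E.
  apply: eq_integral => x _; rewrite /G; have [Dx|_] := boolP (D x).
    by rewrite mul1r -FE//; apply: eq_integral => z _.
  by rewrite mul0r integral0_eq// => z _; rewrite mulr0.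
rewrite tonelli; last 2 first.
- rewrite /G; apply: measR_M; first exact: (measurableT_comp mw).
  apply: measR_bool; apply: measR_and => //.
  exact: (measurableT_comp mD).
- by move=> x z; rewrite mulr_ge0.
apply: eq_integral => z _; rewrite /G.
have [wz|wz] := eqVneq (w z) 0.
  by rewrite wz mul0r integral0_eq// => x _; rewrite mul0r.
rewrite int_Zl; last 3 first.
- exact: w0.
- by apply: measR_bool; apply: measR_and; [exact: mD|exact: mB1].
- by [].
by rewrite lenE// EFinM.
Qed.

(** The integrand of [ellL] and [ellR] depends on x only through the level
    (x - r)^2 / (x (t - x)), up to the side of r on which x lies. *)
Let ratio_powR a (q y : R) : 0 < q -> 0 < y ->
  q `^ (- a) * y `^ (2 * a) = (y ^+ 2 / q) `^ a.
Proof.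
move=> q0 y0; rewrite powRM ?invr_ge0 ?sqr_ge0 ?(ltW q0)//.
rewrite mulrC; congr (_ * _).
  by rewrite powRrM -(powR_mulrn _ (ltW y0)).
by rewrite powRN -(powR_inv1 (ltW q0)) -powRrM mulN1r powRN.
Qed.

Let layer_neg b (q y : R) : 0 < b -> 0 < q -> 0 < y ->
  (\int[leb]_z (\I[0 < z] * (b * z `^ (- b - 1)) * \I[(y ^+ 2 < z * q)%R])%:E =
   ((y ^+ 2 / q) `^ (- b))%:E)%E.
Proof.
move=> b0 q0 y0; have yq : 0 < y ^+ 2 / q by rewrite divr_gt0// exprn_gt0.
transitivity (\int[leb]_z (b * (\I[y ^+ 2 / q < z] * z `^ (- b - 1)))%:E)%E.
  apply: eq_integral => z _; congr EFin; rewrite ltr_pdivrMr//.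
  have [z0|z0] := ltP 0 z; first by rewrite /= mul1r -mulrA [X in b * X]mulrC.
  rewrite [in RHS]ltNge (le_trans (y := 0)) ?mulr_le0_ge0 ?sqr_ge0 ?(ltW q0)//=.
  by rewrite !mul0r mulr0.
rewrite int_Zl; last 3 first.
- exact: ltW.
- by meas.
- by move=> z; rewrite mulr_ge0// powR_ge0.
rewrite integral_powR_tail// -EFinM; congr EFin.
by rewrite mulrCA divff ?gt_eqF// mulr1.
Qed.

Let layer_pos b (q y : R) : 0 < b -> 0 < q -> 0 < y ->
  (\int[leb]_z (\I[0 < z] * (b * z `^ (b - 1)) * \I[(z * q < y ^+ 2)%R])%:E =
   ((y ^+ 2 / q) `^ b)%:E)%E.
Proof.
move=> b0 q0 y0; have yq : 0 < y ^+ 2 / q by rewrite divr_gt0// exprn_gt0.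
transitivity (\int[leb]_z (b * (\I[0 < z < y ^+ 2 / q] * z `^ (b - 1)))%:E)%E.
  apply: eq_integral => z _; congr EFin; rewrite ltr_pdivlMr//.
  have [z0|z0] := ltP 0 z; first by rewrite /= mul1r -mulrA [X in b * X]mulrC.
  by rewrite /= !mul0r mulr0.
rewrite int_Zl; last 3 first.
- exact: ltW.
- by meas.
- by move=> z; rewrite mulr_ge0// powR_ge0.
rewrite integral_powR0 ?(ltW yq)// -EFinM; congr EFin.
by rewrite mulrCA divff ?gt_eqF// mulr1.
Qed.

Let ellLE a t r x : r <= t ->
  ellL a t r x = \I[0 < x < r] * ((x * (t - x)) `^ (- a) * (r - x) `^ (2 * a)).
Proof.
move=> rt; rewrite /ellL /ell; have [x0|_] := ltP 0 x; last by rewrite /= !mul0r mulr0.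
have [xr|_] := ltP x r; last by rewrite /= !mul0r.
have xt : x < t by exact: lt_le_trans rt.
by rewrite xt powRM ?subr_ge0 ?ltW//= !mul1r.
Qed.

Let ellRE a t r x : 0 <= r ->
  ellR a t r x = \I[r < x < t] * ((x * (t - x)) `^ (- a) * (x - r) `^ (2 * a)).
Proof.
move=> r0; rewrite /ellR /ell; have [xr|_] := ltP r x; last by rewrite /= !mul0r.
have x0 : 0 < x by exact: le_lt_trans xr.
rewrite x0 /=; have [xt|_] := ltP x t; last by rewrite /= !(mul0r, mulr0).
by rewrite powRM ?subr_ge0 ?ltW//= !mul1r.
Qed.

(** An identity between lengths of slices, valid at each level, integrates to
    an identity between the integrals; subtraction is avoided since the
    integrals may a priori be infinite. *)
Let add_levels (t r : R) (w L U dd : R -> R) : 0 <= t -> 0 <= r ->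
  measurable_fun setT w -> measurable_fun setT L -> measurable_fun setT U ->
  measurable_fun setT dd ->
  (forall z, 0 <= w z * L z) -> (forall z, 0 <= w z * U z) ->
  (forall z, 0 <= w z * dd z) ->
  (forall z, w z != 0 -> t * dd z + L z = U z + 2 * r * dd z) ->
  (t%:E * \int[leb]_z (w z * dd z)%:E + \int[leb]_z (w z * L z)%:E =
   \int[leb]_z (w z * U z)%:E + (2 * r)%:E * \int[leb]_z (w z * dd z)%:E)%E.
Proof.
move=> t0 r0 mw mL mU mdd wL wU wd E.
have mwd : measurable_fun setT (fun z => w z * dd z) by meas.
rewrite -int_Zl; last 3 first.
- exact: t0.
- exact: mwd.
- exact: wd.
rewrite -int_Zl; last 3 first.
- exact: mulr_ge0.
- exact: mwd.
- exact: wd.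
rewrite -int_D; last 4 first.
- by meas.
- by meas.
- by move=> z; rewrite mulr_ge0.
- exact: wL.
rewrite -int_D; last 4 first.
- by meas.
- by meas.
- exact: wU.
- by move=> z; apply: mulr_ge0; [exact: mulr_ge0|exact: wd].
apply: eq_integral => z _; congr EFin.
have [->|/E {}E] := eqVneq (w z) 0; first by rewrite !mul0r !mulr0.
transitivity (w z * (t * dd z + L z)); first by ring.
by rewrite E; ring.
Qed.

Lemma measurable_disc t r : measurable_fun setT (disc t r).
Proof.
rewrite /disc; apply: (measurableT_comp (f := @Num.sqrt R)); last by meas.
by apply: continuous_measurable_fun; exact: sqrt_continuous.
Qed.

Lemma measurable_rootL t r : measurable_fun setT (rootL t r).
Proof. have := measurable_disc t r; rewrite /rootL => ?; meas. Qed.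

Lemma measurable_rootR t r : measurable_fun setT (rootR t r).
Proof. have := measurable_disc t r; rewrite /rootR => ?; meas. Qed.

(** For a negative exponent the powers are superpositions of sublevel sets,
    which are the intervals between r and a root. The sum of the two roots
    gives t z/(1+z) + (r - x_-) = (x_+ - r) + 2 r z/(1+z) at each level. *)
Let abel_neg b : 0 < b -> exists kappa : \bar R, forall t r : R, 0 <= r -> r <= t ->
  (t%:E * kappa + \int[leb]_x (ellL (- b) t r x)%:E =
   \int[leb]_x (ellR (- b) t r x)%:E + (2 * r)%:E * kappa)%E.
Proof.
move=> b0.
pose w (z : R) : R := \I[0 < z] * (b * z `^ (- b - 1)).
have w0 z : 0 <= w z by rewrite mulr_ge0// mulr_ge0 ?powR_ge0// ltW.
have mw : measurable_fun setT w by rewrite /w; meas.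
have wz z : w z != 0 -> 0 < z by rewrite /w; case: ltP => // _; rewrite mul0r eqxx.
pose dd (z : R) : R := z * (1 + z) `^ (-1).
exists (\int[leb]_z (w z * dd z)%:E)%E => t r r0 rt.
have mL := measurable_rootL t r; have mU := measurable_rootR t r.
have LE : (\int[leb]_x (ellL (- b) t r x)%:E = \int[leb]_z (w z * (r - rootL t r z))%:E)%E.
  under eq_integral do rewrite (ellLE _ _ rt).
  apply: (@layer_cake (fun x => 0 < x < r) (fun x z => (x - r) ^+ 2 < z * (x * (t - x)))).
  - by meas.
  - by meas.
  - exact: mw.
  - exact: w0.
  - move=> x /andP[x0 xr]; rewrite (_ : (x - r) ^+ 2 = (r - x) ^+ 2); last by ring.
    have q0 : 0 < x * (t - x) by rewrite mulr_gt0// subr_gt0 (lt_le_trans xr).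
    by rewrite ratio_powR ?subr_gt0// -layer_neg ?subr_gt0.
  - move=> z /wz z0; have /andP[Lr rR] := root_between r0 rt z0.
    rewrite -(int_len Lr); apply: eq_integral => x _.
    rewrite root_sublevel//; congr (\I[_])%:E.
    have L0 := rootL_ge0 r0 rt z0.
    by apply/idP/idP => [/andP[/andP[? ?] /andP[? ?]]|/andP[? ?]]; lra.
have UE : (\int[leb]_x (ellR (- b) t r x)%:E = \int[leb]_z (w z * (rootR t r z - r))%:E)%E.
  under eq_integral do rewrite (ellRE _ _ _ r0).
  apply: (@layer_cake (fun x => r < x < t) (fun x z => (x - r) ^+ 2 < z * (x * (t - x)))).
  - by meas.
  - by meas.
  - exact: mw.
  - exact: w0.
  - move=> x /andP[xr xt].
    have q0 : 0 < x * (t - x) by rewrite mulr_gt0 ?subr_gt0// (le_lt_trans r0).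
    by rewrite ratio_powR ?subr_gt0// -layer_neg ?subr_gt0.
  - move=> z /wz z0; have /andP[Lr rR] := root_between r0 rt z0.
    rewrite -(int_len rR); apply: eq_integral => x _.
    rewrite root_sublevel//; congr (\I[_])%:E.
    have Rt := rootR_le r0 rt z0.
    by apply/idP/idP => [/andP[/andP[? ?] /andP[? ?]]|/andP[? ?]]; lra.
rewrite LE UE; apply: add_levels => //.
- exact: le_trans rt.
- by meas.
- by meas.
- by rewrite /dd; meas.
- move=> z; have [->|/wz z0] := eqVneq (w z) 0; first by rewrite mul0r.
  by rewrite mulr_ge0// subr_ge0; have /andP[] := root_between r0 rt z0.
- move=> z; have [->|/wz z0] := eqVneq (w z) 0; first by rewrite mul0r.
  by rewrite mulr_ge0// subr_ge0; have /andP[] := root_between r0 rt z0.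
- move=> z; have [->|/wz z0] := eqVneq (w z) 0; first by rewrite mul0r.
  by rewrite mulr_ge0// mulr_ge0 ?powR_ge0// ltW.
move=> z /wz z0; have := rootD t r z; rewrite /dd.
have E : (1 + z) * (1 + z) `^ (-1) = 1.
  by rewrite powR_inv1 ?divff ?gt_eqF ?addr_gt0// ltW ?addr_gt0.
nra.
Qed.

(** For a positive exponent superlevel sets take over: the slices run from a
    root to the end of [0, t], and the same sum of roots is used. *)
Let abel_pos b : 0 < b -> exists kappa : \bar R, forall t r : R, 0 <= r -> r <= t ->
  (t%:E * kappa + \int[leb]_x (ellL b t r x)%:E =
   \int[leb]_x (ellR b t r x)%:E + (2 * r)%:E * kappa)%E.
Proof.
move=> b0.
pose w (z : R) : R := \I[0 < z] * (b * z `^ (b - 1)).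
have w0 z : 0 <= w z by rewrite mulr_ge0// mulr_ge0 ?powR_ge0// ltW.
have mw : measurable_fun setT w by rewrite /w; meas.
have wz z : w z != 0 -> 0 < z by rewrite /w; case: ltP => // _; rewrite mul0r eqxx.
pose dd (z : R) : R := (1 + z) `^ (-1).
exists (\int[leb]_z (w z * dd z)%:E)%E => t r r0 rt.
have mL := measurable_rootL t r; have mU := measurable_rootR t r.
have LE : (\int[leb]_x (ellL b t r x)%:E = \int[leb]_z (w z * rootL t r z)%:E)%E.
  under eq_integral do rewrite (ellLE _ _ rt).
  apply: (@layer_cake (fun x => 0 < x < r) (fun x z => z * (x * (t - x)) < (x - r) ^+ 2)).
  - by meas.
  - by meas.
  - exact: mw.
  - exact: w0.
  - move=> x /andP[x0 xr]; rewrite (_ : (x - r) ^+ 2 = (r - x) ^+ 2); last by ring.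
    have q0 : 0 < x * (t - x) by rewrite mulr_gt0// subr_gt0 (lt_le_trans xr).
    by rewrite ratio_powR ?subr_gt0// -layer_pos ?subr_gt0.
  - move=> z /wz z0; have /andP[Lr rR] := root_between r0 rt z0.
    rewrite -[rootL t r z]subr0 -(int_len (rootL_ge0 r0 rt z0)).
    apply: eq_integral => x _; congr (\I[_])%:E.
    have [x0|//] /= := ltP 0 x; have [xr|xr] /= := ltP x r.
      by rewrite root_suplevelL.
    by apply/esym/negbTE; rewrite -leNgt; lra.
have UE : (\int[leb]_x (ellR b t r x)%:E = \int[leb]_z (w z * (t - rootR t r z))%:E)%E.
  under eq_integral do rewrite (ellRE _ _ _ r0).
  apply: (@layer_cake (fun x => r < x < t) (fun x z => z * (x * (t - x)) < (x - r) ^+ 2)).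
  - by meas.
  - by meas.
  - exact: mw.
  - exact: w0.
  - move=> x /andP[xr xt].
    have q0 : 0 < x * (t - x) by rewrite mulr_gt0 ?subr_gt0// (le_lt_trans r0).
    by rewrite ratio_powR ?subr_gt0// -layer_pos ?subr_gt0.
  - move=> z /wz z0; have /andP[Lr rR] := root_between r0 rt z0.
    rewrite -(int_len (rootR_le r0 rt z0)).
    apply: eq_integral => x _; congr (\I[_])%:E.
    have [xr|xr] /= := ltP r x.
      by rewrite root_suplevelR// andbC.
    by apply/esym/negbTE; rewrite negb_and -leNgt; apply/orP; left; lra.
rewrite LE UE; apply: add_levels => //.
- exact: le_trans rt.
- by meas.
- by rewrite /dd; meas.
- move=> z; have [->|/wz z0] := eqVneq (w z) 0; first by rewrite mul0r.
  by rewrite mulr_ge0// rootL_ge0.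
- move=> z; have [->|/wz z0] := eqVneq (w z) 0; first by rewrite mul0r.
  by rewrite mulr_ge0// subr_ge0 rootR_le.
- by move=> z; rewrite mulr_ge0// powR_ge0.
move=> z /wz z0; have := rootD t r z; rewrite /dd.
have E : (1 + z) * (1 + z) `^ (-1) = 1.
  by rewrite powR_inv1 ?divff ?gt_eqF ?addr_gt0// ltW ?addr_gt0.
nra.
Qed.

Let abel_zero : exists kappa : \bar R, forall t r : R, 0 <= r -> r <= t ->
  (t%:E * kappa + \int[leb]_x (ellL 0 t r x)%:E =
   \int[leb]_x (ellR 0 t r x)%:E + (2 * r)%:E * kappa)%E.
Proof.
exists 1%E => t r r0 rt.
under eq_integral do rewrite (ellLE _ _ rt) mulr0 oppr0 !powRr0 !mulr1.
rewrite (int_len r0).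
under eq_integral do rewrite (ellRE _ _ _ r0) mulr0 oppr0 !powRr0 !mulr1.
by rewrite (int_len rt) !mule1 -!EFinD; congr EFin; ring.
Qed.

(** Slicing by the level of (x - r)^2 / (x (t - x)) produces the same constant
    for all r and t, since only the sum of the two roots enters; r = 0 and
    t = 1 identify it. The identity says that the integral over ]0, t[ of
    (x (t - x))^(-a) sgn(r - x) |r - x|^(2a) is (2 r - t) Beta(1 + a, 1 - a);
    its terms are arranged so as to make sense before finiteness is known. *)
Lemma abel_identity (a t r : R) : - 1 < a < 1 -> 0 <= r -> r <= t ->
  (t%:E * (Beta (1 + a) (1 - a))%:E + \int[leb]_x (ellL a t r x)%:E =
   \int[leb]_x (ellR a t r x)%:E + (2 * r)%:E * (Beta (1 + a) (1 - a))%:E)%E.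
Proof.
move=> /andP[Na1 a1].
have [kappa kE] : exists kappa : \bar R, forall t r : R, 0 <= r -> r <= t ->
    (t%:E * kappa + \int[leb]_x (ellL a t r x)%:E =
     \int[leb]_x (ellR a t r x)%:E + (2 * r)%:E * kappa)%E.
  have [a_lt0|a_gt0|->] := ltgtP a 0; last exact: abel_zero.
  - by have := abel_neg (_ : 0 < - a); rewrite opprK oppr_gt0; apply.
  - exact: abel_pos.
suff -> : (Beta (1 + a) (1 - a))%:E = kappa by exact: kE.
rewrite -eBeta_fin; [|lra|lra].
have := kE 1 0 (lexx 0) ler01; rewrite mulr0 mul0e mul1e adde0.
rewrite [X in (_ + X)%E]integral0_eq ?adde0 => [->|x _]; last first.
  rewrite ellLE//; have [x0|_] := ltP 0 x; last by rewrite mul0r.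
  by rewrite /= ltNge (ltW x0) mul0r.
apply: eq_integral => x _; congr EFin; rewrite ellRE// /Beta_integrand.
have [/andP[x0 x1]|_] := boolP (0 < x < 1); last by rewrite !mul0r.
rewrite !mul1r subr0 powRM ?subr_ge0 ?(ltW x0) ?(ltW x1)//.
rewrite mulrAC -powRD ?(gt_eqF x0) ?implybT//.
by congr (_ `^ _ * _ `^ _); ring.
Qed.

End abel_identity.

(** * Integrable functions *)

Section cvg_to_zero.
Variable R : realType.
Local Open Scope ereal_scope.

Lemma cvge0P (u : nat -> \bar R) : (forall n, 0 <= u n) ->
  u @ \oo --> 0 <-> forall e : R, (0 < e)%R -> \forall n \near \oo, u n <= e%:E.
Proof.
move=> u0; split=> [/fine_cvgP[ufin /cvgr0Pnorm_lt cvgu] e e0|H].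
  near=> n; have ufn : u n \is a fin_num by near: n.
  rewrite -(fineK ufn) lee_fin ltW//; apply: le_lt_trans (ler_norm _) _.
  by near: n; exact: cvgu.
have fin : \forall n \near \oo, u n \is a fin_num.
  near=> n; rewrite ge0_fin_numE// (@le_lt_trans _ _ 1%:E) ?ltry//.
  by near: n; exact: H.
apply/fine_cvgP; split=> //; apply/cvgr0Pnorm_lt => e e0; near=> n.
rewrite /= ger0_norm ?fine_ge0// -lte_fin fineK; last by near: n.
apply: (@le_lt_trans _ _ (e / 2)%:E); last by rewrite lte_fin ltr_pdivrMr// ltr_pMr// ltr1n.
by near: n; apply: H; rewrite divr_gt0.
Unshelve. all: by end_near. Qed.

Lemma cvge0_le (u v : nat -> \bar R) (C : R) : (0 <= C)%R ->
  (forall n, 0 <= u n) -> (forall n, 0 <= v n) -> (forall n, u n <= C%:E * v n) ->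
  v @ \oo --> 0 -> u @ \oo --> 0.
Proof.
move=> C0 u0 v0 uv /(cvge0P v0) H; apply/cvge0P => // e e0.
have C1 : (0 < C + 1)%R by rewrite ltr_wpDl.
have := H (e / (C + 1))%R (divr_gt0 e0 C1); apply: filterS => n vn.
apply: le_trans (uv n) _; apply: (@le_trans _ _ (C%:E * (e / (C + 1))%:E)).
  by rewrite lee_pmul.
rewrite -EFinM lee_fin mulrA ler_pdivrMr// mulrC ler_pM2l//.
by rewrite lerDl.
Qed.

End cvg_to_zero.

Section integrable_functions.
Context d (T : measurableType d) (R : realType) (m : {measure set T -> \bar R}).
Implicit Types f g : T -> R.

(** Integrability of a real function on the whole space, so that the linearity
    of the real-valued integral [rint] has no domain conditions. *)
Definition intble f := m.-integrable setT (fun x => (f x)%:E).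

Lemma intble_dom f g : measurable_fun setT f -> measurable_fun setT g ->
  (forall x, `|f x| <= g x) -> (\int[m]_x (g x)%:E < +oo)%E -> intble f.
Proof.
move=> mf mg fg goo; apply/integrableP; split; first exact: measR_EFin.
apply: le_lt_trans goo; under eq_integral do rewrite abse_EFin.
by apply: int_le => //; apply: measR_norm.
Qed.

Lemma intble_lty f : intble f -> (\int[m]_x (`|f x|)%:E < +oo)%E.
Proof. by move=> /integrableP[_]; under eq_integral do rewrite abse_EFin. Qed.

Lemma intble_meas f : intble f -> measurable_fun setT f.
Proof. by move=> /integrableP[/measurable_EFinP]. Qed.

Lemma intble_ge0 f : measurable_fun setT f -> (forall x, 0 <= f x) ->
  (\int[m]_x (f x)%:E < +oo)%E -> intble f.
Proof. by move=> mf f0; apply: intble_dom => // x; rewrite ger0_norm. Qed.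

Lemma intbleD f g : intble f -> intble g -> intble (fun x => f x + g x).
Proof.
move=> If Ig; rewrite /intble; under eq_fun do rewrite EFinD.
exact: integrableD.
Qed.

Lemma intbleB f g : intble f -> intble g -> intble (fun x => f x - g x).
Proof.
move=> If Ig; rewrite /intble; under eq_fun do rewrite EFinB.
exact: integrableB.
Qed.

Lemma intbleZ (k : R) f : intble f -> intble (fun x => k * f x).
Proof.
move=> If; rewrite /intble; under eq_fun do rewrite EFinM.
exact: integrableZl.
Qed.

Lemma intble_norm f : intble f -> intble (fun x => `|f x|).
Proof.
move=> If; apply: (intble_dom (g := fun x => `|f x|)).
- by apply: measR_norm; exact: intble_meas.
- by apply: measR_norm; exact: intble_meas.
- by move=> x; rewrite normr_id.
- exact: intble_lty.
Qed.

Lemma intble0 : intble (fun=> 0).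
Proof. exact: integrable0. Qed.

Definition rint f := fine (\int[m]_x (f x)%:E)%E.

Lemma rintE f : intble f -> (\int[m]_x (f x)%:E = (rint f)%:E)%E.
Proof. by move=> If; rewrite /rint fineK// integrable_fin_num. Qed.

Lemma rintD f g : intble f -> intble g -> rint (fun x => f x + g x) = rint f + rint g.
Proof. by move=> If Ig; have := RintegralD measurableT If Ig. Qed.

Lemma rintB f g : intble f -> intble g -> rint (fun x => f x - g x) = rint f - rint g.
Proof. by move=> If Ig; have := RintegralB measurableT If Ig. Qed.

Lemma rintZ (k : R) f : intble f -> rint (fun x => k * f x) = k * rint f.
Proof. by move=> If; have := RintegralZl k measurableT If. Qed.

Lemma rint0 : rint (fun=> 0) = 0.
Proof. by rewrite /rint integral0. Qed.

Lemma eq_rint f g : f =1 g -> rint f = rint g.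
Proof. by move=> fg; congr fine; apply: eq_integral => x _; rewrite fg. Qed.

Lemma rint_ge0 f : (forall x, 0 <= f x) -> 0 <= rint f.
Proof. by move=> f0; rewrite fine_ge0// int_ge0. Qed.

Lemma le_norm_rint f : intble f -> `|rint f| <= rint (fun x => `|f x|).
Proof. by move=> If; have := le_normr_Rintegral measurableT If. Qed.

Lemma le_norm_rintE f : intble f -> (`|rint f|%:E <= \int[m]_x (`|f x|)%:E)%E.
Proof.
move=> If; rewrite rintE; last exact: intble_norm.
by rewrite lee_fin le_norm_rint.
Qed.

Lemma amgm (e x y : R) : 0 < e -> `|x * y| <= e^-1 * x ^+ 2 + e * y ^+ 2.
Proof.
move=> e0; have ei0 : 0 < e^-1 by rewrite invr_gt0.
suff : 2 * `|x * y| <= e^-1 * x ^+ 2 + e * y ^+ 2.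
  by apply: le_trans; rewrite ler_peMl// ler1n.
rewrite normrM -[in leRHS](real_normK (num_real x)) -[in leRHS](real_normK (num_real y)).
have := sqr_ge0 (`|x| - e * `|y|) => h.
rewrite -subr_ge0 -(pmulr_rge0 _ e0); apply: le_trans h _.
by rewrite le_eqVlt; apply/orP; left; apply/eqP; field; rewrite gt_eqF.
Qed.

Lemma int_mul_le (e : R) f g : 0 < e -> measurable_fun setT f -> measurable_fun setT g ->
  (\int[m]_x (`|f x * g x|)%:E <=
   e^-1%:E * \int[m]_x (f x ^+ 2)%:E + e%:E * \int[m]_x (g x ^+ 2)%:E)%E.
Proof.
move=> e0 mf mg.
rewrite -int_Zl; last 3 first.
- by rewrite invr_ge0 ltW.
- by meas.
- by move=> x; exact: sqr_ge0.
rewrite -int_Zl; last 3 first.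
- exact: ltW.
- by meas.
- by move=> x; exact: sqr_ge0.
rewrite -int_D; last 4 first.
- by meas.
- by meas.
- by move=> x; rewrite mulr_ge0 ?invr_ge0 ?sqr_ge0// ltW.
- by move=> x; rewrite mulr_ge0 ?sqr_ge0// ltW.
apply: int_le.
- by meas.
- by meas.
- by [].
- by move=> x; exact: amgm.
Qed.

Lemma intble_mul f g : measurable_fun setT f -> measurable_fun setT g ->
  (\int[m]_x (f x ^+ 2)%:E < +oo)%E -> (\int[m]_x (g x ^+ 2)%:E < +oo)%E ->
  intble (fun x => f x * g x).
Proof.
move=> mf mg foo goo; apply: (intble_dom (g := fun x => `|f x * g x|)) => //.
- by meas.
- by meas.
apply: le_lt_trans (int_mul_le ltr01 mf mg) _.
by rewrite invr1 !mul1e lte_add_pinfty.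
Qed.

(** Cauchy-Schwarz in disguise: the weight in [int_mul_le] is chosen so small
    that the fixed factor contributes at most half of the error. *)
Lemma int_mul_cvg0 (f : nat -> T -> R) g : (forall n, measurable_fun setT (f n)) ->
  measurable_fun setT g -> (\int[m]_x (g x ^+ 2)%:E < +oo)%E ->
  (\int[m]_x (f n x ^+ 2)%:E)%E @[n --> \oo] --> 0%E ->
  (\int[m]_x (`|f n x * g x|)%:E)%E @[n --> \oo] --> 0%E.
Proof.
move=> mf mg goo.
have g0 : (0 <= \int[m]_x (g x ^+ 2)%:E)%E by apply: int_ge0 => x; exact: sqr_ge0.
set G := (\int[m]_x (g x ^+ 2)%:E)%E in goo g0.
have Gfin : G \is a fin_num by rewrite ge0_fin_numE.
move=> /cvge0P H; apply/cvge0P => [n|e e0]; first by apply: int_ge0.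
have G1 : 0 < fine G + 1 by rewrite ltr_wpDl// fine_ge0.
pose c := e / 2 / (fine G + 1); have c0 : 0 < c by rewrite !divr_gt0.
have ce0 : 0 < c * (e / 2) by rewrite mulr_gt0// divr_gt0.
have H' := H (fun n => int_ge0 m (fun x => sqr_ge0 (f n x))) _ ce0.
near=> n; apply: le_trans (int_mul_le c0 (mf n) mg) _.
apply: (@le_trans _ _ (c^-1%:E * (c * (e / 2))%:E + c%:E * G)%E).
  apply: leeD => //; apply: lee_pmul.
  - by rewrite lee_fin invr_ge0 (ltW c0).
  - by apply: int_ge0 => x; exact: sqr_ge0.
  - by [].
  - by near: n.
rewrite -(fineK Gfin) -!EFinM -EFinD lee_fin mulKf ?gt_eqF//.
have : c * fine G <= e / 2.
  rewrite /c mulrAC ler_pdivrMr// ler_pM2l ?divr_gt0//.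
  by rewrite lerDl.
by lra.
Unshelve. all: by end_near. Qed.

End integrable_functions.

(** * Step functions and the covariance of the process *)

Section primitives.
Variable R : realType.
Local Notation leb := (@lebesgue_measure R).
Implicit Types (u v : R) (f psi G : R -> R) (s : seq (R * R * R)).

Lemma int_oc u v f : measurable_fun setT f ->
  (\int[leb]_x (\I[u < x <= v] * f x)%:E = \int[leb]_x (\I[u < x < v] * f x)%:E)%E.
Proof.
move=> mf.
rewrite (@integral_ind R _ (measurableTypeR R) leb `]u, v]%classic)//.
rewrite (@integral_ind R _ (measurableTypeR R) leb `]u, v[%classic)//.
rewrite integral_itv_bndo_bndc//; apply: measurable_funTS; exact: measR_EFin.
Qed.

Lemma indicE_oc u v (x : R) : \1_`]u, v] x = \I[u < x <= v] :> R.
Proof. by rewrite indicE mem_setE in_itv. Qed.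

(** Integrals of step functions against psi only involve G; this is what links
    covariances of step integrals to Lebesgue integrals. *)
Definition primitive_of psi G := forall u v, 0 <= u -> u <= v ->
  intble leb (fun x => \I[u < x <= v] * psi x) /\
  rint leb (fun x => \I[u < x <= v] * psi x) = G v - G u.

Lemma step_rint psi G s : primitive_of psi G -> step_wf s ->
  intble leb (fun x => step_fun s x * psi x) /\
  rint leb (fun x => step_fun s x * psi x) =
    \sum_(p <- s) p.1.1 * (G p.2 - G p.1.2).
Proof.
move=> pG; elim: s => [_|[[c u] v] s IH].
  have E : (fun x => step_fun [::] x * psi x) = (fun=> 0).
    by apply/funext => x; rewrite /step_fun big_nil mul0r.
  by rewrite E big_nil; split; [exact: intble0|exact: rint0].
move=> /= /andP[/andP[u0 uv] /IH[I1 I2]].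
have E : (fun x => step_fun ((c, u, v) :: s) x * psi x) =
    (fun x => c * (\I[u < x <= v] * psi x) + step_fun s x * psi x).
  by apply/funext => x; rewrite /step_fun big_cons/= indicE_oc mulrDl mulrA.
have [J1 J2] := pG _ _ u0 uv.
rewrite E; split; first by apply: intbleD => //; exact: intbleZ.
by rewrite big_cons/= rintD//; [rewrite rintZ// J2 I2|exact: intbleZ].
Qed.

Lemma measurable_step_fun s : measurable_fun setT (step_fun s : R -> R).
Proof.
elim: s => [|[[c u] v] s IH].
  rewrite (_ : step_fun [::] = fun=> 0); first exact: measurable_cst.
  by apply/funext => x; rewrite /step_fun big_nil.
rewrite (_ : step_fun _ = fun x => c * \I[u < x <= v] + step_fun s x); first by meas.
by apply/funext => x; rewrite /step_fun big_cons/= indicE_oc.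
Qed.

Lemma step_fun_bounded s : step_wf s -> exists B M : R, [/\ 0 <= B, 0 <= M &
  forall x, `|step_fun s x| <= M * \I[0 < x < B]].
Proof.
elim: s => [_|[[c u] v] s IH].
  by exists 0, 0; split=> // x; rewrite /step_fun big_nil normr0 mul0r.
move=> /= /andP[/andP[u0 uv] /IH[B [M [B0 M0 H]]]].
exists (Num.max B (v + 1)), (`|c| + M); split.
- by rewrite le_max B0.
- by rewrite addr_ge0.
move=> x; rewrite /step_fun big_cons/= indicE_oc.
apply: le_trans (ler_normD _ _) _; rewrite mulrDl lerD//.
  rewrite normrM ler_wpM2l//; have [/andP[ux xv]|_] := boolP (u < x <= v).
    rewrite (le_lt_trans u0 ux) lt_max (_ : x < v + 1) ?orbT ?normr1//.
    by rewrite (le_lt_trans xv)// ltrDl.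
  by rewrite normr0.
apply: le_trans (H x) _; rewrite ler_wpM2l// lt_max.
by case: (0 < x); case: (x < B); rewrite //= ler0n.
Qed.

End primitives.

Section kernel_phi.
Variable R : realType.
Local Notation leb := (@lebesgue_measure R).
Variable a : R.
Hypothesis a_bnd : - 2^-1 < a < 2^-1.
Let e := 2 * a + 1.
Let e0 : 0 < e. Proof. by move: a_bnd; rewrite /e => /andP[]; lra. Qed.
Let enz : e != 0. Proof. by rewrite gt_eqF. Qed.
Let aE : 2 * a = e - 1. Proof. by rewrite /e; ring. Qed.

(** H phi_r is the derivative in x > 0 of the covariance E(W_x W_r). *)
Definition phi (r x : R) : R :=
  \I[0 < x] * (x `^ (2 * a) + \I[x < r] * (r - x) `^ (2 * a)
               - \I[r < x] * (x - r) `^ (2 * a)).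

Lemma measurable_phi r : measurable_fun setT (phi r).
Proof. by rewrite /phi; meas. Qed.

(** The covariance E(W_x W_r) divided by H. *)
Definition cov_prim (r x : R) : R := (x `^ e + r `^ e - `|x - r| `^ e) / e.

Let pos (x : R) : R := Num.max x 0.

Let int_left (r u v : R) : u <= v ->
  (\int[leb]_x (\I[u < x < v] * (\I[x < r] * (r - x) `^ (2 * a)))%:E =
   ((pos (r - u) `^ e - pos (r - v) `^ e) / e)%:E)%E.
Proof.
move=> uv; rewrite /pos aE; have [ru|ur] := leP r u.
  rewrite !max_r ?subr_le0// ?(le_trans ru)// subrr mul0r.
  rewrite integral0_eq// => x _; have [ux|_] := ltP u x; last by rewrite mul0r.
  by rewrite (ltNge x r) (le_trans ru (ltW ux)) mul0r mulr0.
transitivity (\int[leb]_x (\I[(u < x < Num.min v r)%R] * (r - x) `^ (e - 1))%:E)%E.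
  apply: eq_integral => x _; rewrite lt_min.
  by case: (u < x); case: (x < v); case: (x < r); rewrite ?mul1r ?mul0r ?mulr0.
rewrite integral_powR_left ?e0//; last 2 first.
- by rewrite ge_min lexx orbT.
- by rewrite le_min uv ltW.
rewrite max_l ?subr_ge0 ?(ltW ur)//; congr ((_ - _) / _)%:E.
have [vr|rv] := leP v r; first by rewrite max_l ?subr_ge0.
by rewrite max_r ?subr_le0 ?(ltW rv)// subrr.
Qed.

Let int_right (r u v : R) : u <= v ->
  (\int[leb]_x (\I[u < x < v] * (\I[r < x] * (x - r) `^ (2 * a)))%:E =
   ((pos (v - r) `^ e - pos (u - r) `^ e) / e)%:E)%E.
Proof.
move=> uv; rewrite /pos aE; have [vr|rv] := leP v r.
  rewrite !max_r ?subr_le0// ?(le_trans uv)// subrr mul0r.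
  rewrite integral0_eq// => x _; have [xv|_] := ltP x v; last by rewrite andbF mul0r.
  by rewrite (ltNge r x) (le_trans (ltW xv) vr) mul0r mulr0.
transitivity (\int[leb]_x (\I[(Num.max u r < x < v)%R] * (x - r) `^ (e - 1))%:E)%E.
  apply: eq_integral => x _; rewrite gt_max.
  by case: (u < x); case: (x < v); case: (r < x); rewrite ?mul1r ?mul0r ?mulr0.
rewrite integral_powR_right ?e0//; last 2 first.
- by rewrite le_max lexx orbT.
- by rewrite ge_max uv ltW.
rewrite (@max_l _ _ (v - r)) ?subr_ge0 ?(ltW rv)//; congr ((_ - _) / _)%:E.
have [ur|ru] := leP u r; first by rewrite max_r ?subr_le0// subrr.
by rewrite max_l ?subr_ge0 ?(ltW ru).
Qed.

Let norm_powR (x : R) : `|x| `^ e = pos x `^ e + pos (- x) `^ e.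
Proof.
rewrite /pos; have [x0|x0] := leP 0 x.
  by rewrite ger0_norm// (@max_r _ _ (- x)) ?oppr_le0// powR0// addr0.
by rewrite ltr0_norm// (@max_l _ _ (- x)) ?oppr_ge0 ?(ltW x0)// powR0// add0r.
Qed.

Lemma phi_primitive r : 0 <= r -> primitive_of (phi r) (cov_prim r).
Proof.
move=> r0 u v u0 uv.
pose f1 (x : R) : R := \I[u < x <= v] * x `^ (2 * a).
pose f2 (x : R) : R := \I[u < x <= v] * (\I[x < r] * (r - x) `^ (2 * a)).
pose f3 (x : R) : R := \I[u < x <= v] * (\I[r < x] * (x - r) `^ (2 * a)).
have E : (fun x => \I[u < x <= v] * phi r x) = fun x => f1 x + f2 x - f3 x.
  apply/funext => x; rewrite /f1 /f2 /f3 /phi.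
  have [/andP[ux xv]|_] := boolP (u < x <= v); last by rewrite !mul0r addr0 subr0.
  by rewrite (le_lt_trans u0 ux) !mul1r.
have i1 : (\int[leb]_x (f1 x)%:E = ((v `^ e - u `^ e) / e)%:E)%E.
  by rewrite int_oc; [rewrite aE integral_powR_itv ?e0|meas].
have i2 : (\int[leb]_x (f2 x)%:E = ((pos (r - u) `^ e - pos (r - v) `^ e) / e)%:E)%E.
  by rewrite int_oc; [exact: int_left|meas].
have i3 : (\int[leb]_x (f3 x)%:E = ((pos (v - r) `^ e - pos (u - r) `^ e) / e)%:E)%E.
  by rewrite int_oc; [exact: int_right|meas].
have I1 : intble leb f1.
  apply: intble_ge0; [by rewrite /f1; meas| |by rewrite i1 ltry].
  by move=> x; rewrite mulr_ge0// powR_ge0.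
have I2 : intble leb f2.
  apply: intble_ge0; [by rewrite /f2; meas| |by rewrite i2 ltry].
  by move=> x; rewrite !mulr_ge0// powR_ge0.
have I3 : intble leb f3.
  apply: intble_ge0; [by rewrite /f3; meas| |by rewrite i3 ltry].
  by move=> x; rewrite !mulr_ge0// powR_ge0.
rewrite E; split; first by apply: intbleB => //; exact: intbleD.
rewrite rintB//; last exact: intbleD.
rewrite rintD// /rint i1 i2 i3 /= /cov_prim !norm_powR !opprB.
by rewrite -mulrDl -!mulrBl; congr (_ / _); ring.
Qed.

End kernel_phi.

(** * The covariance of the Wiener integral of l_H with the process *)

Section covariance_primitive.
Variable R : realType.
Local Notation leb := (@lebesgue_measure R).
Variables a t : R.
Hypothesis a_bnd : - 2^-1 < a < 2^-1.
Hypothesis t0 : 0 < t.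
Let a1 : 0 < 1 - a. Proof. by move: a_bnd => /andP[]; lra. Qed.
Let a2 : 0 < 2 * a + 1. Proof. by move: a_bnd => /andP[]; lra. Qed.
Let idom := @intble_dom _ (measurableTypeR R) R leb.
Let eqr := @eq_rint _ (measurableTypeR R) R leb.
Let B : R := Beta (1 + a) (1 - a).

Lemma integral_ell :
  (\int[leb]_x (ell a t x)%:E = (t `^ (1 - 2 * a) * Beta (1 - a) (1 - a))%:E)%E.
Proof.
rewrite EFinM -eBeta_fin// (_ : 1 - 2 * a = (1 - a) + (1 - a) - 1); last by ring.
rewrite -integral_Beta_scale; last exact: t0.
apply: eq_integral => x _.
by rewrite /ell (_ : 1 - a - 1 = - a)//; ring.
Qed.

Lemma intble_ell : intble leb (ell a t).
Proof.
apply: intble_ge0; [exact: measurable_ell|by move=> x; exact: ell_ge0|].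
by rewrite integral_ell ltry.
Qed.

Lemma ell_le_neg x : a <= 0 -> ell a t x <= (t `^ (- a)) ^+ 2 * \I[0 < x < t].
Proof.
move=> a0; rewrite /ell; have [/andP[x0 xt]|_] := boolP (0 < x < t); last first.
  by rewrite mul0r mulr0.
rewrite mul1r mulr1 expr2 ler_pM ?powR_ge0//.
  by rewrite ge0_ler_powR ?oppr_ge0 ?nnegrE ?(ltW x0) ?(ltW xt) ?(ltW t0).
by rewrite ge0_ler_powR ?oppr_ge0 ?nnegrE ?subr_ge0 ?(ltW t0) ?(ltW xt)// gerBl ltW.
Qed.

Lemma intble_ellL r : 0 <= r -> intble leb (ellL a t r).
Proof.
move=> r0; have mL := measurable_ellL a t r.
have mell := measurable_ell a t.
have [a0|a0] := leP 0 a.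
  apply: (idom (g := fun x => r `^ (2 * a) * ell a t x)) => //; first by meas.
    move=> x; rewrite ger0_norm ?ellL_ge0// /ellL.
    have [xr|_] := ltP x r; last by rewrite mul0r mulr_ge0 ?powR_ge0 ?ell_ge0.
    rewrite mul1r mulrC; have [x0|x0] := ltP 0 x; last first.
      by rewrite /ell ltNge x0 !mul0r !mulr0.
    rewrite ler_wpM2r ?ell_ge0// ge0_ler_powR ?nnegrE ?subr_ge0 ?(ltW xr)//.
      by rewrite mulr_ge0.
    by rewrite gerBl ltW.
  rewrite int_Zl; [by rewrite integral_ell -EFinM ltry|exact: powR_ge0|exact: mell|].
  by move=> x; exact: ell_ge0.
apply: (idom (g := fun x => (t `^ (- a)) ^+ 2 *
  (\I[0 < x < r] * (r - x) `^ ((2 * a + 1) - 1)))) => //; first by meas.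
  move=> x; rewrite ger0_norm ?ellL_ge0// /ellL addrK.
  have [xr|_] := ltP x r; last by rewrite mul0r !mulr_ge0 ?sqr_ge0 ?powR_ge0.
  rewrite mul1r andbT mulrA ler_wpM2r ?powR_ge0//.
  apply: le_trans (ell_le_neg _ (ltW a0)) _; rewrite ler_wpM2l ?sqr_ge0//.
  by case: (0 < x); case: (x < t).
rewrite int_Zl; last 3 first.
- exact: sqr_ge0.
- by meas.
- by move=> x; rewrite mulr_ge0 ?powR_ge0.
by rewrite integral_powR_left ?a2 ?gt_eqF// -EFinM ltry.
Qed.

Lemma intble_ellR r : 0 <= r -> intble leb (ellR a t r).
Proof.
move=> r0; have mR := measurable_ellR a t r.
have mell := measurable_ell a t.
have [a0|a0] := leP 0 a.
  apply: (idom (g := fun x => t `^ (2 * a) * ell a t x)) => //; first by meas.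
    move=> x; rewrite ger0_norm ?ellR_ge0// /ellR.
    have [xr|_] := ltP r x; last by rewrite mul0r mulr_ge0 ?powR_ge0 ?ell_ge0.
    rewrite mul1r mulrC; have [xt|xt] := ltP x t; last first.
      by rewrite /ell (ltNge x t) xt andbF !mul0r !mulr0.
    rewrite ler_wpM2r ?ell_ge0// ge0_ler_powR ?nnegrE ?subr_ge0 ?(ltW xr) ?(ltW t0)//.
      by rewrite mulr_ge0.
    by rewrite lerBlDr (le_trans (ltW xt))// lerDl.
  rewrite int_Zl; [by rewrite integral_ell -EFinM ltry|exact: powR_ge0|exact: mell|].
  by move=> x; exact: ell_ge0.
apply: (idom (g := fun x => (t `^ (- a)) ^+ 2 *
  (\I[r < x < Num.max r t] * (x - r) `^ ((2 * a + 1) - 1)))) => //; first by meas.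
  move=> x; rewrite ger0_norm ?ellR_ge0// /ellR addrK.
  have [xr|_] := ltP r x; last by rewrite mul0r !mulr_ge0 ?sqr_ge0 ?powR_ge0.
  rewrite mul1r mulrA ler_wpM2r ?powR_ge0//.
  apply: le_trans (ell_le_neg _ (ltW a0)) _; rewrite ler_wpM2l ?sqr_ge0// lt_max.
  by case: (0 < x); case: (x < t); rewrite ?orbT ?ler0n ?lexx.
rewrite int_Zl; last 3 first.
- exact: sqr_ge0.
- by meas.
- by move=> x; rewrite mulr_ge0 ?powR_ge0.
by rewrite integral_powR_right ?a2 ?gt_eqF ?le_max ?lexx// -EFinM ltry.
Qed.

(** The power x^(2a) in [phi] is the right half for the point 0. *)
Lemma ell_phiE r x : ell a t x * phi a r x = ellR a t 0 x + ellL a t r x - ellR a t r x.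
Proof.
rewrite /phi /ellR /ellL subr0; have [x0|x0] := ltP 0 x; last first.
  by rewrite /ell ltNge x0 !mul0r !mulr0 !addr0 subr0.
by rewrite !mul1r; ring.
Qed.

Lemma intble_ell_phi r : 0 <= r -> intble leb (fun x => ell a t x * phi a r x).
Proof.
move=> r0; have -> : (fun x => ell a t x * phi a r x) =
    (fun x => ellR a t 0 x + ellL a t r x - ellR a t r x).
  by apply/funext => x; rewrite ell_phiE.
apply: intbleB; last exact: intble_ellR.
by apply: intbleD; [exact: intble_ellR|exact: intble_ellL].
Qed.

Lemma abel_rint r : 0 <= r -> r <= t ->
  t * B + rint leb (ellL a t r) = rint leb (ellR a t r) + 2 * r * B.
Proof.
move=> r0 rt; have a11 : - 1 < a < 1 by move: a_bnd => /andP[]; lra.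
have := abel_identity a11 r0 rt.
rewrite (rintE (intble_ellL r0)) (rintE (intble_ellR r0)) -!EFinM -!EFinD.
by move=> [].
Qed.

(** Up to the factor H C_H, the covariance of W_r with the Wiener integral of
    l_H(t, .). *)
Definition covM r := rint leb (fun x => ell a t x * phi a r x).

Lemma covME r : 0 <= r ->
  covM r = t * B + rint leb (ellL a t r) - rint leb (ellR a t r).
Proof.
move=> r0; have IR0 := intble_ellR (lexx 0).
have IL := intble_ellL r0; have IR := intble_ellR r0.
rewrite /covM (eqr (ell_phiE r)) rintB//; last exact: intbleD.
rewrite rintD//; congr (_ + _ - _).
have := abel_rint (lexx 0) (ltW t0); rewrite mulr0 mul0r addr0 => <-.
rewrite (_ : rint leb (ellL a t 0) = 0) ?addr0//.
rewrite -[RHS](rint0 leb); apply: eqr => x; rewrite /ellL /ell.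
have [x0|_] := ltP 0 x; last by rewrite !mul0r mulr0.
by rewrite (ltNge x 0) (ltW x0) mul0r.
Qed.

(** Linearity in r is what makes the increments of the family of Wiener
    integrals of l_H uncorrelated. *)
Lemma covM_below r : 0 <= r -> r <= t -> covM r = 2 * r * B.
Proof.
by move=> r0 rt; rewrite covME// abel_rint// addrAC subrr add0r.
Qed.

Lemma ellR_above r : t <= r -> rint leb (ellR a t r) = 0.
Proof.
move=> tr; rewrite -[RHS](rint0 leb); apply: eqr => x; rewrite /ellR /ell.
have [rx|_] := ltP r x; last by rewrite mul0r.
by rewrite (ltNge x t) (le_trans tr (ltW rx)) andbF !mul0r mulr0.
Qed.

Lemma covM_above r : t <= r -> covM r = t * B + rint leb (ellL a t r).
Proof. by move=> tr; rewrite covME ?ellR_above ?subr0// (le_trans (ltW t0)). Qed.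

(** For r > t the covariance with W_r is no longer linear; 2a times this
    integral is the derivative of [covM] there. *)
Definition tail_kernel (x : R) : R :=
  fine (\int[leb]_y (ell a t y * (x - y) `^ (2 * a - 1))%:E)%E.

Let etk (x : R) := (\int[leb]_y (ell a t y * (x - y) `^ (2 * a - 1))%:E)%E.

Let metk : measurable_fun setT etk.
Proof.
apply: (@measurable_fun_fubini_tonelli_F _ _ (measurableTypeR R) (measurableTypeR R)
  R leb (fun z => (ell a t z.2 * (z.1 - z.2) `^ (2 * a - 1))%:E)).
  by rewrite /ell; meas.
by move=> z; rewrite lee_fin mulr_ge0 ?powR_ge0 ?ell_ge0.
Qed.

Lemma measurable_tail_kernel : measurable_fun setT tail_kernel.
Proof. exact: (measurableT_comp (fine_measurable measurableT) metk). Qed.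

Lemma tail_kernel_ge0 x : 0 <= tail_kernel x.
Proof.
by rewrite fine_ge0// int_ge0// => y; rewrite mulr_ge0 ?powR_ge0 ?ell_ge0.
Qed.

Lemma tail_kernelE x : t < x -> etk x = (tail_kernel x)%:E.
Proof.
move=> tx; rewrite /tail_kernel fineK// ge0_fin_numE; last first.
  by apply: int_ge0 => y; rewrite mulr_ge0 ?powR_ge0 ?ell_ge0.
apply: (@le_lt_trans _ _ (\int[leb]_y ((x - t) `^ (2 * a - 1) * ell a t y)%:E)%E).
  have mell := measurable_ell a t.
  apply: int_le; [by meas|by meas| |].
    by move=> y; rewrite mulr_ge0 ?powR_ge0 ?ell_ge0.
  move=> y; have [yt|yt] := ltP y t; last first.
    by rewrite /ell (ltNge y t) yt andbF !mul0r mulr0.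
  rewrite mulrC ler_wpM2r ?ell_ge0//.
  have xt0 : 0 < x - t by rewrite subr_gt0.
  rewrite (_ : 2 * a - 1 = - (1 - 2 * a)); last by ring.
  rewrite !powRN lef_pV2 ?posrE ?powR_gt0//; last by lra.
  rewrite ge0_ler_powR ?nnegrE//; [|lra|lra|lra].
  by move: a_bnd => /andP[]; lra.
rewrite int_Zl; [by rewrite integral_ell -EFinM ltry|exact: powR_ge0|exact: measurable_ell|].
by move=> y; exact: ell_ge0.
Qed.

(** Tonelli: integrating in x first turns (x - y)^(2a - 1) into the difference
    of (v - y)^(2a) and (u - y)^(2a), the integrands of [ellL]. *)
Lemma tail_kernel_primitive u v : t <= u -> u <= v ->
  intble leb (fun x => \I[u < x <= v] * (2 * a * tail_kernel x)) /\
  rint leb (fun x => \I[u < x <= v] * (2 * a * tail_kernel x)) = covM v - covM u.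
Proof.
move=> tu uv.
have u0 : 0 <= u by exact: le_trans (ltW t0) tu.
have IL w : t <= w -> intble leb (ellL a t w).
  by move=> tw; apply: intble_ellL; exact: le_trans (ltW t0) tw.
have tv : t <= v by exact: le_trans uv.
have [a0|a0] := eqVneq a 0.
  have E : (fun x => \I[u < x <= v] * (2 * a * tail_kernel x)) = (fun=> 0).
    by apply/funext => x; rewrite a0 mulr0 mul0r mulr0.
  rewrite E rint0; split; first exact: intble0.
  rewrite (covM_above tv) (covM_above tu).
  suff -> : rint leb (ellL a t v) = rint leb (ellL a t u) by rewrite subrr.
  apply: eqr => x; rewrite /ellL a0 mulr0 !powRr0 !mulr1.
  have [xt|tx] := ltP x t; last by rewrite /ell (ltNge x t) tx andbF !mul0r !mulr0.
  by rewrite (lt_le_trans xt tv) (lt_le_trans xt tu).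
have a20 : 2 * a != 0 by rewrite mulf_neq0// pnatr_eq0.
have mtk := measurable_tail_kernel.
have key : (\int[leb]_x (\I[u < x <= v] * tail_kernel x)%:E =
    ((rint leb (ellL a t v) - rint leb (ellL a t u)) / (2 * a))%:E)%E.
  rewrite int_oc//.
  transitivity (\int[leb]_x \int[leb]_y
      (\I[u < x < v] * (ell a t y * (x - y) `^ (2 * a - 1)))%:E)%E.
    apply: eq_integral => x _; have [/andP[ux xv]|_] := boolP (u < x < v); last first.
      by rewrite mul0r integral0_eq// => y _; rewrite mul0r.
    rewrite mul1r -tail_kernelE; last by exact: le_lt_trans ux.
    by apply: eq_integral => y _; rewrite mul1r.
  rewrite tonelli; last 2 first.
  - by rewrite /ell; meas.
  - by move=> x y; rewrite !mulr_ge0 ?powR_ge0.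
  have -> : (rint leb (ellL a t v) - rint leb (ellL a t u)) / (2 * a) =
      rint leb (fun y => (2 * a)^-1 * (ellL a t v y - ellL a t u y)).
    rewrite rintZ; last by apply: intbleB; exact: IL.
    by rewrite rintB; [rewrite mulrC|exact: IL|exact: IL].
  rewrite -rintE; last by apply: intbleZ; apply: intbleB; exact: IL.
  apply: eq_integral => y _.
  have [yt|ty] := ltP y t; last first.
    rewrite /ellL /ell (ltNge y t) ty andbF !mul0r !mulr0 subrr mulr0.
    by rewrite integral0_eq// => x _; rewrite mul0r mulr0.
  transitivity (\int[leb]_x (ell a t y * (\I[u < x < v] * (x - y) `^ (2 * a - 1)))%:E)%E.
    by apply: eq_integral => x _; congr EFin; ring.
  rewrite int_Zl; [|exact: ell_ge0|by meas|by move=> x; rewrite mulr_ge0 ?powR_ge0].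
  have yu : y < u by exact: lt_le_trans tu.
  rewrite integral_powR_right ?yu ?orbT ?(ltW yu)// -EFinM; congr EFin.
  by rewrite /ellL (lt_le_trans yu uv) yu !mul1r; ring.
have I : intble leb (fun x => \I[u < x <= v] * tail_kernel x).
  apply: intble_ge0; [by meas| |by rewrite key ltry].
  by move=> x; rewrite mulr_ge0 ?tail_kernel_ge0.
have E : (fun x => \I[u < x <= v] * (2 * a * tail_kernel x)) =
    (fun x => 2 * a * (\I[u < x <= v] * tail_kernel x)).
  by apply/funext => x; ring.
rewrite E; split; first exact: intbleZ.
rewrite (rintZ _ I) (covM_above tv) (covM_above tu).
have -> : rint leb (fun x => \I[u < x <= v] * tail_kernel x) =
    (rint leb (ellL a t v) - rint leb (ellL a t u)) / (2 * a) by rewrite /rint key.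
move: (rint _ _) (rint _ _) => p q.
by rewrite mulrCA (divff a20) mulr1; ring.
Qed.

(** The derivative of [covM] on both sides of t. *)
Definition covM_density (x : R) : R :=
  \I[0 < x <= t] * (2 * B) + \I[t < x] * (2 * a * tail_kernel x).

Lemma measurable_covM_density : measurable_fun setT covM_density.
Proof. by have ? := measurable_tail_kernel; rewrite /covM_density; meas. Qed.

Lemma covM_density_primitive : primitive_of covM_density covM.
Proof.
move=> u v u0 uv.
have mtk := measurable_tail_kernel.
(* the interval ]u, v] is cut at t *)
pose u1 := Num.min u t; pose v1 := Num.min v t.
pose u2 := Num.max u t; pose v2 := Num.max v t.
have u1v1 : u1 <= v1.
  by rewrite le_min !ge_min uv lexx orbT.
have u2v2 : u2 <= v2 by rewrite ge_max !le_max uv lexx orbT.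
have tu2 : t <= u2 by rewrite le_max lexx orbT.
have [I2 J2] := tail_kernel_primitive tu2 u2v2.
pose f1 x := 2 * B * (\I[u1 < x <= v1] * 1).
have i1 : (\int[leb]_x (\I[(u1 < x <= v1)%R] * 1)%:E = (v1 - u1)%:E)%E.
  rewrite int_oc; last exact: measurable_cst.
  by under eq_integral do rewrite mulr1; exact: int_len.
have I1' : intble leb (fun x => \I[u1 < x <= v1] * 1).
  by apply: intble_ge0; [meas|move=> x; rewrite mulr1|rewrite i1 ltry].
have I1 : intble leb f1 by exact: intbleZ.
have E : (fun x => \I[u < x <= v] * covM_density x) =
    (fun x => f1 x + \I[u2 < x <= v2] * (2 * a * tail_kernel x)).
  apply/funext => x.
  rewrite /f1 /covM_density /u1 /v1 /u2 /v2 gt_min le_min gt_max le_max mulr1.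
  case: (leP x t) => [xt|tx] /=.
    rewrite !orbF !andbT !andbF/= !mul0r !addr0.
    have [ux|ux] := ltP u x; last by rewrite mul0r mulr0.
    by rewrite (le_lt_trans u0 ux) /= mul1r mulrC.
  rewrite !orbT !andbF !andbT !orbF/=.
  by rewrite mulr0 !add0r mul0r add0r mul1r.
rewrite E; split; first exact: intbleD.
have R1 : rint leb f1 = 2 * B * (v1 - u1) by rewrite (rintZ _ I1') /rint i1.
rewrite (rintD I1 I2) R1 J2 /v1 /u1 /v2 /u2.
have ME w : 0 <= w -> covM w = 2 * B * Num.min w t + (covM (Num.max w t) - covM t).
  move=> w0; have [wt|tw] := leP w t.
    by rewrite subrr addr0 (covM_below w0 wt) mulrAC.
  by rewrite (covM_below (ltW t0) (lexx t)); move: (covM w) => p; ring.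
rewrite (ME v (le_trans u0 uv)) (ME u u0).
move: (covM _) (covM _) (covM _) => p q r; ring.
Qed.

End covariance_primitive.

(** * Functionals controlled by the integrand norm *)

Section norm_estimates.
Variable R : realType.
Local Notation leb := (@lebesgue_measure R).
Variable H : R.
Hypothesis H01 : 0 < H < 1.
Let a := H - 2^-1.
Let kerE : 2 * H - 2 = 2 * a - 1. Proof. by rewrite /a; field. Qed.

Lemma integral_powR_left_tail c x : 0 < c -> 0 < x ->
  (\int[leb]_y (\I[y < 0] * (x - y) `^ (- c - 1))%:E = (x `^ (- c) / c)%:E)%E.
Proof.
move=> c0 x0; rewrite -integral_powR_tail; [|exact: c0|exact: x0].
have := @ge0_integral_affine R (-1) x (fun z => (\I[x < z] * z `^ (- c - 1))%:E).
rewrite normrN1 invr1 mul1e => <-.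
- apply: eq_integral => y _; have -> : -1 * y + x = x - y by ring.
  by rewrite ltrDl oppr_gt0.
- by rewrite oppr_eq0 oner_eq0.
- by meas.
- by move=> z; rewrite lee_fin mulr_ge0// powR_ge0.
Qed.

Lemma measurable_inner (F : R -> R -> R) :
  measurable_fun setT (fun z : R * R => F z.1 z.2) -> (forall x y, 0 <= F x y) ->
  measurable_fun setT (fun x => \int[leb]_y (F x y)%:E)%E.
Proof.
move=> mF F0.
apply: (@measurable_fun_fubini_tonelli_F _ _ (measurableTypeR R) (measurableTypeR R)
  R leb (fun z => (F z.1 z.2)%:E)).
  exact: measR_EFin.
by move=> z; rewrite lee_fin.
Qed.

Lemma iint_le (F G : R -> R -> R) :
  measurable_fun setT (fun z : R * R => F z.1 z.2) ->
  measurable_fun setT (fun z : R * R => G z.1 z.2) ->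
  (forall x y, 0 <= F x y) -> (forall x y, 0 <= G x y) ->
  (forall x, (\int[leb]_y (F x y)%:E <= \int[leb]_y (G x y)%:E)%E) ->
  (\int[leb]_x \int[leb]_y (F x y)%:E <= \int[leb]_x \int[leb]_y (G x y)%:E)%E.
Proof.
move=> mF mG F0 G0 FG; apply: ge0_le_integral => //.
all: try by move=> x _; exact: int_ge0.
all: exact: measurable_inner.
Qed.

Lemma measurable_slice (F : R -> R -> R) x :
  measurable_fun setT (fun z : R * R => F z.1 z.2) -> measurable_fun setT (F x).
Proof.
move=> mF; have -> : F x = (fun z : R * R => F z.1 z.2) \o (fun y => (x, y)) by [].
exact: (measurableT_comp mF (measurable_pair1 x)).
Qed.

(** For H < 1/2, since g vanishes on the negatives, restricting the Gagliardo
    integral to pairs x > 0 > y leaves g(x)^2 |x - y|^(2H-2), and integrating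
    over y gives the weight x^(2a). *)
Lemma weighted_L2_le : H <= 2^-1 -> exists2 C : R, 0 <= C & forall g : R -> R,
  measurable_fun setT g -> (forall x, x <= 0 -> g x = 0) ->
  (\int[leb]_x ((g x * (\I[0 < x] * x `^ a)) ^+ 2)%:E <= C%:E * integrand_norm2 H g)%E.
Proof.
move: H01 => /andP[H0 H1].
rewrite le_eqVlt => /predU1P[HE|Hlt].
  exists 1 => // g mg g0; rewrite mul1e /integrand_norm2 HE ltxx eqxx.
  apply: int_le; [by meas|by meas|by move=> x; exact: sqr_ge0|].
  move=> x; rewrite /a HE subrr powRr0 mulr1.
  by case: (0 < x); rewrite ?mulr1// mulr0 expr0n sqr_ge0.
pose c := H * (1 - 2 * H) / 2; have c0 : 0 < c by rewrite !mulr_gt0//; lra.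
have a0 : 0 < - (2 * a) by rewrite /a; lra.
exists (- (2 * a) / c); first by rewrite divr_ge0// ltW.
move=> g mg g0; rewrite /integrand_norm2 Hlt -/c.
rewrite muleA -EFinM divfK ?gt_eqF//.
have mgy : measurable_fun setT (fun z : R * R => g z.2) by exact: (measurableT_comp mg).
have mgx : measurable_fun setT (fun z : R * R => g z.1) by exact: (measurableT_comp mg).
pose F (x y : R) := (g x * \I[0 < x]) ^+ 2 * (\I[y < 0] * (x - y) `^ (2 * a - 1)).
have F0 x y : 0 <= F x y.
  by apply: mulr_ge0; [exact: sqr_ge0|rewrite mulr_ge0 ?powR_ge0].
have mF : measurable_fun setT (fun z : R * R => F z.1 z.2) by rewrite /F; meas.
have -> : (\int[leb]_x ((g x * (\I[0 < x] * x `^ a)) ^+ 2)%:E =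
    (- (2 * a))%:E * \int[leb]_x \int[leb]_y (F x y)%:E)%E.
  rewrite -ge0_integralZl; last 4 first.
  - exact: measurableT.
  - exact: measurable_inner.
  - by move=> x _; exact: int_ge0.
  - by rewrite lee_fin ltW.
  apply: eq_integral => x _; rewrite /F int_Zl; last 3 first.
  - exact: sqr_ge0.
  - by meas.
  - by move=> y; rewrite mulr_ge0 ?powR_ge0.
  have [x0|x0] := ltP 0 x; last first.
    by rewrite mul0r !mulr0 expr0n/= mul0e mule0.
  rewrite (_ : 2 * a - 1 = - - (2 * a) - 1); last by rewrite opprK.
  rewrite integral_powR_left_tail// opprK -!EFinM; congr EFin.
  rewrite !mulr1 mul1r exprMn [2 * a]mulrC powRrM (powR_mulrn _ (powR_ge0 _ _)).
  by rewrite [a * 2]mulrC; field; lra.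
apply: lee_pmul => //; first by rewrite lee_fin ltW.
  by apply: integral_ge0 => x _; exact: int_ge0.
apply: iint_le => //.
- by meas.
- by move=> x y; rewrite mulr_ge0 ?sqr_ge0 ?powR_ge0.
move=> x; apply: int_le.
- exact: (measurable_slice (F := F)).
- by meas.
- exact: F0.
move=> y; rewrite /F kerE; have [y0|y0] := ltP y 0; last first.
  by rewrite mul0r mulr0 mulr_ge0 ?sqr_ge0 ?powR_ge0.
have [x0|x0] := ltP 0 x; last first.
  by rewrite mulr0 expr0n mul0r mulr_ge0 ?sqr_ge0 ?powR_ge0.
rewrite (g0 y (ltW y0)) subr0 mulr1 mul1r gtr0_norm// subr_gt0.
exact: lt_trans x0.
Qed.

(** A product of two such weights is dominated by |x - y|^(2H-2), because the
    distance of two positive numbers is at most the larger one. *)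
Definition tail_weight (x : R) : R := \I[0 < x] * Num.min 1 (x `^ (2 * a - 1)).

Lemma measurable_tail_weight : measurable_fun setT tail_weight.
Proof.
rewrite /tail_weight; apply: measR_M; first by meas.
by apply: measurable_minr; meas.
Qed.

Lemma tail_weight_ge0 x : 0 <= tail_weight x.
Proof. by rewrite mulr_ge0// le_min ler01 powR_ge0. Qed.

(** The square of the weighted L^1 norm is a double integral, compared with
    the norm pointwise off the diagonal. *)
Lemma weighted_L1_le : 2^-1 < H -> exists2 C : R, 0 <= C & forall g : R -> R,
  measurable_fun setT g ->
  ((\int[leb]_x (`|g x| * tail_weight x)%:E) * (\int[leb]_x (`|g x| * tail_weight x)%:E)
   <= C%:E * integrand_norm2 H g)%E.
Proof.
move: H01 => /andP[H0 H1] Hgt.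
have mw := measurable_tail_weight.
pose c := H * (2 * H - 1); have c0 : 0 < c by rewrite !mulr_gt0//; lra.
have a0 : 0 < a by rewrite /a; lra.
have a1 : 2 * a - 1 < 0 by rewrite /a; lra.
exists c^-1; first by rewrite invr_ge0 ltW.
move=> g mg; rewrite /integrand_norm2.
have -> : (H < 2^-1) = false by apply/negbTE; rewrite -leNgt ltW.
have -> : (H == 2^-1) = false by apply/negbTE; rewrite gt_eqF.
rewrite -/c muleA -EFinM mulVf ?gt_eqF// mul1e.
have mgy : measurable_fun setT (fun z : R * R => g z.2) by exact: (measurableT_comp mg).
have mgx : measurable_fun setT (fun z : R * R => g z.1) by exact: (measurableT_comp mg).
have mwy : measurable_fun setT (fun z : R * R => tail_weight z.2).
  exact: (measurableT_comp mw).
have mwx : measurable_fun setT (fun z : R * R => tail_weight z.1).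
  exact: (measurableT_comp mw).
have gw0 x : 0 <= `|g x| * tail_weight x by rewrite mulr_ge0// tail_weight_ge0.
have mgw : measurable_fun setT (fun x => `|g x| * tail_weight x) by meas.
rewrite -ge0_integralZr; last 4 first.
- exact: measurableT.
- exact: measR_EFin.
- by move=> x _; rewrite lee_fin.
- exact: int_ge0.
under eq_integral do rewrite -int_Zl//.
apply: iint_le.
- by meas.
- by meas.
- by move=> x y; rewrite mulr_ge0.
- by move=> x y; rewrite !mulr_ge0 ?powR_ge0.
(* the comparison fails on the diagonal, where 0 to a negative power is 0 *)
move=> x; pose D := [set y : R | y != x].
have mD : measurable D.
  rewrite (_ : D = ~` [set x]); first by apply: measurableC.
  by apply/seteqP; split => y /= /eqP.
have -> : (\int[leb]_y (`|g x| * tail_weight x * (`|g y| * tail_weight y))%:E =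
   \int[leb]_y (\I[y != x] * (`|g x| * tail_weight x * (`|g y| * tail_weight y)))%:E)%E.
  rewrite (@integral_ind R _ (measurableTypeR R) leb D)//.
  rewrite (_ : D = setT `\ x); last first.
    by apply/seteqP; split => y /=; [move=> /eqP|move=> [_ /eqP]].
  rewrite integral_setD1//; first by rewrite setTD; apply: measurableC.
  apply: measurable_funTS; apply: measR_EFin; apply: measR_M; first by meas.
  exact: mgw.
apply: int_le.
- apply: measR_M; last by meas.
  apply: measR_bool; apply: (measurable_fun_bool true).
  by rewrite setTI (_ : _ @^-1` _ = D).
- by meas.
- by move=> y; apply: mulr_ge0 => //; apply: mulr_ge0; exact: gw0.
move=> y; have [->|yx] := eqVneq y x; first by rewrite mul0r !mulr_ge0 ?powR_ge0.
rewrite mul1r mulrACA ler_wpM2l ?mulr_ge0// /tail_weight kerE.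
have [x0|x0] := ltP 0 x; last by rewrite !mul0r powR_ge0.
have [y0|y0] := ltP 0 y; last by rewrite mul0r mulr0 powR_ge0.
rewrite !mul1r.
wlog xy : x y x0 y0 yx {D mD} / x < y.
  move=> W; case: (ltgtP x y) yx => // xy _; first by apply: W; rewrite ?(gt_eqF xy).
  by rewrite mulrC distrC; apply: W; rewrite ?(gt_eqF xy).
apply: (@le_trans _ _ (1 * (y `^ (2 * a - 1)))).
  by apply: ler_pM; rewrite ?le_min ?ler01 ?powR_ge0// ge_min lexx ?orbT.
rewrite mul1r ltr0_norm ?subr_lt0// opprB (_ : 2 * a - 1 = - (1 - 2 * a)); last by ring.
rewrite !powRN lef_pV2 ?posrE ?powR_gt0 ?subr_gt0//.
by rewrite ge0_ler_powR ?nnegrE ?subr_ge0 ?(ltW xy) ?(ltW y0)//; [lra|rewrite gerBl ltW].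
Qed.

(** Conditions under which f |-> int f psi is controlled by the norm, in terms
    of the two weights above. *)
Definition testable (psi : R -> R) : Prop :=
  [/\ measurable_fun setT psi,
    H <= 2^-1 -> (\int[leb]_x ((\I[0 < x] * (psi x * x `^ (- a))) ^+ 2)%:E < +oo)%E &
    2^-1 < H -> exists C : R, forall x : R, 0 < x -> `|psi x| <= C * tail_weight x].

Lemma testable_cvg0 (psi : R -> R) (g : nat -> R -> R) : testable psi ->
  (forall n, measurable_fun setT (g n)) -> (forall n x, x <= 0 -> g n x = 0) ->
  integrand_norm2 H (g n) @[n --> \oo] --> 0%E ->
  (\int[leb]_x (`|g n x * psi x|)%:E)%E @[n --> \oo] --> 0%E.
Proof.
move=> [mpsi psiL psiR] mg g0 Ng; have [Hle|Hgt] := leP H 2^-1.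
  have psioo := psiL Hle.
  have [C C0 CH] := weighted_L2_le Hle.
  pose psi' (x : R) := \I[0 < x] * (psi x * x `^ (- a)).
  rewrite (_ : (fun n => _) = fun n =>
      (\int[leb]_x (`|g n x * (\I[0 < x] * x `^ a) * psi' x|)%:E)%E); last first.
    apply/funext => n; apply: eq_integral => x _; rewrite /psi'.
    have [x0|x0] := ltP 0 x; last by rewrite g0// !mul0r.
    by rewrite powRN !mul1r; congr (`|_|%:E); field; rewrite gt_eqF// powR_gt0.
  apply: int_mul_cvg0 => //.
  - by move=> n; have ? := mg n; meas.
  - by rewrite /psi'; meas.
  apply: (cvge0_le C0 _ _ _ Ng).
  - by move=> n; apply: int_ge0 => x; exact: sqr_ge0.
  - move=> n; rewrite /integrand_norm2; case: ifP => [Hlt|HN].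
      apply: mule_ge0.
        by rewrite lee_fin !mulr_ge0//; move: H01 => /andP[]; lra.
      by apply: integral_ge0 => x _; apply: int_ge0 => y; rewrite mulr_ge0 ?sqr_ge0 ?powR_ge0.
    case: ifP => [_|HE]; first by apply: int_ge0 => x; exact: sqr_ge0.
    by move: Hle; rewrite le_eqVlt HE HN.
  - by move=> n; apply: CH; [exact: mg|exact: g0].
have [C psiC] := psiR Hgt.
have [C' C'0 CH] := weighted_L1_le Hgt.
have mw := measurable_tail_weight.
have J0 n : (0 <= \int[leb]_x (`|g n x| * tail_weight x)%:E)%E.
  by apply: int_ge0 => x; rewrite mulr_ge0 ?tail_weight_ge0.
have J : (\int[leb]_x (`|g n x| * tail_weight x)%:E)%E @[n --> \oo] --> 0%E.
  have JJ : ((\int[leb]_x (`|g n x| * tail_weight x)%:E) *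
      (\int[leb]_x (`|g n x| * tail_weight x)%:E))%E @[n --> \oo] --> 0%E.
    apply: (cvge0_le C'0 _ _ _ Ng).
    - by move=> n; exact: mule_ge0.
    - move=> n; have := CH _ (mg n).
      rewrite /integrand_norm2 ltNge (ltW Hgt)/= gt_eqF// => _.
      apply: mule_ge0; first by rewrite lee_fin mulr_ge0//; move: H01 => /andP[]; lra.
      by apply: integral_ge0 => x _; apply: int_ge0 => y; rewrite !mulr_ge0 ?powR_ge0.
    - by move=> n; exact: CH.
  move/cvge0P : JJ => /(_ (fun n => mule_ge0 (J0 n) (J0 n))) JJ.
  apply/cvge0P => // e e0; have := JJ (e ^+ 2) (exprn_gt0 _ e0).
  apply: filterS => n; move: (J0 n).
  case: (\int[leb]_x _)%E => [r||]//.
  - rewrite -EFinM !lee_fin => r0; rewrite -expr2 ler_sqr ?nnegrE//; exact: ltW.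
have C0 : 0 <= Num.max C 0 by rewrite le_max lexx orbT.
apply: (cvge0_le C0 _ J0 _ J).
- by move=> n; apply: int_ge0.
move=> n; rewrite -int_Zl; last 3 first.
- exact: C0.
- by have ? := mg n; meas.
- by move=> x; rewrite mulr_ge0 ?tail_weight_ge0.
apply: int_le.
- by have ? := mg n; meas.
- by have ? := mg n; meas.
- by [].
move=> x; have [x0|x0] := ltP 0 x; last by rewrite g0// mul0r normr0 mul0r mulr0.
rewrite normrM mulrCA ler_wpM2l//; apply: le_trans (psiC _ x0) _.
by rewrite ler_wpM2r ?tail_weight_ge0// le_max lexx.
Qed.

End norm_estimates.

Section testable_functions.
Variable R : realType.
Local Notation leb := (@lebesgue_measure R).
Variable H : R.
Hypothesis H01 : 0 < H < 1.
Let a := H - 2^-1.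
Let a_bnd : - 2^-1 < a < 2^-1.
Proof. by rewrite /a; move: H01 => /andP[? ?]; apply/andP; split; lra. Qed.

Lemma ler_powR_neg (p x y : R) : p <= 0 -> 0 < x -> x <= y -> y `^ p <= x `^ p.
Proof.
move=> p0 x0 xy; have y0 : 0 < y by exact: lt_le_trans xy.
rewrite -[p]opprK !(powRN _ (- p)) lef_pV2 ?posrE ?powR_gt0//.
by rewrite ge0_ler_powR ?oppr_ge0 ?nnegrE ?(ltW x0) ?(ltW y0).
Qed.

(** Split (x - y)^(2a-1) into the powers p and q and bound x - y below by
    x - t in the first and by x (t - y) / t in the second; the latter leaves a
    convergent Beta integral. The freedom in p and q is needed because the
    singularity at x = t and the decay at infinity compete. *)
Lemma tail_kernel_le (t p q : R) : 0 < t -> p <= 0 -> q <= 0 ->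
  p + q = 2 * a - 1 -> - 1 < q - a ->
  exists2 N : R, 0 <= N &
    forall x, t < x -> tail_kernel a t x <= N * ((x - t) `^ p * x `^ q).
Proof.
move=> t0 p0 q0 pq qa.
have a1 : 0 < 1 - a by move: a_bnd => /andP[]; lra.
have qa1 : 0 < q - a + 1 by lra.
have mell := measurable_ell a t.
pose F (y : R) := ell a t y * (t - y) `^ q.
have F0 y : 0 <= F y by rewrite mulr_ge0 ?ell_ge0 ?powR_ge0.
have FE : (\int[leb]_y (F y)%:E =
    (t `^ ((1 - a) + (q - a + 1) - 1) * Beta (1 - a) (q - a + 1))%:E)%E.
  rewrite EFinM -eBeta_fin// -integral_Beta_scale; last exact: t0.
  apply: eq_integral => y _; rewrite /F /ell.
  have [/andP[y0 yt]|_] := boolP (0 < y < t); last by rewrite !mul0r.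
  rewrite !mul1r -mulrA -powRD; last by rewrite subr_eq0 (gt_eqF yt) implybT.
  by congr ((_ `^ _ * _ `^ _)%:E); ring.
pose N := fine (\int[leb]_y (F y)%:E)%E.
have NE : (\int[leb]_y (F y)%:E = N%:E)%E by rewrite /N FE.
exists (t `^ (- q) * N); first by rewrite mulr_ge0 ?powR_ge0// fine_ge0// int_ge0.
move=> x tx; have x0 : 0 < x by exact: lt_trans tx.
rewrite -lee_fin -(tail_kernelE a_bnd t0 tx).
have -> : (t `^ (- q) * N * ((x - t) `^ p * x `^ q))%:E =
   (\int[leb]_y (t `^ (- q) * ((x - t) `^ p * x `^ q) * F y)%:E)%E.
  rewrite int_Zl; last 3 first.
  - by rewrite !mulr_ge0 ?powR_ge0.
  - by rewrite /F; meas.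
  - exact: F0.
  by rewrite NE -EFinM; congr EFin; ring.
apply: int_le.
- by meas.
- by rewrite /F; meas.
- by move=> y; rewrite mulr_ge0 ?ell_ge0 ?powR_ge0.
move=> y; rewrite /F [leRHS]mulrCA.
have [/andP[y0 yt]|nyt] := boolP (0 < y < t); last first.
  by rewrite /ell (negbTE nyt) !mul0r.
rewrite ler_wpM2l ?ell_ge0// -pq powRD; last first.
  by rewrite subr_eq0 (gt_eqF (lt_trans yt tx)) implybT.
rewrite (_ : _ * _ * _ = (x - t) `^ p * (t `^ (- q) * (x `^ q * (t - y) `^ q))); last by ring.
apply: ler_pM; rewrite ?powR_ge0//.
  by apply: ler_powR_neg => //; lra.
have -> : t `^ (- q) * (x `^ q * (t - y) `^ q) = (t^-1 * (x * (t - y))) `^ q.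
  rewrite powRM ?invr_ge0 ?mulr_ge0 ?subr_ge0 ?(ltW t0) ?(ltW x0) ?(ltW yt)//.
  rewrite powRM ?subr_ge0 ?(ltW x0) ?(ltW yt)//; congr (_ * _).
  by rewrite -(powR_inv1 (ltW t0)) -powRrM mulN1r.
apply: ler_powR_neg => //.
  by rewrite !mulr_gt0 ?invr_gt0 ?subr_gt0.
rewrite mulrC ler_pdivrMr//.
have : 0 <= y * (x - t) by rewrite mulr_ge0 ?subr_ge0 // ltW.
lra.
Qed.

Lemma tail_weight_near t x : a < 2^-1 -> 0 < x -> x <= t ->
  1 <= Num.max 1 (t `^ (1 - 2 * a)) * tail_weight H x.
Proof.
move=> a1 x0 xt; rewrite /tail_weight x0 mul1r -/a.
have t0 : 0 < t by exact: lt_le_trans xt.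
rewrite /Num.min; case: ifP => _; first by rewrite mulr1 le_max lexx.
apply: (@le_trans _ _ (t `^ (1 - 2 * a) * x `^ (2 * a - 1))); last first.
  by rewrite ler_wpM2r ?powR_ge0// le_max lexx orbT.
rewrite (_ : 1 - 2 * a = - (2 * a - 1)); last by ring.
rewrite powRN mulrC ler_pdivlMr ?powR_gt0// mul1r ler_powR_neg//; lra.
Qed.

Lemma tail_weight_far t x : a < 2^-1 -> 0 < t -> t <= x ->
  x `^ (2 * a - 1) <= Num.max 1 (t `^ (2 * a - 1)) * tail_weight H x.
Proof.
move=> a1 t0 tx; have x0 : 0 < x by exact: lt_le_trans tx.
rewrite /tail_weight x0 mul1r -/a.
rewrite /Num.min; case: ifP => _.
  rewrite mulr1 le_max; apply/orP; right; rewrite ler_powR_neg//; lra.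
by rewrite ler_peMl ?powR_ge0// le_max lexx.
Qed.

(** For a < 0 the exponents of [tail_kernel_le] are chosen with
    s = (a + 1/2) / 2, which makes the squared bound integrable at t (as
    2 (a - s) > -1) and at infinity. *)
Lemma testable_covM_density t : 0 < t -> testable H (covM_density a t).
Proof.
move=> t0; have [an1 a1] := andP a_bnd.
have mQ := measurable_covM_density a t.
have mtk := measurable_tail_kernel a t.
have B0 : 0 < Beta (1 + a) (1 - a) by apply: Beta_gt0; lra.
split=> //; rewrite -/a.
- move=> Hle; have a0 : a <= 0 by rewrite /a; lra.
  pose F1 (x : R) := (2 * Beta (1 + a) (1 - a)) ^+ 2 *
    (\I[0 < x <= t] * x `^ ((1 - 2 * a) - 1)).
  have F10 x : 0 <= F1 x.
    by rewrite /F1 mulr_ge0 ?sqr_ge0// mulr_ge0 ?powR_ge0.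
  have mF1 : measurable_fun setT F1 by rewrite /F1; meas.
  have F1oo : (\int[leb]_x (F1 x)%:E < +oo)%E.
    rewrite int_Zl; last 3 first.
    - exact: sqr_ge0.
    - by meas.
    - by move=> x; rewrite mulr_ge0 ?powR_ge0.
    rewrite int_oc; last by meas.
    rewrite integral_powR0; [|lra|exact: ltW].
    by rewrite -EFinM ltry.
  have xx x : 0 < x -> (x `^ (- a)) ^+ 2 = x `^ ((1 - 2 * a) - 1).
    move=> x0; rewrite -powR_mulrn ?powR_ge0// -powRrM; congr (_ `^ _); ring.
  have [a00|a_neq0] := eqVneq a 0.
    apply: le_lt_trans F1oo; apply: int_le => //.
    - by meas.
    - by move=> x; exact: sqr_ge0.
    move=> x; rewrite /F1 /covM_density.
    have [x0|x0] := ltP 0 x; last by rewrite !mul0r expr0n mulr0.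
    rewrite /= mul1r exprMn xx// {3}a00 mulr0 mul0r mulr0 addr0 exprMn.
    by case: (x <= t); rewrite ?mul1r ?mulr1 ?expr1n ?mul1r// expr0n !mul0r mulr0.
  have a_lt0 : a < 0 by rewrite lt_neqAle a_neq0.
  pose s := (a + 2^-1) / 2.
  have [N N0 tkN] : exists2 N : R, 0 <= N & forall x, t < x ->
      tail_kernel a t x <= N * ((x - t) `^ (a - s) * x `^ (a - 1 + s)).
    by apply: tail_kernel_le => //; rewrite /s; lra.
  (* the singularity matters near t, the decay beyond 2 t; the two ranges overlap *)
  pose F2 (x : R) := (2 * a * N) ^+ 2 * (t `^ (2 * s - 2) *
      (\I[t < x < 3 * t] * (x - t) `^ ((2 * (a - s) + 1) - 1)) +
      2^-1 `^ (2 * (a - s)) * (\I[2 * t < x] * x `^ (- (1 - 2 * a) - 1))).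
  have F20 x : 0 <= F2 x.
    by rewrite mulr_ge0 ?sqr_ge0// addr_ge0// mulr_ge0 ?powR_ge0// mulr_ge0 ?powR_ge0.
  have mF2 : measurable_fun setT F2 by rewrite /F2; meas.
  have F2oo : (\int[leb]_x (F2 x)%:E < +oo)%E.
    rewrite int_Zl; last 3 first.
    - exact: sqr_ge0.
    - by meas.
    - by move=> x; rewrite addr_ge0// mulr_ge0 ?powR_ge0// mulr_ge0 ?powR_ge0.
    rewrite int_D; last 4 first.
    - by meas.
    - by meas.
    - by move=> x; rewrite mulr_ge0 ?powR_ge0// mulr_ge0 ?powR_ge0.
    - by move=> x; rewrite mulr_ge0 ?powR_ge0// mulr_ge0 ?powR_ge0.
    rewrite int_Zl; [|exact: powR_ge0|by meas|by move=> x; rewrite mulr_ge0 ?powR_ge0].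
    rewrite int_Zl; [|exact: powR_ge0|by meas|by move=> x; rewrite mulr_ge0 ?powR_ge0].
    have e0 : 0 < 2 * (a - s) + 1 by rewrite /s; lra.
    rewrite integral_powR_right ?e0 ?gt_eqF//; last by lra.
    rewrite integral_powR_tail; [|lra|lra].
    by rewrite -!EFinM ltry.
  apply: (@le_lt_trans _ _ (\int[leb]_x (F1 x + F2 x)%:E)%E); last first.
    by rewrite int_D// lte_add_pinfty.
  apply: int_le.
  - by meas.
  - by meas.
  - by move=> x; exact: sqr_ge0.
  move=> x; rewrite /covM_density.
  have [x0|x0] := ltP 0 x; last by rewrite mul0r expr0n addr_ge0.
  rewrite /= mul1r exprMn xx//; have [xt|tx] := leP x t.
    rewrite mul1r mul0r addr0 ler_wpDr//.
    by rewrite /F1 x0 xt /= mul1r.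
  rewrite mul0r add0r mul1r ler_wpDl// /F2.
  apply: (@le_trans _ _ ((2 * a) ^+ 2 * ((N * ((x - t) `^ (a - s) * x `^ (a - 1 + s))) ^+ 2 *
      x `^ (1 - 2 * a - 1)))).
    rewrite exprMn -mulrA ler_wpM2l ?sqr_ge0//.
    rewrite ler_wpM2r ?powR_ge0// ler_sqr ?nnegrE ?tail_kernel_ge0//; first exact: tkN.
    by rewrite !mulr_ge0 ?powR_ge0.
  have E (Y Z : R) : (2 * a) ^+ 2 * ((N * Y) ^+ 2 * Z) = (2 * a * N) ^+ 2 * (Y ^+ 2 * Z).
    by ring.
  rewrite E.
  rewrite ler_wpM2l ?sqr_ge0//.
  have xt0 : 0 < x - t by rewrite subr_gt0.
  have -> : ((x - t) `^ (a - s) * x `^ (a - 1 + s)) ^+ 2 * x `^ (1 - 2 * a - 1) =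
      (x - t) `^ (2 * (a - s)) * x `^ (2 * s - 2).
    rewrite exprMn -!powR_mulrn ?powR_ge0// -!powRrM -mulrA -powRD ?(gt_eqF x0) ?implybT//.
    by congr (_ `^ _ * _ `^ _); ring.
  rewrite tx /= addrK; have [x3|x3] := ltP x (3 * t).
    rewrite mul1r ler_wpDr//; first by rewrite mulr_ge0 ?powR_ge0// mulr_ge0 ?powR_ge0.
    by rewrite mulrC ler_wpM2r ?powR_ge0// ler_powR_neg ?(ltW tx)// /s; lra.
  rewrite mul0r mulr0 add0r (_ : 2 * t < x); last by lra.
  rewrite mul1r (_ : - (1 - 2 * a) - 1 = 2 * (a - s) + (2 * s - 2)); last by ring.
  rewrite (@powRD _ x (2 * (a - s)) (2 * s - 2)) ?(gt_eqF x0) ?implybT// mulrA ler_wpM2r ?powR_ge0//.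
  rewrite -powRM ?invr_ge0 ?(ltW x0)//.
  by apply: ler_powR_neg; rewrite /s; lra.
- move=> Hgt; have a0 : 0 < a by rewrite /a; lra.
  have [N N0 tkN] : exists2 N : R, 0 <= N & forall x, t < x ->
      tail_kernel a t x <= N * ((x - t) `^ 0 * x `^ (2 * a - 1)).
    by apply: tail_kernel_le => //; lra.
  have B20 : 0 <= 2 * Beta (1 + a) (1 - a) by rewrite mulr_ge0 ?(ltW B0).
  exists (2 * Beta (1 + a) (1 - a) * Num.max 1 (t `^ (1 - 2 * a)) +
    2 * a * N * Num.max 1 (t `^ (2 * a - 1))) => x x0.
  have mx0 (c : R) : 0 <= Num.max 1 c by rewrite le_max ler01.
  have aN0 : 0 <= 2 * a * N by rewrite !mulr_ge0// ltW.
  have w0 := tail_weight_ge0 H x.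
  rewrite mulrDl /covM_density x0 /=; have [xt|tx] := leP x t.
    rewrite mul1r mul0r addr0 ger0_norm// ler_wpDr//; first exact: mulr_ge0 (mulr_ge0 aN0 (mx0 _)) w0.
    by rewrite -mulrA ler_peMr// tail_weight_near.
  rewrite mul0r mul1r add0r ger0_norm; last first.
    by rewrite mulr_ge0 ?tail_kernel_ge0// mulr_ge0// ltW.
  rewrite ler_wpDl//; first exact: mulr_ge0 (mulr_ge0 B20 (mx0 _)) w0.
  apply: (@le_trans _ _ (2 * a * N * x `^ (2 * a - 1))).
    rewrite -[leRHS]mulrA ler_wpM2l ?mulr_ge0 ?(ltW a0)//.
    by apply: le_trans (tkN _ tx) _; rewrite powRr0 mul1r.
  by rewrite -[leRHS]mulrA ler_wpM2l// tail_weight_far// ltW.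
Qed.

(** For a > 0 the two powers cancel at infinity to first order, leaving
    x^(2a - 1). *)
Lemma testable_phi r : 2^-1 <= H -> 0 <= r -> testable H (phi a r).
Proof.
move=> Hge r0; have [an1 a1] := andP a_bnd.
have mphi := measurable_phi a r.
split=> //; rewrite -/a.
- move=> Hle; have a0 : a = 0 by rewrite /a; lra.
  apply: (@le_lt_trans _ _ (\int[leb]_x (4 * (\I[0 < x < r + 1] * x `^ (1 - 1)))%:E)%E).
    apply: int_le.
    - by meas.
    - by meas.
    - by move=> x; exact: sqr_ge0.
    move=> x; rewrite /phi a0 mulr0 oppr0 subrr !powRr0 !mulr1.
    have [x0|x0] := ltP 0 x; last by rewrite mul0r expr0n mulr0.
    rewrite /= !mul1r; have [xr|xr|xr] := ltgtP x r.
    + have -> /= : x < r + 1 by lra.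
      by rewrite subr0 mulr1 expr2; lra.
    + by rewrite addr0 subrr expr0n mulr_ge0.
    + have -> /= : x < r + 1 by lra.
      by rewrite addr0 subr0 expr1n mulr1; lra.
  rewrite int_Zl; last 3 first.
  - by [].
  - by meas.
  - by move=> x; rewrite mulr_ge0 ?powR_ge0.
  by rewrite integral_powR0 ?addr_ge0// -EFinM ltry.
- move=> Hgt; have a0 : 0 < a by rewrite /a; lra.
  have [r00|rn0] := eqVneq r 0.
    exists 0 => x x0; rewrite mul0r /phi r00 x0 mul1r (ltNge x) (ltW x0) mul0r.
    by rewrite addr0 subr0 mul1r subrr normr0.
  have r_gt0 : 0 < r by rewrite lt_neqAle eq_sym rn0.
  have mx0 (c : R) : 0 <= Num.max 1 c by rewrite le_max ler01.
  exists (2 * r `^ (2 * a) * Num.max 1 (r `^ (1 - 2 * a)) +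
    r * Num.max 1 (r `^ (2 * a - 1))) => x x0.
  have w0 := tail_weight_ge0 H x.
  have mono (y z : R) : 0 <= y -> y <= z -> y `^ (2 * a) <= z `^ (2 * a).
    move=> y0 yz; have a20 : 0 <= 2 * a by rewrite mulr_ge0// ltW.
    by apply: ge0_ler_powR => //; rewrite nnegrE// (le_trans y0).
  rewrite mulrDl /phi x0 mul1r; have [xr|rx] := leP x r.
    rewrite ler_wpDr//; first exact: mulr_ge0 (mulr_ge0 r0 (mx0 _)) w0.
    apply: (@le_trans _ _ (2 * r `^ (2 * a))).
      have h1 := mono _ _ (ltW x0) xr; have h2 := powR_ge0 x (2 * a).
      have h3 : 0 <= r - x by rewrite subr_ge0.
      have h4 : r - x <= r by rewrite gerBl ltW.
      have h5 := mono _ _ h3 h4; have h6 := powR_ge0 (r - x) (2 * a).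
      rewrite mul0r subr0; case: (x < r); rewrite ?mul1r ?mul0r ger0_norm ?addr_ge0//; lra.
    by rewrite -mulrA ler_peMr ?mulr_ge0 ?powR_ge0// tail_weight_near.
  have -> : x < r = false by apply/negbTE; rewrite -leNgt ltW.
  rewrite mul0r addr0 mul1r ler_wpDl//.
    by apply: mulr_ge0 w0; rewrite !mulr_ge0 ?powR_ge0.
  have xr0 : 0 <= x - r by rewrite subr_ge0 ltW.
  have xrx : x - r <= x by rewrite gerBl.
  rewrite ger0_norm ?subr_ge0 ?mono//.
  apply: (@le_trans _ _ (r * x `^ (2 * a - 1))); last first.
    by rewrite -mulrA ler_wpM2l// tail_weight_far// ltW.
  have -> : x - r = x * (1 - r / x) by field; rewrite gt_eqF.
  have rx1 : r / x <= 1 by rewrite ler_pdivrMr// mul1r ltW.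
  have rx0 : 0 < r / x by rewrite divr_gt0.
  rewrite powRM ?(ltW x0) ?subr_ge0//.
  have h : 1 - r / x <= (1 - r / x) `^ (2 * a).
    have [->|n0] := eqVneq (1 - r / x) 0; first by rewrite powR_ge0.
    rewrite -[leLHS]powRr1 ?subr_ge0// ger_powR//; last by lra.
    by rewrite lt_neqAle eq_sym n0 subr_ge0 rx1/= gerBl ltW.
  have xa0 := powR_ge0 x (2 * a).
  apply: (@le_trans _ _ (x `^ (2 * a) * (r / x))).
    rewrite -{1}[x `^ (2 * a)]mulr1 -mulrBr ler_wpM2l//; lra.
  rewrite powRB ?(gt_eqF x0) ?implybT// powRr1 ?(ltW x0)//.
  by rewrite le_eqVlt; apply/orP; left; apply/eqP; ring.
Qed.

End testable_functions.

(** * The Gagliardo form when H < 1/2 *)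

Section gagliardo.
Variable R : realType.
Local Notation leb := (@lebesgue_measure R).
Local Notation leb2 := (@lebesgue_measure R \x @lebesgue_measure R)%E.
Variable H : R.
Hypotheses (H0 : 0 < H) (Hlt : H < 2^-1).
Let a := H - 2^-1.
Let a_lt0 : a < 0. Proof. by rewrite /a subr_lt0. Qed.
Let a_gt : - 2^-1 < a. Proof. by rewrite /a ltrBrDr addNr. Qed.
Let c0 : 0 < - (2 * a). Proof. by rewrite oppr_gt0 pmulr_rlt0. Qed.
Let e0 : 0 < 2 * a + 1. Proof. by rewrite -ltrBlDr sub0r mulrC -ltr_pdivrMr// mulN1r. Qed.
Let nz : 2 * a != 0. Proof. by rewrite lt_eqF// -oppr_gt0. Qed.
Variable r : R.
Hypothesis r0 : 0 <= r.

(** For x in ]0, r[ and y outside, the mass of |x - y|^(2a-1) over y is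
    phi_r(x) / (-2a), and symmetrically for fixed y > r up to the sign. *)
Definition strip (y : R) : R := \I[y < 0] + \I[r < y].

Definition gker (x y : R) : R := \I[0 < x < r] * (strip y * `|x - y| `^ (2 * a - 1)).

Lemma strip_ge0 y : 0 <= strip y. Proof. by rewrite addr_ge0. Qed.

Lemma gker_ge0 x y : 0 <= gker x y.
Proof. by rewrite mulr_ge0// mulr_ge0 ?powR_ge0 ?strip_ge0. Qed.

Lemma measurable_gker : measurable_fun setT (fun z : R * R => gker z.1 z.2).
Proof. by rewrite /gker /strip; meas. Qed.

Lemma integral_gker_right x : 0 < x < r ->
  (\int[leb]_y (gker x y)%:E = ((x `^ (2 * a) + (r - x) `^ (2 * a)) / - (2 * a))%:E)%E.
Proof.
move=> xr; rewrite /gker; case/andP: (xr) => x0 xltr.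
transitivity (\int[leb]_y (\I[y < 0] * (x - y) `^ (- - (2 * a) - 1) +
    \I[r < y] * (y - x) `^ (- - (2 * a) - 1))%:E)%E.
  apply: eq_integral => y _; rewrite opprK xr mul1r /strip mulrDl.
  congr (_ + _)%:E.
    by have [y0|_] := ltP y 0; rewrite ?mul0r// gtr0_norm// subr_gt0 (lt_trans y0).
  have [ry|_] := ltP r y; rewrite ?mul0r// ltr0_norm ?opprB//.
  by rewrite subr_lt0 (lt_trans xltr).
rewrite int_D; last 4 first.
- by meas.
- by meas.
- by move=> y; rewrite mulr_ge0 ?powR_ge0.
- by move=> y; rewrite mulr_ge0 ?powR_ge0.
rewrite integral_powR_left_tail//.
have -> : (\int[leb]_y (\I[r < y] * (y - x) `^ (- - (2 * a) - 1))%:E =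
    ((r - x) `^ (- - (2 * a)) / - (2 * a))%:E)%E.
  rewrite -integral_powR_tail; [|exact: c0|by rewrite subr_gt0].
  have <- := @ge0_integral_shift R (- x)
    (fun z => (\I[r - x < z] * z `^ (- - (2 * a) - 1))%:E).
  - by apply: eq_integral => y _; rewrite ltrD2r.
  - by meas.
  - by move=> z; rewrite lee_fin mulr_ge0 ?powR_ge0.
by rewrite -EFinD !opprK -mulrDl.
Qed.

Lemma integral_gker_left y : r < y ->
  (\int[leb]_x (gker x y)%:E = (((y - r) `^ (2 * a) - y `^ (2 * a)) / - (2 * a))%:E)%E.
Proof.
move=> ry; have y0 : 0 < y by exact: le_lt_trans ry.
transitivity (\int[leb]_x (\I[0 < x < r] * (y - x) `^ (2 * a - 1))%:E)%E.
  apply: eq_integral => x _; congr EFin; rewrite /gker /strip ry (ltNge y) (ltW y0).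
  have [/andP[x0 xr]|_] := boolP (0 < x < r); last by rewrite !mul0r.
  by rewrite /= add0r !mul1r ltr0_norm ?opprB// subr_lt0 (lt_trans xr).
rewrite integral_powR_left ?ry ?orbT ?(ltW ry)//.
by rewrite subr0 invrN mulrN -mulNr opprB.
Qed.

Lemma integral2_gker : (\int[leb2]_z (gker z.1 z.2)%:E < +oo)%E.
Proof.
rewrite fubini_tonelli1; last 2 first.
- by apply: measR_EFin; exact: measurable_gker.
- by move=> z; rewrite lee_fin gker_ge0.
rewrite /fubini_F /=.
apply: (@le_lt_trans _ _ (\int[leb]_x ((- (2 * a))^-1 *
  (\I[0 < x < r] * x `^ ((2 * a + 1) - 1) + \I[0 < x < r] * (r - x) `^ ((2 * a + 1) - 1)))%:E)%E).
  rewrite le_eqVlt; apply/orP; left; apply/eqP; apply: eq_integral => x _.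
  rewrite addrK; have [xr|nxr] := boolP (0 < x < r).
    by rewrite integral_gker_right// !mul1r mulrC.
  by rewrite !mul0r addr0 mulr0 integral0_eq// => y _; rewrite /gker (negbTE nxr) mul0r.
rewrite int_Zl; last 3 first.
- by rewrite invr_ge0 ltW.
- by meas.
- by move=> x; rewrite addr_ge0// mulr_ge0 ?powR_ge0.
rewrite int_D; last 4 first.
- by meas.
- by meas.
- by move=> x; rewrite mulr_ge0 ?powR_ge0.
- by move=> x; rewrite mulr_ge0 ?powR_ge0.
rewrite integral_powR0// integral_powR_left ?e0 ?gt_eqF//.
by rewrite -!EFinM ltry.
Qed.

Lemma intble2_dom (F : R -> R -> R) (M : R) :
  measurable_fun setT (fun z : R * R => F z.1 z.2) -> 0 <= M ->
  (forall x y, `|F x y| <= M * gker x y) -> intble leb2 (fun z => F z.1 z.2).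
Proof.
move=> mF M0 FM; have mg := measurable_gker.
apply: (@intble_dom _ (measurableTypeR R * measurableTypeR R)%type R leb2 _
  (fun z => M * gker z.1 z.2)) => //.
- by apply: measR_M => //; exact: measurable_cst.
rewrite int_Zl; last 3 first.
- exact: M0.
- exact: mg.
- by move=> z; exact: gker_ge0.
by apply: lte_mul_pinfty => //; rewrite integral2_gker.
Qed.

Lemma int_neq (f : R -> R) (p : R) : measurable_fun setT f ->
  (\int[leb]_x (\I[x != p] * f x)%:E = \int[leb]_x (f x)%:E)%E.
Proof.
move=> mf; rewrite (@integral_ind R _ (measurableTypeR R) leb (setT `\ p)).
  rewrite integral_setD1//; first by rewrite setTD; apply: measurableC.
  by apply: measurable_funTS; exact: measR_EFin.
by move=> x; split=> [[_ /eqP]|/eqP].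
Qed.

Lemma intbleZ1 (k : R) (f : R -> R) : intble leb f ->
  (\int[leb]_x (f x * k)%:E = (rint leb f * k)%:E)%E.
Proof.
move=> If; rewrite mulrC -rintZ// -rintE; last exact: intbleZ.
by apply: eq_integral => x _; rewrite mulrC.
Qed.

(** Expand the difference and apply Fubini's theorem to each half: integrating
    out the other variable gives the values of phi_r inside and outside
    ]0, r[. The point x = r carries no mass and is discarded. *)
Lemma gagliardo_phi (g : R -> R) (M : R) : measurable_fun setT g ->
  (forall x, x <= 0 -> g x = 0) -> (forall x, `|g x| <= M) ->
  intble leb (fun x => g x * phi a r x) ->
  rint leb (fun x => g x * phi a r x) =
    - (2 * a) * rint leb2 (fun z => gker z.1 z.2 * (g z.1 - g z.2)).
Proof.
move=> mg g0 gM Igphi.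
have M0 : 0 <= M by apply: le_trans (gM 0).
have mgk := measurable_gker.
have mgx : measurable_fun setT (fun z : R * R => g z.1) by exact: (measurableT_comp mg).
have mgy : measurable_fun setT (fun z : R * R => g z.2) by exact: (measurableT_comp mg).
have I1 : intble leb2 (fun z => gker z.1 z.2 * g z.1).
  apply: (@intble2_dom (fun x y => gker x y * g x) M) => //; first by meas.
  by move=> x y; rewrite normrM ger0_norm ?gker_ge0// mulrC ler_wpM2r ?gker_ge0.
have I2 : intble leb2 (fun z => gker z.1 z.2 * g z.2).
  apply: (@intble2_dom (fun x y => gker x y * g y) M) => //; first by meas.
  by move=> x y; rewrite normrM ger0_norm ?gker_ge0// mulrC ler_wpM2r ?gker_ge0.
have -> : rint leb2 (fun z => gker z.1 z.2 * (g z.1 - g z.2)) =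
   rint leb2 (fun z => gker z.1 z.2 * g z.1) - rint leb2 (fun z => gker z.1 z.2 * g z.2).
  by rewrite -(rintB I1 I2); apply: eq_rint => z; rewrite mulrBr.
pose f1 (x : R) := g x * (\I[0 < x < r] * ((x `^ (2 * a) + (r - x) `^ (2 * a)) / - (2 * a))).
pose f2 (y : R) := g y * (\I[r < y] * (((y - r) `^ (2 * a) - y `^ (2 * a)) / - (2 * a))).
have E1 x : fubini_F leb (fun z => (gker z.1 z.2 * g z.1)%:E) x = (f1 x)%:E.
  rewrite /fubini_F /f1/=; have [xr|nxr] := boolP (0 < x < r); last first.
    by rewrite mul0r mulr0 integral0_eq// => y _; rewrite /gker (negbTE nxr) !mul0r.
  have Ig : intble leb (gker x).
    apply: intble_ge0; first exact: (measurable_slice (F := gker)).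
      by move=> y; exact: gker_ge0.
    by rewrite integral_gker_right// ltry.
  rewrite intbleZ1//; congr EFin.
  by rewrite /rint integral_gker_right//= mul1r mulrC.
have E2 y : fubini_G leb (fun z => (gker z.1 z.2 * g z.2)%:E) y = (f2 y)%:E.
  rewrite /fubini_G /f2/=; have [y0|y0] := leP y 0.
    by rewrite g0// mul0r integral0_eq// => x _; rewrite mulr0.
  have [ry|yr] := ltP r y; last first.
    rewrite mul0r mulr0 integral0_eq// => x _.
    by rewrite /gker /strip (ltNge y) (ltW y0) (ltNge r) yr addr0 mul0r mulr0 mul0r.
  have Ig : intble leb (gker^~ y).
    apply: intble_ge0; first by rewrite /gker /strip; meas.
      by move=> x; exact: gker_ge0.
    by rewrite integral_gker_left// ltry.
  rewrite intbleZ1//; congr EFin.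
  by rewrite /rint integral_gker_left//= mul1r mulrC.
have If1 : intble leb f1.
  by rewrite /intble -(funext E1); exact: integrable_fubini_F.
have If2 : intble leb f2.
  have mf2 : measurable_fun setT f2 by rewrite /f2; meas.
  have mGk : measurable_fun setT (fun y => \int[leb]_x (gker x y)%:E)%E.
    apply: (measurable_inner (F := fun y x => gker x y)).
      by rewrite /gker /strip; meas.
    by move=> y x; exact: gker_ge0.
  have Gk0 y : (0 <= \int[leb]_x (gker x y)%:E)%E.
    by apply: int_ge0 => x; exact: gker_ge0.
  apply/integrableP; split; first exact: measR_EFin.
  apply: (@le_lt_trans _ _ (\int[leb]_y (M%:E * \int[leb]_x (gker x y)%:E))%E).
    apply: ge0_le_integral => //.
    - by apply: measurableT_comp => //; exact: measR_EFin.
    - exact: measurable_funeM.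
    move=> y _; rewrite abse_EFin /f2; have [y0|y0] := leP y 0.
      by rewrite g0// mul0r normr0 mule_ge0.
    have [ry|yr] := ltP r y; last by rewrite mul0r mulr0 normr0 mule_ge0.
    rewrite integral_gker_left// -EFinM lee_fin mul1r normrM ler_pM//.
    rewrite ger0_norm// -lee_fin -integral_gker_left//.
  rewrite ge0_integralZl//.
  apply: lte_mul_pinfty => //.
  have := integral2_gker; rewrite fubini_tonelli2//.
    by apply: measR_EFin; exact: measurable_gker.
  by move=> z; rewrite lee_fin gker_ge0.
have R1 : rint leb2 (fun z => gker z.1 z.2 * g z.1) = rint leb f1.
  congr fine; rewrite -(integral12_prod_meas1 I1).
  by apply: eq_integral => x _; exact: E1.
have R2 : rint leb2 (fun z => gker z.1 z.2 * g z.2) = rint leb f2.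
  congr fine; rewrite -(integral21_prod_meas1 I2).
  by apply: eq_integral => y _; exact: E2.
rewrite R1 R2 -(rintB If1 If2) -rintZ; last exact: intbleB.
have mphi := measurable_phi a r.
rewrite /rint -(int_neq r); last by meas.
rewrite -[in RHS](int_neq r); last first.
  by apply: measR_M; [meas|rewrite /f1 /f2; meas].
congr fine; apply: eq_integral => x _.
have [|xr] := eqVneq x r; first by rewrite !mul0r.
rewrite /= !mul1r; congr EFin.
have [x0|x0] := leP x 0; first by rewrite /f1 /f2 g0// !mul0r subrr mulr0.
rewrite /f1 /f2 /phi x0 mul1r.
have [xltr|rltx|/eqP] := ltgtP x r; last by rewrite (negbTE xr).
- rewrite /= !(mul0r, mul1r, mulr0, addr0, subr0, sub0r).
  have F (u v c : R) : c != 0 -> u * v = c * (u * (v / c)) by move=> cn; field.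
  by apply: F; rewrite oppr_eq0.
- rewrite /= !(mul0r, mul1r, mulr0, addr0, subr0, sub0r).
  have F (u p q c : R) : c != 0 -> u * (p - q) = c * - (u * ((q - p) / c)).
    by move=> cn; field.
  by apply: F; rewrite oppr_eq0.
Qed.

(** Cauchy-Schwarz on the product measure, the kernel |x - y|^(2a-1) being
    split into two square roots: one half belongs to the norm of g, the other
    is square-integrable over the region by [integral2_gker]. *)
Lemma gagliardo_cvg (g : nat -> R -> R) :
  (forall n, measurable_fun setT (g n)) -> (forall n x, x <= 0 -> g n x = 0) ->
  (forall n, exists M : R, forall x, `|g n x| <= M) ->
  (forall n, intble leb (fun x => g n x * phi a r x)) ->
  integrand_norm2 H (g n) @[n --> \oo] --> 0%E ->
  rint leb (fun x => g n x * phi a r x) @[n --> \oo] --> 0.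
Proof.
move=> mg g0 gM Ig Ng.
pose F n (z : R * R) := (g n z.1 - g n z.2) * `|z.1 - z.2| `^ (a - 2^-1).
pose G (z : R * R) := \I[0 < z.1 < r] * (strip z.2 * `|z.1 - z.2| `^ (a - 2^-1)).
have sq (u : R) : (u `^ (a - 2^-1)) ^+ 2 = u `^ (2 * a - 1).
  by rewrite -powR_mulrn ?powR_ge0// -powRrM; congr (_ `^ _); field.
have mF n : measurable_fun setT (F n).
  have mgx : measurable_fun setT (fun z : R * R => g n z.1) by exact: (measurableT_comp (mg n)).
  have mgy : measurable_fun setT (fun z : R * R => g n z.2) by exact: (measurableT_comp (mg n)).
  by rewrite /F; meas.
have mG : measurable_fun setT G by rewrite /G /strip; meas.
have FG n z : gker z.1 z.2 * (g n z.1 - g n z.2) = F n z * G z.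
  rewrite /F /G /gker -sq; ring.
have GG : (\int[leb2]_z (G z ^+ 2)%:E < +oo)%E.
  apply: le_lt_trans integral2_gker; apply: int_le => //.
  - by meas.
  - exact: measurable_gker.
  - by move=> z; exact: sqr_ge0.
  move=> z; rewrite /G /gker !exprMn sq /strip le_eqVlt; apply/orP; left; apply/eqP.
  have h (b : bool) : (b%:R : R) ^+ 2 = b%:R by case: b; rewrite ?expr1n ?expr0n.
  rewrite h; congr (_ * (_ * _)).
  have [z0|_] := ltP z.2 0; last by rewrite add0r h.
  by rewrite (ltNge r) (le_trans (ltW z0) r0) addr0 h.
have FF : (\int[leb2]_z (F n z ^+ 2)%:E)%E @[n --> \oo] --> 0%E.
  pose c := H * (1 - 2 * H) / 2.
  have cc0 : 0 < c by rewrite divr_gt0// mulr_gt0//; move: Hlt; lra.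
  have FE n : (\int[leb2]_z (F n z ^+ 2)%:E = c^-1%:E * integrand_norm2 H (g n))%E.
    rewrite /integrand_norm2 Hlt -/c muleA -EFinM mulVf ?gt_eqF// mul1e.
    rewrite fubini_tonelli1; last 2 first.
    - by apply: measR_EFin; have := mF n => ?; meas.
    - by move=> z; rewrite lee_fin sqr_ge0.
    apply: eq_integral => x _; apply: eq_integral => y _; congr EFin.
    by rewrite /F /= exprMn sq; congr (_ * _ `^ _); rewrite /a; field.
  apply: (cvge0_le (C := c^-1) _ _ _ _ Ng).
  - by rewrite invr_ge0 ltW.
  - by move=> n; apply: int_ge0 => z; exact: sqr_ge0.
  - move=> n; rewrite /integrand_norm2 Hlt -/c mule_ge0// ?lee_fin ?(ltW cc0)//.
    apply: integral_ge0 => x _; apply: int_ge0 => y.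
    by rewrite mulr_ge0 ?sqr_ge0 ?powR_ge0.
  - by move=> n; rewrite FE.
have FGc := @int_mul_cvg0 _ (measurableTypeR R * measurableTypeR R)%type R leb2
  F G mF mG GG FF.
have bound n : (`|rint leb (fun x => g n x * phi a r x)|%:E <=
    (- (2 * a))%:E * \int[leb2]_z (`|F n z * G z|)%:E)%E.
  have [M HM] := gM n.
  rewrite (gagliardo_phi (mg n) (g0 n) HM (Ig n)) normrM (gtr0_norm c0) EFinM.
  rewrite lee_pmul ?lee_fin ?(ltW c0)//.
  have -> : rint leb2 (fun z => gker z.1 z.2 * (g n z.1 - g n z.2)) =
      rint leb2 (fun z => F n z * G z) by apply: eq_rint => z; exact: FG.
  apply: le_norm_rintE.
  have M0 : 0 <= M by apply: le_trans (HM 0).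
  have mgk := measurable_gker.
  have mgx : measurable_fun setT (fun z : R * R => g n z.1) by exact: (measurableT_comp (mg n)).
  have mgy : measurable_fun setT (fun z : R * R => g n z.2) by exact: (measurableT_comp (mg n)).
  have -> : (fun z => F n z * G z) = (fun z => gker z.1 z.2 * (g n z.1 - g n z.2)).
    by apply/funext => z; rewrite FG.
  apply: (@intble2_dom (fun x y => gker x y * (g n x - g n y)) (M + M)).
  - by meas.
  - exact: addr_ge0.
  move=> x y; rewrite normrM ger0_norm ?gker_ge0// mulrC ler_wpM2r ?gker_ge0//.
  by apply: le_trans (ler_normB _ _) _; exact: lerD.
apply/cvgr0Pnorm_lt => e epos.
have B0 n : (0 <= (- (2 * a))%:E * \int[leb2]_z (`|F n z * G z|)%:E)%E.
  by rewrite mule_ge0 ?lee_fin ?(ltW c0)// int_ge0.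
have B : (fun n => (- (2 * a))%:E * \int[leb2]_z (`|F n z * G z|)%:E)%E @ \oo --> 0%E.
  apply: (cvge0_le (ltW c0) B0 _ _ FGc) => // n.
  by apply: int_ge0.
have := (cvge0P B0).1 B (e / 2) (divr_gt0 epos (ltr0n _ 2)).
apply: filterS => n Bn; rewrite -lte_fin.
apply: le_lt_trans (bound n) _; apply: le_lt_trans Bn _.
by rewrite lte_fin ltr_pdivrMr// ltr_pMr// ltr1n.
Qed.

End gagliardo.

(** * Step approximations of l_H and its constants *)

Section step_approximation.
Variable R : realType.
Local Notation leb := (@lebesgue_measure R).
Variable H : R.
Hypothesis H01 : 0 < H < 1.
Let a := H - 2^-1.
Let a_bnd : - 2^-1 < a < 2^-1.
Proof. by rewrite /a; move: H01 => /andP[? ?]; apply/andP; split; lra. Qed.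

Lemma l_HE T x : l_H H T x = C_H H * ell a T x.
Proof.
rewrite /l_H /ell; case: ifP => _; last by rewrite mul0r mulr0.
have -> : 1 / 2 - H = - a by rewrite /a; field.
by rewrite mul1r mulrA.
Qed.

Lemma measurable_l_H T : measurable_fun setT (l_H H T).
Proof.
have m := measurable_ell a T.
by rewrite (funext (l_HE T)); meas.
Qed.

Lemma l_H_le0 T x : x <= 0 -> l_H H T x = 0.
Proof. by move=> x0; rewrite /l_H ltNge x0. Qed.

Lemma step_fun_le0 (s : seq (R * R * R)) x : step_wf s -> x <= 0 -> step_fun s x = 0.
Proof.
move=> ws x0; rewrite /step_fun big_seq big1// => -[[c u] v] /=.
move/allP : ws => /[apply] /= /andP[u0 _].
by rewrite indicE_oc ltNge (le_trans x0 u0) mulr0.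
Qed.

Lemma l_H_bounded T : 0 < T -> H < 2^-1 -> exists M : R, forall x, `|l_H H T x| <= M.
Proof.
move=> T0 Hlt; have a0 : a <= 0 by rewrite /a; lra.
exists (`|C_H H| * (T `^ (- a)) ^+ 2) => x.
rewrite l_HE normrM ler_wpM2l// ger0_norm ?ell_ge0//.
apply: le_trans (ell_le_neg T0 _ a0) _.
by rewrite -[leRHS]mulr1 ler_wpM2l ?sqr_ge0//; case: (0 < x < T).
Qed.

Section approximation.
Variables (T : R) (s : nat -> seq (R * R * R)).
Hypotheses (T0 : 0 < T) (ws : forall n, step_wf (s n)).
Hypothesis cvg_s :
  integrand_norm2 H (fun x => step_fun (s n) x - l_H H T x) @[n --> \oo] --> 0%E.

Let g n x := step_fun (s n) x - l_H H T x.

Let mg n : measurable_fun setT (g n).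
Proof.
have m1 := @measurable_step_fun R (s n); have m2 := measurable_l_H T.
by rewrite /g; meas.
Qed.

Let g0 n x : x <= 0 -> g n x = 0.
Proof. by move=> x0; rewrite /g step_fun_le0// l_H_le0// subrr. Qed.

Let rint_cvg psi G : primitive_of psi G -> intble leb (fun x => l_H H T x * psi x) ->
  rint leb (fun x => g n x * psi x) @[n --> \oo] --> 0 ->
  rint leb (fun x => step_fun (s n) x * psi x) @[n --> \oo] -->
  rint leb (fun x => l_H H T x * psi x).
Proof.
move=> pG Il Ig.
rewrite (_ : (fun n => _) = fun n => rint leb (fun x => g n x * psi x) +
    rint leb (fun x => l_H H T x * psi x)); last first.
  apply/funext => n /=; have [Is _] := step_rint pG (ws n).
  apply/eqP; rewrite -subr_eq -(rintB Is Il); apply/eqP.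
  by congr fine; apply: eq_integral => x _; rewrite /g mulrBl.
rewrite -[X in _ --> X]add0r; apply: cvgD; first exact: Ig.
exact: cvg_cst.
Qed.

Let Ig psi G n : primitive_of psi G -> intble leb (fun x => l_H H T x * psi x) ->
  intble leb (fun x => g n x * psi x).
Proof.
move=> pG Il; have [Is _] := step_rint pG (ws n).
rewrite /g; under eq_fun do rewrite mulrBl.
exact: intbleB.
Qed.

Lemma step_testable_cvg psi G : testable H psi -> primitive_of psi G ->
  intble leb (fun x => l_H H T x * psi x) ->
  rint leb (fun x => step_fun (s n) x * psi x) @[n --> \oo] -->
  rint leb (fun x => l_H H T x * psi x).
Proof.
move=> tpsi pG Il; apply: (rint_cvg pG Il).
have C := testable_cvg0 H01 tpsi mg g0 cvg_s.
apply/cvgr0Pnorm_lt => e e0.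
have P0 n : (0 <= \int[leb]_x (`|g n x * psi x|)%:E)%E by apply: int_ge0.
have := (cvge0P P0).1 C (e / 2) (divr_gt0 e0 (ltr0n _ 2)).
apply: filterS => n Bn; rewrite -lte_fin.
apply: le_lt_trans (le_norm_rintE (Ig _ pG Il)) _; apply: le_lt_trans Bn _.
by rewrite lte_fin ltr_pdivrMr// ltr_pMr// ltr1n.
Qed.

Lemma intble_l_H_phi r : 0 <= r -> intble leb (fun x => l_H H T x * phi a r x).
Proof.
move=> r0; have -> : (fun x => l_H H T x * phi a r x) =
    (fun x => C_H H * (ell a T x * phi a r x)).
  by apply/funext => x; rewrite l_HE mulrA.
by apply: intbleZ; exact: intble_ell_phi.
Qed.

Lemma step_phi_cvg r : 0 <= r ->
  rint leb (fun x => step_fun (s n) x * phi a r x) @[n --> \oo] --> C_H H * covM a T r.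
Proof.
move=> r0; have Il := intble_l_H_phi r0; have pG := phi_primitive a_bnd r0.
have -> : C_H H * covM a T r = rint leb (fun x => l_H H T x * phi a r x).
  rewrite /covM -rintZ; last exact: intble_ell_phi.
  by congr fine; apply: eq_integral => x _; rewrite l_HE mulrA.
have [Hge|Hlt] := leP 2^-1 H.
  by apply: (step_testable_cvg _ pG Il); exact: testable_phi.
apply: (rint_cvg pG Il).
apply: gagliardo_cvg => //; first by move: H01 => /andP[].
  move=> n; have [B [M [B0 M0 sM]]] := step_fun_bounded (ws n).
  have [M' lM] := l_H_bounded T0 Hlt.
  exists (M + M') => x; apply: le_trans (ler_normB _ _) _; apply: lerD => //.
  apply: le_trans (sM x) _; rewrite -[leRHS]mulr1 ler_wpM2l//.
  by case: (0 < x < B).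
by move=> n; exact: Ig pG Il.
Qed.

(** Only the constant part of the density meets the support of l_H(T, .). *)
Lemma step_covM_density_cvg t : T <= t ->
  rint leb (fun x => step_fun (s n) x * covM_density a t x) @[n --> \oo] -->
  C_H H * (2 * Beta (1 + a) (1 - a) * (T `^ (1 - 2 * a) * Beta (1 - a) (1 - a))).
Proof.
move=> Tt; have t0 : 0 < t by exact: lt_le_trans Tt.
have E x : l_H H T x * covM_density a t x =
    C_H H * (2 * Beta (1 + a) (1 - a) * ell a T x).
  rewrite l_HE /covM_density; have [/andP[x0 xT]|nxT] := boolP (0 < x < T); last first.
    by rewrite /ell (negbTE nxT) !mul0r !mulr0 mul0r.
  have xt : x < t by exact: lt_le_trans Tt.
  by rewrite x0 (ltW xt) (ltNge t) (ltW xt)/= mul0r addr0 mul1r; ring.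
have Iell := intble_ell a_bnd T0.
have Il : intble leb (fun x => l_H H T x * covM_density a t x).
  by rewrite (funext E); apply: intbleZ; exact: intbleZ.
have -> : C_H H * (2 * Beta (1 + a) (1 - a) * (T `^ (1 - 2 * a) * Beta (1 - a) (1 - a))) =
   rint leb (fun x => l_H H T x * covM_density a t x).
  rewrite (funext E) rintZ; last exact: intbleZ.
  by rewrite rintZ// /rint integral_ell.
apply: (step_testable_cvg _ (covM_density_primitive a_bnd t0) Il).
exact: testable_covM_density.
Qed.

End approximation.

Lemma C_H_gt0 : 0 < C_H H.
Proof.
move: H01 => /andP[H0 H1].
by rewrite sqrtr_gt0 divr_gt0 ?Gamma_gt0 ?mulr_gt0 ?exprn_gt0 ?Gamma_gt0//; lra.
Qed.

Lemma b1_gt0 : 0 < b1 H.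
Proof. by move: H01 => /andP[H0 H1]; rewrite mulr_gt0 ?C_H_gt0 ?Beta_gt0//; lra. Qed.

(** Both Beta values become Gamma values, with Gamma(2) = 1. *)
Lemma C_H_normalization :
  2 * H * C_H H ^+ 2 * Beta (1 + a) (1 - a) * Beta (1 - a) (1 - a) = 1.
Proof.
move: H01 => /andP[H0 H1].
have p0 : 0 < 3 / 2 - H by lra.
have q0 : 0 < 1 / 2 + H by lra.
have s0 : 0 < 3 - 2 * H by lra.
have aE : 1 - a = 3 / 2 - H by rewrite /a; field.
have aE' : 1 + a = 1 / 2 + H by rewrite /a; field.
have spq : 1 / 2 + H + (3 / 2 - H) = 2 by field.
have spp : 3 / 2 - H + (3 / 2 - H) = 3 - 2 * H by field.
have G1 := Gamma_gt0 p0; have G2 := Gamma_gt0 q0; have G3 := Gamma_gt0 s0.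
have B1 := GammaM q0 p0; rewrite spq Gamma2 mulr1 in B1.
have B2 := GammaM p0 p0; rewrite spp in B2.
rewrite aE aE' -B1 /C_H.
move: (Gamma (3 / 2 - H)) (Gamma (1 / 2 + H)) (Gamma (3 - 2 * H)) G1 G2 G3 B2.
move: (Beta (3 / 2 - H) (3 / 2 - H)) => b x y z x0 y0 z0 xxb.
have bE : b = x ^+ 2 / z by rewrite expr2 xxb mulfK ?gt_eqF.
rewrite bE sqr_sqrtr; last first.
  by rewrite divr_ge0 ?mulr_ge0 ?exprn_ge0 ?ltW.
by field; rewrite !gt_eqF.
Qed.

End step_approximation.

(** * Square-integrable variables and Wiener integrals *)

Section square_integrable.
Context d (Omega : measurableType d) (R : realType) (P : {measure set Omega -> \bar R}).
Implicit Types X Y : Omega -> R.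

(** Membership in L^2. *)
Definition sqint X := measurable_fun setT X /\ (\int[P]_w (X w ^+ 2)%:E < +oo)%E.

Lemma sqintD X Y : sqint X -> sqint Y -> sqint (fun w => X w + Y w).
Proof.
move=> [mX X2] [mY Y2]; split; first by meas.
apply: (@le_lt_trans _ _ (\int[P]_w (2 * X w ^+ 2 + 2 * Y w ^+ 2)%:E)%E).
  apply: int_le; [by meas|by meas|by move=> w; exact: sqr_ge0|].
  move=> w; have := sqr_ge0 (X w - Y w).
  by rewrite sqrrB sqrrD; lra.
rewrite int_D; last 4 first.
- by meas.
- by meas.
- by move=> w; rewrite mulr_ge0 ?sqr_ge0.
- by move=> w; rewrite mulr_ge0 ?sqr_ge0.
rewrite !int_Zl//; last 4 first.
- by meas.
- by move=> w; exact: sqr_ge0.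
- by meas.
- by move=> w; exact: sqr_ge0.
by rewrite lte_add_pinfty// lte_mul_pinfty// fin_numE.
Qed.

Lemma sqintZ (c : R) X : sqint X -> sqint (fun w => c * X w).
Proof.
move=> [mX X2]; split; first by meas.
under eq_integral do rewrite exprMn.
rewrite int_Zl; [|exact: sqr_ge0|by meas|by move=> w; exact: sqr_ge0].
by rewrite lte_mul_pinfty// lee_fin sqr_ge0.
Qed.

Lemma sqintB X Y : sqint X -> sqint Y -> sqint (fun w => X w - Y w).
Proof.
move=> SX SY; have := sqintD SX (sqintZ (- 1) SY).
by under eq_fun do rewrite mulN1r.
Qed.

Lemma sqint_intble X Y : sqint X -> sqint Y -> intble P (fun w => X w * Y w).
Proof. by move=> [mX X2] [mY Y2]; exact: intble_mul. Qed.

Lemma sqint_cvg (I : nat -> Omega -> R) X : (forall n, sqint (I n)) ->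
  measurable_fun setT X ->
  (\int[P]_w ((I n w - X w) ^+ 2)%:E)%E @[n --> \oo] --> 0%E -> sqint X.
Proof.
move=> SI mX /cvge0P H.
have /(_ 1 ltr01) := H (fun n => int_ge0 P (fun w => sqr_ge0 (I n w - X w))).
move=> [n _ /(_ n (leqnn n)) /= Hn].
have S : sqint (fun w => I n w - X w).
  split; last exact: le_lt_trans Hn (ltry _).
  by have [m _] := SI n; meas.
have := sqintB (SI n) S.
by under eq_fun do rewrite opprB addrC subrK.
Qed.

(** Continuity of the L^2 pairing in one argument. *)
Lemma sqint_rint_cvg (I : nat -> Omega -> R) X Y : (forall n, sqint (I n)) ->
  sqint X -> sqint Y ->
  (\int[P]_w ((I n w - X w) ^+ 2)%:E)%E @[n --> \oo] --> 0%E ->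
  rint P (fun w => I n w * Y w) @[n --> \oo] --> rint P (fun w => X w * Y w).
Proof.
move=> SI SX SY C.
have SD n : sqint (fun w => I n w - X w) by exact: sqintB.
have [mY Y2] := SY.
have C' := int_mul_cvg0 (fun n => (SD n).1) mY Y2 C.
rewrite (_ : (fun n => _) = fun n => rint P (fun w => (I n w - X w) * Y w) +
    rint P (fun w => X w * Y w)); last first.
  apply/funext => n; apply/eqP; rewrite -subr_eq -rintB; try exact: sqint_intble.
  by apply/eqP/eq_rint => w; rewrite mulrBl.
rewrite -[X in _ --> X]add0r; apply: cvgD; last exact: cvg_cst.
apply/cvgr0Pnorm_lt => e e0.
have P0 n : (0 <= \int[P]_w (`|(I n w - X w) * Y w|)%:E)%E by apply: int_ge0.
have := (cvge0P P0).1 C' (e / 2) (divr_gt0 e0 (ltr0n _ 2)).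
apply: filterS => n Bn; rewrite -lte_fin.
apply: le_lt_trans (le_norm_rintE (sqint_intble (SD n) SY)) _.
by apply: le_lt_trans Bn _; rewrite lte_fin ltr_pdivrMr// ltr_pMr// ltr1n.
Qed.

End square_integrable.

Section wiener_integrals.
Context d (Omega : measurableType d) (R : realType) (P : probability Omega R).
Variables (H : R) (W : R -> {RV P >-> R}).
Hypotheses (H01 : 0 < H < 1) (HW : fractional_brownian_motion H W).
Let a := H - 2^-1.
Let a_bnd : - 2^-1 < a < 2^-1.
Proof. by rewrite /a; move: H01 => /andP[? ?]; apply/andP; split; lra. Qed.

Lemma measurable_RV (X : {RV P >-> R}) : measurable_fun setT X.
Proof. exact: measurable_funP. Qed.

Lemma expectationE (X : Omega -> R) : 'E_P[X]%E = (\int[P]_w (X w)%:E)%E.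
Proof. by rewrite unlock. Qed.

Definition fbm_cov (u r : R) : R := 2^-1 * (u `^ (2 * H) + r `^ (2 * H) - `|u - r| `^ (2 * H)).

Lemma fbm_sqint t : 0 <= t -> sqint P (W t).
Proof.
move=> t0; split; first exact: measurable_RV.
have := HW.2 t t t0 t0; rewrite expectationE => E.
by under eq_integral do rewrite expr2; rewrite E ltry.
Qed.

Lemma fbm_rint u r : 0 <= u -> 0 <= r -> rint P (fun w => W u w * W r w) = fbm_cov u r.
Proof.
by move=> u0 r0; have := HW.2 u r u0 r0; rewrite expectationE /rint => ->.
Qed.

Lemma step_integral_cons c u v s w : step_integral W ((c, u, v) :: s) w =
  c * (W v w - W u w) + step_integral W s w.
Proof. by rewrite /step_integral big_cons. Qed.

Lemma step_integral_sqint s : step_wf s -> sqint P (step_integral W s).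
Proof.
elim: s => [_|[[c u] v] s IH].
  rewrite (_ : step_integral W [::] = fun=> 0).
    split; first exact: measurable_cst.
    by under eq_integral do rewrite expr0n; rewrite integral0 ltry.
  by apply/funext => w; rewrite /step_integral big_nil.
move=> /= /andP[/andP[u0 uv] /IH S].
rewrite (funext (step_integral_cons c u v s)); apply: sqintD => //.
by apply: sqintZ; apply: sqintB; apply: fbm_sqint => //; exact: le_trans uv.
Qed.

Lemma step_integral_rint (X : Omega -> R) (G : R -> R) s : sqint P X ->
  (forall u, 0 <= u -> rint P (fun w => W u w * X w) = G u) -> step_wf s ->
  rint P (fun w => step_integral W s w * X w) = \sum_(p <- s) p.1.1 * (G p.2 - G p.1.2).
Proof.
move=> SX GE; elim: s => [_|[[c u] v] s IH].
  rewrite big_nil -[RHS](rint0 P); apply: eq_rint => w.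
  by rewrite /step_integral big_nil mul0r.
move=> /= /andP[/andP[u0 uv] ws]; rewrite big_cons -IH//=.
have v0 : 0 <= v by exact: le_trans uv.
have SWu := fbm_sqint u0; have SWv := fbm_sqint v0.
have Iu := sqint_intble SWu SX; have Iv := sqint_intble SWv SX.
rewrite -(GE u u0) -(GE v v0) -(rintB Iv Iu) -rintZ; last exact: intbleB.
rewrite -rintD.
- by apply: eq_rint => w; rewrite step_integral_cons; ring.
- by apply: intbleZ; exact: intbleB.
- by apply: sqint_intble => //; exact: step_integral_sqint.
Qed.

Lemma wiener_sqint f X : is_wiener_integral H W f X -> sqint P X.
Proof.
move=> [s [ws _]]; under eq_fun do rewrite expectationE.
apply: sqint_cvg; first by move=> n; exact: step_integral_sqint.
exact: measurable_RV.
Qed.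

(** The covariance of a Wiener integral with Y is determined by the function
    G(u) = E(W_u Y) through its Stieltjes sums along step approximations. *)
Lemma wiener_rint f X (Y : Omega -> R) (G : R -> R) l : is_wiener_integral H W f X ->
  sqint P Y -> (forall u, 0 <= u -> rint P (fun w => W u w * Y w) = G u) ->
  (forall s : nat -> seq (R * R * R), (forall n, step_wf (s n)) ->
     integrand_norm2 H (fun x => step_fun (s n) x - f x) @[n --> \oo] --> 0%E ->
     \sum_(p <- s n) p.1.1 * (G p.2 - G p.1.2) @[n --> \oo] --> l) ->
  rint P (fun w => X w * Y w) = l.
Proof.
move=> WX SY GE Gl; have SX := wiener_sqint WX.
have [s [ws cs]] := WX; under eq_fun do rewrite expectationE.
move=> C; have := sqint_rint_cvg (fun n => step_integral_sqint (ws n)) SX SY C.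
have -> : (fun n => rint P (fun w => step_integral W (s n) w * Y w)) =
    (fun n => \sum_(p <- s n) p.1.1 * (G p.2 - G p.1.2)).
  by apply/funext => n; apply: step_integral_rint.
move=> C1; have C2 := Gl s ws cs.
exact: (cvg_unique _ C1 C2).
Qed.

Lemma fbm_cov_prim u r : H * cov_prim a r u = fbm_cov u r.
Proof.
have HE : 2 * a + 1 = 2 * H by rewrite /a; field.
rewrite /cov_prim /fbm_cov HE; field.
by rewrite gt_eqF//; move: H01 => /andP[].
Qed.

(** First test: against W_r the Stieltjes sums are integrals of phi_r. *)
Lemma wiener_fbm_rint T X r : 0 < T -> is_wiener_integral H W (l_H H T) X -> 0 <= r ->
  rint P (fun w => W r w * X w) = H * (C_H H * covM a T r).
Proof.
move=> T0 WX r0; transitivity (rint P (fun w => X w * W r w)).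
  by apply: eq_rint => w; rewrite mulrC.
apply: (wiener_rint (G := fbm_cov^~ r) WX (fbm_sqint r0)).
  by move=> u u0; exact: fbm_rint.
move=> s ws cs.
have := step_phi_cvg H01 T0 ws cs r0; rewrite -/a => C.
have -> : (fun n => \sum_(p <- s n) p.1.1 * (fbm_cov p.2 r - fbm_cov p.1.2 r)) =
    (fun n => H * rint (@lebesgue_measure R) (fun x => step_fun (s n) x * phi a r x)).
  apply/funext => n; have [_ ->] := step_rint (phi_primitive a_bnd r0) (ws n).
  rewrite mulr_sumr; apply: eq_bigr => p _.
  by rewrite -!fbm_cov_prim; ring.
by apply: cvgM => //; exact: cvg_cst.
Qed.

(** Second test: the covariances of Y with the process, just computed, have
    the density [covM_density], which is constant on ]0, s[. *)
Lemma wiener_cov s t X Y : 0 < s -> s <= t ->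
  is_wiener_integral H W (l_H H s) X -> is_wiener_integral H W (l_H H t) Y ->
  rint P (fun w => X w * Y w) = s `^ (2 - 2 * H).
Proof.
move=> s0 st WX WY; have t0 : 0 < t by exact: lt_le_trans st.
apply: (wiener_rint WX (wiener_sqint WY) (fun r => wiener_fbm_rint t0 WY (r := r))).
move=> u wu cu.
have -> : (fun n => \sum_(p <- u n) p.1.1 * (H * (C_H H * covM a t p.2) -
      H * (C_H H * covM a t p.1.2))) =
    (fun n => H * C_H H *
      rint (@lebesgue_measure R) (fun x => step_fun (u n) x * covM_density a t x)).
  apply/funext => n; have [_ ->] := step_rint (covM_density_primitive a_bnd t0) (wu n).
  rewrite mulr_sumr; apply: eq_bigr => p _.
  by move: (covM a t p.2) (covM a t p.1.2) (C_H H) => x y z; ring.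
have := step_covM_density_cvg H01 s0 wu cu st; rewrite -/a => C.
have -> : s `^ (2 - 2 * H) = H * C_H H * (C_H H *
    (2 * Beta (1 + a) (1 - a) * (s `^ (1 - 2 * a) * Beta (1 - a) (1 - a)))).
  have -> : 2 - 2 * H = 1 - 2 * a by rewrite /a; field.
  rewrite -[LHS]mul1r -{1}(C_H_normalization H01) -/a.
  by move: (Beta _ _) (Beta _ _) (C_H _) (_ `^ _) => b b' c q; ring.
by apply: cvgM => //; exact: cvg_cst.
Qed.

End wiener_integrals.

(** * Moments of the centred normal law *)

Section gaussian_moments.
Variable R : realType.
Local Notation leb := (@lebesgue_measure R).
Variable v : R.
Hypothesis v0 : 0 < v.

(** The normal density of variance v without its constant. *)
Definition gauss_exp (x : R) : R := expR (- (x ^+ 2 / (2 * v))).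

Let gauss_exp_ge0 x : 0 <= gauss_exp x. Proof. exact: expR_ge0. Qed.

Let mge : measurable_fun setT gauss_exp. Proof. by rewrite /gauss_exp; meas. Qed.

Let v2 : 2 * v != 0. Proof. by rewrite mulf_neq0 ?gt_eqF. Qed.

Let der (y : R) : is_derive y 1 (fun y => - gauss_exp y) (y / v * gauss_exp y).
Proof.
rewrite /gauss_exp; apply: is_derive_eq.
by rewrite /GRing.scale/=; field; rewrite gt_eqF.
Qed.

Lemma gauss_exp_tail x : 0 < x ->
  (\int[leb]_y (\I[x < y] * (y / v * gauss_exp y))%:E = (gauss_exp x)%:E)%E.
Proof.
move=> x0.
have mf : measurable_fun setT (fun y : R => y / v * gauss_exp y) by meas.
rewrite (@integral_ind R _ (measurableTypeR R) leb `]x, +oo[%classic); last first.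
  by move=> y /=; rewrite in_itv/= andbT.
rewrite integral_itv_obnd_cbnd; last by apply: measurable_funTS; exact: measR_EFin.
have dcont (f : R -> R) y : derivable f y 1 -> {for y, continuous f}.
  by move=> df; apply: differentiable_continuous; exact/derivable1_diffP.
have Fc y : {for y, continuous (fun y => - gauss_exp y)}.
  by apply: dcont; have [] := der y.
have gc y : {for y, continuous gauss_exp}.
  have -> : gauss_exp = (fun z => - (- gauss_exp z)) by apply/funext => z; rewrite opprK.
  by apply: continuousN; exact: Fc.
rewrite (@ge0_continuous_FTC2y _ _ (fun y => - gauss_exp y) x 0).
- by rewrite -EFinB sub0r opprK.
- by move=> y xy; rewrite mulr_ge0 ?divr_ge0 ?(ltW v0)// (le_trans (ltW x0)).
- apply: continuous_subspaceT => y; apply: cvgM; last exact: gc.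
  by apply: cvgM; [exact: cvg_id|exact: cvg_cst].
- rewrite -oppr0; apply: cvgN; rewrite /gauss_exp.
  suff hq : (y ^+ 2 / (2 * v) : R) @[y --> +oo] --> +oo.
    exact: (@cvg_comp _ _ _ (fun y : R => y ^+ 2 / (2 * v)) (fun y => expR (- y))
      _ _ _ hq (@cvgr_expR R)).
  apply/cvgryPge => A; near=> y.
  rewrite ler_pdivlMr ?mulr_gt0//.
  have y1 : 1 <= y by near: y; exact: nbhs_pinfty_ge.
  have yA : A * (2 * v) <= y by near: y; apply: nbhs_pinfty_ge; rewrite num_real.
  by rewrite (le_trans yA)// expr2 ler_peMl// (le_trans ler01).
- by move=> y _; have [] := der y.
- by apply: cvg_at_right_filter; exact: Fc.
- by move=> y _; rewrite derive1E; have [_ ->] := der y.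
Unshelve. all: by end_near. Qed.

Definition half_moment n := (\int[leb]_x (\I[0 < x] * (x ^+ n * gauss_exp x))%:E)%E.

(** Integration by parts done by Tonelli: write y^(n+1) as the integral of
    (n+1) x^n over ]0, y[ and integrate y exp(-y^2/2v) over ]x, +oo[. *)
Lemma half_momentSS n : (half_moment n.+2 = (n.+1%:R * v)%:E * half_moment n)%E.
Proof.
have mf k : measurable_fun setT (fun x : R => \I[0 < x] * (x ^+ k * gauss_exp x)) by meas.
have f0 k x : 0 <= \I[0 < x] * (x ^+ k * gauss_exp x).
  have [x0|_] := ltP 0 x; last by rewrite mul0r.
  by rewrite mul1r mulr_ge0// exprn_ge0// ltW.
rewrite /half_moment -int_Zl; last 3 first.
- by rewrite mulr_ge0// ltW.
- exact: mf.
- exact: f0.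
pose F (x y : R) := n.+1%:R * \I[0 < x < y] * x ^+ n * (y * gauss_exp y).
have F0 x y : 0 <= F x y.
  rewrite /F; have [/andP[x0 xy]|_] := boolP (0 < x < y); last by rewrite mulr0 !mul0r.
  rewrite mulr1 !mulr_ge0// ?exprn_ge0// ltW// (lt_trans x0)//.
transitivity (\int[leb]_y \int[leb]_x (F x y)%:E)%E.
  apply: eq_integral => y _; have [y0|y0] := ltP 0 y; last first.
    rewrite mul0r integral0_eq// => x _; rewrite /F.
    have -> : (0 < x < y) = false by apply/negbTE/negP => /andP[? ?]; lra.
    by rewrite mulr0 !mul0r.
  have -> : (\I[true] * (y ^+ n.+2 * gauss_exp y))%:E =
    (n.+1%:R * (y * gauss_exp y) * (y `^ n.+1%:R / n.+1%:R))%:E :> \bar R.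
    have n1 : n.+1%:R != 0 :> R by rewrite pnatr_eq0.
    rewrite powR_mulrn ?(ltW y0)// !exprS /= mul1r; congr EFin.
    by move: n.+1%:R n1 => c c0; field.
  rewrite EFinM -integral_powR0; [|by rewrite ltr0n|exact: ltW].
  rewrite -int_Zl; last 3 first.
  - by rewrite !mulr_ge0 ?(ltW y0).
  - by meas.
  - by move=> x; rewrite mulr_ge0 ?powR_ge0.
  apply: eq_integral => x _; rewrite /F; congr EFin.
  have [/andP[x0 xy]|_] := boolP (0 < x < y); last by rewrite !(mul0r, mulr0).
  have -> : x `^ (n.+1%:R - 1) = x ^+ n.
    by rewrite -natr1 addrK powR_mulrn// ltW.
  by rewrite /=; ring.
rewrite -tonelli; last 2 first.
- by rewrite /F /gauss_exp; meas.
- exact: F0.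
apply: eq_integral => x _; have [x0|x0] := ltP 0 x; last first.
  rewrite mul0r mulr0 integral0_eq// => y _; rewrite /F (ltNge 0 x) x0.
  by rewrite mulr0 !mul0r.
rewrite mul1r.
have -> : (n.+1%:R * v * (x ^+ n * gauss_exp x))%:E =
  ((n.+1%:R * v * x ^+ n)%:E * (gauss_exp x)%:E)%E by rewrite -EFinM; congr EFin; ring.
rewrite -gauss_exp_tail// -int_Zl; last 3 first.
- by rewrite !mulr_ge0 ?exprn_ge0 ?(ltW x0) ?(ltW v0).
- by meas.
- move=> y; have [xy|_] := ltP x y; last by rewrite mul0r.
  by rewrite mul1r mulr_ge0// divr_ge0 ?(ltW v0)// ltW// (lt_trans x0).
apply: eq_integral => y _; rewrite /F x0/=; congr EFin.
by case: (x < y); rewrite ?(mulr0, mul0r)//=; field; rewrite gt_eqF.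
Qed.

Lemma normal_pdf_gauss_exp x :
  normal_pdf 0 (Num.sqrt v) x = normal_peak (Num.sqrt v) * gauss_exp x.
Proof.
rewrite normal_pdfE ?gt_eqF ?sqrtr_gt0// /normal_fun /gauss_exp subr0.
rewrite sqr_sqrtr ?(ltW v0)//; congr (_ * expR _).
by rewrite mulNr (mulrC 2) mulr_natr.
Qed.

Lemma abs_moment n : (\int[leb]_x (`|x| ^+ n * normal_pdf 0 (Num.sqrt v) x)%:E =
  (2 * normal_peak (Num.sqrt v))%:E * half_moment n)%E.
Proof.
have p0 : 0 <= normal_peak (Num.sqrt v) by exact: normal_peak_ge0.
have mf k : measurable_fun setT (fun x : R => \I[0 < x] * (x ^+ k * gauss_exp x)) by meas.
have f0 k x : 0 <= \I[0 < x] * (x ^+ k * gauss_exp x).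
  have [x0|_] := ltP 0 x; last by rewrite mul0r.
  by rewrite mul1r mulr_ge0// exprn_ge0// ltW.
pose F (x : R) := \I[0 < x] * (x ^+ n * gauss_exp x).
have FN : (\int[leb]_x (F (- x))%:E = half_moment n)%E.
  have := @ge0_integral_affine R (-1) 0 (fun x => (F x)%:E).
  rewrite normrN1 invr1 mul1e /half_moment => <-.
  - by apply: eq_integral => x _; rewrite mulN1r addr0.
  - by rewrite oppr_eq0 oner_eq0.
  - by apply: measR_EFin; exact: mf.
  - by move=> x; rewrite lee_fin f0.
have mFN : measurable_fun setT (fun x : R => F (- x)) by rewrite /F /gauss_exp; meas.
transitivity (\int[leb]_x (normal_peak (Num.sqrt v) * (F x + F (- x)))%:E)%E.
  rewrite -(int_neq 0); last first.
    by rewrite (funext normal_pdf_gauss_exp); meas.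
  rewrite -[RHS](int_neq 0); last first.
    by apply: measR_M; [meas|apply: measR_D; [exact: mf|exact: mFN]].
  apply: eq_integral => x _; have [|x0] := eqVneq x 0; first by rewrite !mul0r.
  rewrite /= !mul1r normal_pdf_gauss_exp mulrCA; congr (_ * _)%:E.
  rewrite /F /gauss_exp sqrrN oppr_gt0.
  have [xneg|xpos|x00] := ltgtP x 0; last by rewrite x00 eqxx in x0.
    by rewrite mul0r mul1r add0r ltr0_norm.
  by rewrite mul0r mul1r addr0 gtr0_norm.
rewrite int_Zl; last 3 first.
- exact: p0.
- by apply: measR_D; [exact: mf|exact: mFN].
- by move=> x; rewrite addr_ge0 ?f0.
rewrite int_D; last 4 first.
- exact: mf.
- exact: mFN.
- exact: f0.
- by move=> x; exact: f0.
rewrite FN -/(half_moment n); have h0 : (0 <= half_moment n)%E by apply: int_ge0.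
rewrite -[X in (_ * (X + X))%E]mul1e -ge0_muleDl// muleA -EFinD -EFinM.
by congr (_%:E * _)%E; ring.
Qed.

Lemma abs_moment0 : ((2 * normal_peak (Num.sqrt v))%:E * half_moment 0 = 1)%E.
Proof.
rewrite -abs_moment -(@integral_normal_pdf R 0 (Num.sqrt v)).
by apply: eq_integral => x _; rewrite expr0 mul1r.
Qed.

Lemma abs_moment2 : (\int[leb]_x (`|x| ^+ 2 * normal_pdf 0 (Num.sqrt v) x)%:E = v%:E)%E.
Proof. by rewrite abs_moment half_momentSS muleCA abs_moment0 mule1 mul1r. Qed.

Lemma abs_moment4 :
  (\int[leb]_x (`|x| ^+ 4 * normal_pdf 0 (Num.sqrt v) x)%:E = (3 * v ^+ 2)%:E)%E.
Proof.
rewrite abs_moment !half_momentSS muleCA (muleCA _ (_ * v)%:E) abs_moment0 mule1.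
by rewrite -EFinM; congr EFin; ring.
Qed.

End gaussian_moments.

(** * Gaussian variables *)

Section layer.
Context d (T : measurableType d) (R : realType) (m : {sigma_finite_measure set T -> \bar R}).
Local Notation leb := (@lebesgue_measure R).

(** Moments expressed by tails. The weight g makes the formula apply both to a
    random variable (g = 1) and to a law given by a density. *)
Lemma moment_layer n (X g : T -> R) : measurable_fun setT X -> measurable_fun setT g ->
  (forall x, 0 <= g x) ->
  (\int[m]_x (`|X x| ^+ n.+1 * g x)%:E =
   \int[leb]_y ((\I[0 < y] * (n.+1%:R * y ^+ n))%:E *
      \int[m]_x (\I[(y < `|X x|)%R] * g x)%:E))%E.
Proof.
move=> mX mg g0.
pose F (x : T) (y : R) := \I[0 < y] * (n.+1%:R * y ^+ n) * (\I[y < `|X x|] * g x).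
have k0 (y : R) : 0 <= \I[0 < y] * (n.+1%:R * y ^+ n).
  have [y0|_] := ltP 0 y; last by rewrite mul0r.
  by rewrite mul1r mulr_ge0// exprn_ge0// ltW.
have F0 x y : 0 <= F x y by rewrite /F; apply: mulr_ge0; [exact: k0|exact: mulr_ge0].
have mF : measurable_fun setT (fun z : T * measurableTypeR R => F z.1 z.2).
  have mX1 : measurable_fun setT (fun z : T * measurableTypeR R => X z.1).
    exact: measurableT_comp.
  have mg1 : measurable_fun setT (fun z : T * measurableTypeR R => g z.1).
    exact: measurableT_comp.
  by rewrite /F; meas.
transitivity (\int[m]_x \int[leb]_y (F x y)%:E)%E.
  apply: eq_integral => x _.
  have -> : (`|X x| ^+ n.+1 * g x)%:E =
      ((n.+1%:R * g x)%:E * (`|X x| `^ n.+1%:R / n.+1%:R)%:E)%E.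
    have n1 : n.+1%:R != 0 :> R by rewrite pnatr_eq0.
    rewrite -EFinM; congr EFin; rewrite powR_mulrn//.
    by move: n.+1%:R n1 => c c0; field.
  rewrite -integral_powR0; [|by rewrite ltr0n|by []].
  rewrite -int_Zl; last 3 first.
  - by rewrite mulr_ge0.
  - by meas.
  - by move=> y; rewrite mulr_ge0 ?powR_ge0.
  apply: eq_integral => y _; rewrite /F; congr EFin.
  have [y0|_] := ltP 0 y; last by rewrite /= !(mul0r, mulr0).
  have -> : y `^ (n.+1%:R - 1) = y ^+ n by rewrite -natr1 addrK powR_mulrn// ltW.
  by rewrite /=; ring.
have := @fubini_tonelli _ _ T (measurableTypeR R) R m leb (fun z => (F z.1 z.2)%:E).
move=> ->; last 2 first.
- by apply/measurable_EFinP.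
- by move=> z; rewrite lee_fin.
apply: eq_integral => y _ /=; rewrite -int_Zl.
- by [].
- exact: k0.
- by meas.
- by move=> x; rewrite mulr_ge0.
Qed.

End layer.

Section gaussian_variables.
Context d (Omega : measurableType d) (R : realType) (P : probability Omega R).
Local Notation leb := (@lebesgue_measure R).

(** Centred, of variance v; degenerate when v = 0. *)
Definition has_gaussian_law (v : R) (X : Omega -> R) := measurable_fun setT X /\
  forall A : set R, measurable A -> P [set w | A (X w)] = gaussian_law 0 v A.

Lemma prob_int (b : Omega -> bool) : measurable_fun setT b ->
  (\int[P]_w (\I[b w])%:E = P [set w | b w])%E.
Proof.
move=> mb; under eq_integral do rewrite -[X in X%:E]mulr1.
rewrite (@integral_ind R _ Omega P [set w | b w]); last by [].
by rewrite integral_cst ?mul1e// -[X in measurable X]setTI; exact: mb.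
Qed.

(** Both sides have the same layer-cake formula, since the tails agree. *)
Lemma gaussian_moment (v : R) X n : 0 < v -> has_gaussian_law v X ->
  (\int[P]_w (`|X w| ^+ n.+1)%:E =
   \int[leb]_x (`|x| ^+ n.+1 * normal_pdf 0 (Num.sqrt v) x)%:E)%E.
Proof.
move=> v0 [mX lX].
have mpdf : measurable_fun setT (normal_pdf 0 (Num.sqrt v)) by exact: measurable_normal_pdf.
have pdf0 x : 0 <= normal_pdf 0 (Num.sqrt v) x by exact: normal_pdf_ge0.
rewrite (@moment_layer _ (measurableTypeR R) R leb n id _ _ mpdf pdf0); last exact: measurable_id.
under eq_integral do rewrite -[X in X%:E]mulr1.
rewrite (@moment_layer _ Omega R P n X (fun=> 1) mX); last 2 first.
- exact: measurable_cst.
- by [].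
apply: eq_integral => y _; congr (_ * _)%E.
under eq_integral do rewrite mulr1.
rewrite prob_int; last by meas.
pose A : set R := [set x | y < `|x|].
have mA : measurable A.
  have : measurable_fun setT (fun x : R => y < `|x|) by meas.
  by move=> /(_ measurableT [set true] I); rewrite setTI.
rewrite (lX A mA) /gaussian_law gt_eqF// /normal_prob.
by rewrite (@integral_ind R _ (measurableTypeR R) leb A).
Qed.

Lemma degenerate_moment X n : has_gaussian_law 0 X ->
  (\int[P]_w (X w ^+ n.+1)%:E = 0)%E.
Proof.
move=> [mX lX]; rewrite -(integral0 P setT).
have mA : measurable [set~ (0 : R)] by exact: measurableC.
apply: ae_eq_integral => //; first by apply: measR_EFin; meas.
exists [set w | [set~ 0] (X w)]; split.
- by rewrite -[X in measurable X]setTI; exact: mX.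
- by apply: etrans (lX _ mA) _; rewrite /gaussian_law eqxx diracE memNset// => /(_ erefl).
- move=> w /= /not_implyP[_ Xw] Xw0; apply: Xw.
  by rewrite Xw0 expr0n.
Qed.

Lemma gaussian_second_moment v X : 0 <= v -> has_gaussian_law v X ->
  (\int[P]_w (X w ^+ 2)%:E = v%:E)%E.
Proof.
rewrite le_eqVlt => /predU1P[<-|v0] lX; first exact: degenerate_moment.
rewrite -(abs_moment2 v0) -(gaussian_moment 1 v0 lX).
by apply: eq_integral => w _; rewrite real_normK ?num_real.
Qed.

Lemma gaussian_fourth_moment v X : 0 <= v -> has_gaussian_law v X ->
  (\int[P]_w (X w ^+ 4)%:E = (3 * v ^+ 2)%:E)%E.
Proof.
rewrite le_eqVlt => /predU1P[<-|v0] lX.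
  by rewrite expr0n mulr0; exact: degenerate_moment.
rewrite -(abs_moment4 v0) -(gaussian_moment 3 v0 lX).
apply: eq_integral => w _.
by rewrite (exprM _ 2 2) (exprM `|_| 2 2) real_normK ?num_real.
Qed.

End gaussian_variables.

(** * Limits of Gaussian variables *)

Section deviation.
Context d (Omega : measurableType d) (R : realType) (P : probability Omega R).
Implicit Types X Y : Omega -> R.

Lemma measurable_event (b : Omega -> bool) : measurable_fun setT b -> measurable [set w | b w].
Proof. by move=> mb; rewrite -[X in measurable X]setTI; exact: mb. Qed.

Lemma chebyshev_pow X k y : measurable_fun setT X -> 0 < y ->
  (P [set w | (y < `|X w|)%R] <= ((y ^+ k)^-1)%:E * \int[P]_w (`|X w| ^+ k)%:E)%E.
Proof.
move=> mX y0; rewrite -prob_int; last by meas.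
have yk : 0 < y ^+ k by rewrite exprn_gt0.
rewrite -int_Zl; last 3 first.
- by rewrite invr_ge0 ltW.
- by meas.
- by move=> w; exact: exprn_ge0.
apply: int_le.
- by meas.
- by meas.
- by [].
- move=> w; have [yX|_] := ltP y `|X w|; last by rewrite mulr_ge0 ?invr_ge0 ?exprn_ge0// ltW.
  by rewrite ler_pdivlMl// mulr1 lerXn2r ?nnegrE// ltW.
Qed.

Lemma prob_le (A B C : set Omega) : measurable A -> measurable B -> measurable C ->
  A `<=` B `|` C -> (P A <= P B + P C)%E.
Proof.
move=> mA mB mC ABC; apply: le_trans (measureU2 P mB mC).
by apply: le_measure; rewrite ?inE//; exact: measurableU.
Qed.

End deviation.

Lemma normal_prob_interval (R : realType) (s x e : R) : s != 0 -> 0 <= e ->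
  (normal_prob 0 s `]x, (x + e)%R]%classic <= (normal_peak s * e)%:E)%E.
Proof.
move=> s0 e0; rewrite /normal_prob.
have mB : measurable (`]x, (x + e)] : set (measurableTypeR R)) by exact: measurable_itv.
have Db (z : R) : `]x, (x + e)%R]%classic z <-> x < z <= x + e by rewrite /= in_itv.
have mpdf : measurable_fun setT (normal_pdf 0 s) by exact: measurable_normal_pdf.
rewrite -(@integral_ind R _ (measurableTypeR R) (@lebesgue_measure R) _ _ _ Db).
have := @int_le _ (measurableTypeR R) R (@lebesgue_measure R)
  (fun z => \I[x < z <= x + e] * normal_pdf 0 s z)
  (fun z => \I[x < z <= x + e] * normal_peak s).
move=> /(_ ltac:(meas) ltac:(meas)) H.
apply: le_trans (H _ _) _.
- by move=> z; rewrite mulr_ge0 ?normal_pdf_ge0.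
- by move=> z; rewrite ler_wpM2l ?normal_pdf_ub.
rewrite (@integral_ind R _ (measurableTypeR R) (@lebesgue_measure R) _ _ (fun=> _) Db).
rewrite integral_cst; last exact: mB.
rewrite [X in (_ * X)%E](_ : _ = if (x < x + e)%R then (x + e)%:E - x%:E else 0)%E; last first.
  by apply: etrans (lebesgue_measure_itv _) _; rewrite /= lte_fin.
case: ifPn => _.
  by rewrite -EFinB -EFinM lee_fin addrAC subrr add0r.
by rewrite mule0 lee_fin mulr_ge0 ?normal_peak_ge0.
Qed.

Lemma gaussian_law_interval (R : realType) (v x e : R) : 0 < v -> 0 <= e ->
  (gaussian_law 0 v `]-oo, (x + e)%R] <=
   gaussian_law 0 v `]-oo, x] + (normal_peak (Num.sqrt v) * e)%:E)%E.
Proof.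
move=> v0 e0; rewrite /gaussian_law gt_eqF//.
have xe : x <= x + e by rewrite lerDl.
have s0 : Num.sqrt v != 0 by rewrite gt_eqF// sqrtr_gt0.
have -> : `]-oo, (x + e)]%classic = `]-oo, x] `|` `]x, (x + e)] :> set R.
  by rewrite -itv_bndbnd_setU.
have mA : measurable (`]-oo, x] : set (measurableTypeR R)) by exact: measurable_itv.
have mB : measurable (`]x, (x + e)] : set (measurableTypeR R)) by exact: measurable_itv.
apply: le_trans (measureU2 (normal_prob 0 (Num.sqrt v)) mA mB) _.
apply: leeD; first exact: lexx.
exact: normal_prob_interval.
Qed.

Section squeeze.
Context d (Omega : measurableType d) (R : realType) (P : probability Omega R).
Implicit Types X Y : Omega -> R.

(** X <= x forces Y <= x + e unless |X - Y| > e. *)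
Lemma cdf_le X Y x y e : measurable_fun setT X -> measurable_fun setT Y -> x + e = y -> 0 < e ->
  (P [set w | (X w <= x)%R] <= P [set w | (Y w <= y)%R] +
     ((e ^+ 2)^-1)%:E * \int[P]_w ((X w - Y w) ^+ 2)%:E)%E.
Proof.
move=> mX mY xey e0.
have mXY : measurable_fun setT (fun w => X w - Y w) by meas.
apply: (@le_trans _ _ (P [set w | (Y w <= y)%R] + P [set w | (e < `|X w - Y w|)%R])%E).
  apply: prob_le.
  - by apply: measurable_event; meas.
  - by apply: measurable_event; meas.
  - by apply: measurable_event; meas.
  - move=> w /= Xx; have [|yY] := leP (Y w) y; [by left|right].
    by rewrite ltr0_norm; lra.
apply: leeD => //; apply: le_trans (chebyshev_pow P 2 mXY e0) _.
rewrite lee_pmul//; last 1 first.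
- by under eq_integral do rewrite real_normK ?num_real//.
- by rewrite lee_fin invr_ge0 sqr_ge0.
- by apply: int_ge0 => w; exact: sqr_ge0.
Qed.

(** The distribution function of X is squeezed between shifts by b of that of
    the normal law, which is Lipschitz. An L^2 error of b^3 costs b by
    Chebyshev's inequality, and b = e / (k + 1), with k the Lipschitz constant,
    makes the total error e. *)
Lemma gaussian_approx X v : 0 < v -> measurable_fun setT X ->
  (forall e : R, 0 < e -> exists J, has_gaussian_law P v J /\
    (\int[P]_w ((J w - X w) ^+ 2)%:E <= e%:E)%E) ->
  forall x, P [set w | X w <= x] = gaussian_law 0 v `]-oo, x]%classic.
Proof.
move=> v0 mX HJ x.
pose k := normal_peak (Num.sqrt v).
have k0 : 0 <= k by exact: normal_peak_ge0.
have lE J y : has_gaussian_law P v J ->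
    P [set w | (J w <= y)%R] = gaussian_law 0 v `]-oo, y]%classic.
  move=> [mJ lJ]; rewrite -(lJ `]-oo, y]%classic); last exact: measurable_itv.
  by congr (P _); apply/seteqP; split=> w /=; rewrite in_itv.
have e3 (e : R) : 0 < e -> ((e ^+ 2)^-1 * (e ^+ 3) = e)%R.
  by move=> e0; field; rewrite gt_eqF.
apply/eqP; rewrite eq_le; apply/andP; split; apply/lee_addgt0Pr => e e0.
- pose b := e / (k + 1).
  have b0 : 0 < b by rewrite divr_gt0// ltr_wpDl.
  have [J [lJ HJe]] := HJ (b ^+ 3) (exprn_gt0 _ b0).
  apply: le_trans (@cdf_le X J x (x + b) b mX lJ.1 erefl b0) _.
  rewrite (lE _ _ lJ); apply: le_trans (leeD (gaussian_law_interval x v0 (ltW b0))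
     (lexx _)) _; rewrite -addeA; apply: leeD => //.
  under eq_integral do rewrite -sqrrN opprB.
  apply: (@le_trans _ _ ((k * b)%:E + b%:E)%E).
    apply: leeD => //; rewrite -{2}(e3 b b0) EFinM; apply: lee_pmul => //.
      by rewrite lee_fin invr_ge0 sqr_ge0.
    by apply: int_ge0 => w; exact: sqr_ge0.
  by rewrite -EFinD lee_fin -{2}[b]mul1r -mulrDl /b mulrC divfK// gt_eqF// ltr_wpDl.
- pose b := e / (k + 1).
  have b0 : 0 < b by rewrite divr_gt0// ltr_wpDl.
  have [J [lJ HJe]] := HJ (b ^+ 3) (exprn_gt0 _ b0).
  have xb : x = (x - b) + b by rewrite subrK.
  rewrite {1}xb; apply: le_trans (gaussian_law_interval (x - b) v0 (ltW b0)) _.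
  rewrite -(lE _ _ lJ).
  apply: le_trans (leeD (@cdf_le J X (x - b) x b lJ.1 mX (esym xb) b0) (lexx _)) _.
  rewrite -addeA; apply: leeD => //.
  apply: (@le_trans _ _ (b%:E + (k * b)%:E)%E).
    apply: leeD => //; rewrite -{2}(e3 b b0) EFinM; apply: lee_pmul => //.
      by rewrite lee_fin invr_ge0 sqr_ge0.
    by apply: int_ge0 => w; exact: sqr_ge0.
  by rewrite -EFinD lee_fin addrC -{2}[b]mul1r -mulrDl /b mulrC divfK// gt_eqF// ltr_wpDl.
Qed.

End squeeze.

(** * The closed linear span of the process *)

Section gaussian_closure.
Context d (Omega : measurableType d) (R : realType) (P : probability Omega R).
Variables (H : R) (W : R -> {RV P >-> R}).
Hypotheses (HW : fractional_brownian_motion H W).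
Implicit Types (X Y : Omega -> R) (L : seq (R * R)).

(** Finite linear combinations of values of the process, as lists of pairs
    (coefficient, time); unlike step integrals they are closed under linear
    operations by mere concatenation. *)
Definition fbm_combo L w := \sum_(p <- L) p.1 * W p.2 w.

Definition fbm_combo_wf L := all (fun p => 0 <= p.2) L.

Lemma fbm_combo_law L : fbm_combo_wf L ->
  exists2 v : R, 0 <= v & has_gaussian_law P v (fbm_combo L).
Proof.
move=> wL.
have [v v0 lv] := HW.1 (size L) (fun i => (nth (0, 0) L i).2)
  (fun i => (nth (0, 0) L i).1) (fun i => all_nthP (0, 0) wL i (ltn_ord i)).
have E w : fbm_combo L w =
    \sum_(i < size L) (nth (0, 0) L i).1 * W (nth (0, 0) L i).2 w.
  by rewrite /fbm_combo (big_nth (0, 0)) big_mkord.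
exists v => //; split; last first.
  move=> A mA; rewrite -(lv A mA); congr (P _).
  by apply/seteqP; split=> w /=; rewrite E.
rewrite (funext E); apply: measurable_sum => i.
by have := measurable_RV (W (nth (0, 0) L i).2) => ?; meas.
Qed.

Lemma fbm_combo_sqint L : fbm_combo_wf L -> sqint P (fbm_combo L).
Proof.
move=> /fbm_combo_law[v v0 lv]; split; first exact: lv.1.
by rewrite (gaussian_second_moment v0 lv) ltry.
Qed.

Definition fbm_combo_lin (a b : R) L1 L2 :=
  [seq (a * p.1, p.2) | p <- L1] ++ [seq (b * p.1, p.2) | p <- L2].

Lemma fbm_combo_linE a b L1 L2 w :
  fbm_combo (fbm_combo_lin a b L1 L2) w = a * fbm_combo L1 w + b * fbm_combo L2 w.
Proof.
rewrite /fbm_combo big_cat !big_map !mulr_sumr.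
by congr (_ + _); apply: eq_bigr => p _; rewrite mulrA.
Qed.

Lemma fbm_combo_lin_wf a b L1 L2 : fbm_combo_wf L1 -> fbm_combo_wf L2 ->
  fbm_combo_wf (fbm_combo_lin a b L1 L2).
Proof. by rewrite /fbm_combo_wf all_cat !all_map => -> ->. Qed.

Lemma step_integral_combo s : step_wf s ->
  exists2 L, fbm_combo_wf L & step_integral W s = fbm_combo L.
Proof.
elim: s => [_|[[c u] v] s IH].
  by exists [::] => //; apply/funext => w; rewrite /step_integral /fbm_combo !big_nil.
move=> /= /andP[/andP[u0 uv] /IH[L wL sL]].
exists [:: (c, v), (- c, u) & L].
  by rewrite /= wL u0 (le_trans u0 uv).
apply/funext => w; rewrite step_integral_cons sL /fbm_combo !big_cons /=.
by ring.
Qed.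

(** The closed linear span of the process in L^2. *)
Definition gauss_limit X := measurable_fun setT X /\ exists L : nat -> seq (R * R),
  (forall n, fbm_combo_wf (L n)) /\
  (\int[P]_w ((fbm_combo (L n) w - X w) ^+ 2)%:E)%E @[n --> \oo] --> 0%E.

Lemma wiener_gauss_limit f (X : {RV P >-> R}) : is_wiener_integral H W f X -> gauss_limit X.
Proof.
move=> [s [ws _]]; under eq_fun do rewrite expectationE.
move=> C; split; first exact: measurable_RV.
pose L n := s2val (cid2 (step_integral_combo (ws n))).
have wL n : fbm_combo_wf (L n) by exact: s2valP (cid2 (step_integral_combo (ws n))).
have LE n : step_integral W (s n) = fbm_combo (L n).
  exact: s2valP' (cid2 (step_integral_combo (ws n))).
by exists L; split => //; under eq_fun do rewrite -LE.
Qed.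

Lemma gauss_limit_lin a b X Y : gauss_limit X -> gauss_limit Y ->
  gauss_limit (fun w => a * X w + b * Y w).
Proof.
move=> [mX [L [wL CL]]] [mY [K [wK CK]]]; split; first by meas.
exists (fun n => fbm_combo_lin a b (L n) (K n)); split.
  by move=> n; exact: fbm_combo_lin_wf.
have mL n : measurable_fun setT (fbm_combo (L n)) by exact: (fbm_combo_sqint (wL n)).1.
have mK n : measurable_fun setT (fbm_combo (K n)) by exact: (fbm_combo_sqint (wK n)).1.
have sum0 : (\int[P]_w ((fbm_combo (L n) w - X w) ^+ 2)%:E +
    \int[P]_w ((fbm_combo (K n) w - Y w) ^+ 2)%:E)%E @[n --> \oo] --> 0%E.
  rewrite -[X in _ --> X]adde0; apply: cvgeD => //.
apply: (@cvge0_le _ _ _ (2 * (a ^+ 2 + b ^+ 2)) _ _ _ _ sum0).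
- by rewrite mulr_ge0// addr_ge0 ?sqr_ge0.
- by move=> n; apply: int_ge0 => w; exact: sqr_ge0.
- by move=> n; apply: adde_ge0; apply: int_ge0 => w; exact: sqr_ge0.
move=> n; rewrite -int_D; last 4 first.
- by have := mL n => ?; meas.
- by have := mK n => ?; meas.
- by move=> w; exact: sqr_ge0.
- by move=> w; exact: sqr_ge0.
have mLn := mL n; have mKn := mK n.
rewrite -int_Zl; last 3 first.
- by rewrite mulr_ge0// addr_ge0 ?sqr_ge0.
- by meas.
- by move=> w; rewrite addr_ge0 ?sqr_ge0.
rewrite (funext (fbm_combo_linE a b (L n) (K n))).
apply: int_le.
- by meas.
- by meas.
- by move=> w; exact: sqr_ge0.
move=> w; set x := fbm_combo (L n) w - X w; set y := fbm_combo (K n) w - Y w.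
have -> : a * fbm_combo (L n) w + b * fbm_combo (K n) w - (a * X w + b * Y w) = a * x + b * y.
  by rewrite /x /y; ring.
have -> : 2 * (a ^+ 2 + b ^+ 2) * (x ^+ 2 + y ^+ 2) =
    (a * x + b * y) ^+ 2 + (a * x - b * y) ^+ 2 + 2 * (a * y) ^+ 2 + 2 * (b * x) ^+ 2 by ring.
have := sqr_ge0 (a * x - b * y); have := sqr_ge0 (a * y); have := sqr_ge0 (b * x).
by lra.
Qed.

Lemma gauss_limit_sqint X : gauss_limit X -> sqint P X.
Proof.
move=> [mX [L [wL CL]]]; apply: sqint_cvg mX CL => n.
exact: fbm_combo_sqint.
Qed.

End gaussian_closure.

Section gaussian_limits.
Context d (Omega : measurableType d) (R : realType) (P : probability Omega R).
Local Notation leb := (@lebesgue_measure R).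
Implicit Types X Y : Omega -> R.

Lemma sqint1 : sqint P (fun=> 1).
Proof.
split; first exact: measurable_cst.
under eq_integral do rewrite expr1n; rewrite integral_cst// mul1e.
exact: le_lt_trans (probability_le1 P measurableT) (ltry 1).
Qed.

Lemma sqint_intble1 X : sqint P X -> intble P X.
Proof.
move=> SX; have := sqint_intble SX sqint1.
by under eq_fun do rewrite mulr1.
Qed.

(** The positive and negative parts have the same tails. *)
Lemma symmetric_mean0 X v : has_gaussian_law P v X -> has_gaussian_law P v (fun w => - X w) ->
  intble P X -> rint P X = 0.
Proof.
move=> [mX lX] [mN lN] IX.
have mpos Y : measurable_fun setT Y -> measurable_fun setT (fun w => \I[0 < Y w] : R).
  by move=> mY; meas.
have half Y : measurable_fun setT Y ->
  (\int[P]_w (`|Y w| ^+ 1 * \I[0 < Y w])%:E =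
   \int[leb]_y ((\I[0 < y] * (1%:R * y ^+ 0))%:E * P [set w | (Y w \in `]Num.max 0 y, +oo[)%R]))%E.
  move=> mY; rewrite moment_layer; [|by []|exact: mpos|by []].
  apply: eq_integral => y _; have [y0|] := ltP 0 y; last by rewrite mul0r !mul0e.
  congr (_ * _)%E; rewrite -prob_int; last first.
    rewrite (_ : (fun w => _) = fun w => y < Y w); first by meas.
    by apply/funext => w; rewrite in_itv/= andbT.
  apply: eq_integral => w _; rewrite in_itv/= andbT -natrM mulnb; congr (_%:R)%:E.
  congr nat_of_bool; have [Y0|Y0] := ltP 0 (Y w); first by rewrite andbT gtr0_norm.
  by rewrite andbF; apply/esym/negbTE; rewrite -leNgt (le_trans Y0)// ltW.
have tailE y : P [set w | (X w \in `]Num.max 0 y, +oo[)%R] =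
               P [set w | (- X w \in `]Num.max 0 y, +oo[)%R].
  have mA : measurable (`]Num.max 0 y, +oo[%classic : set (measurableTypeR R)).
    exact: measurable_itv.
  by rewrite [LHS](lX _ mA) [RHS](lN _ mA).
have E : (\int[P]_w (`|X w| ^+ 1 * \I[0 < X w])%:E =
          \int[P]_w (`|X w| ^+ 1 * \I[0 < - X w])%:E)%E.
  rewrite half//; under [RHS]eq_integral do rewrite -normrN.
  by rewrite half//; apply: eq_integral => y _; rewrite tailE.
have I1 (b : Omega -> bool) : measurable_fun setT b ->
    intble P (fun w => `|X w| ^+ 1 * \I[b w]).
  move=> mb; apply: (intble_dom (g := fun w => `|X w|)) => //.
  - by meas.
  - by meas.
  - move=> w; rewrite expr1 normrM normr_id (ger0_norm (ler0n _ _)).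
    by case: (b w); rewrite ?mulr1 ?mulr0.
  - exact: intble_lty.
transitivity (rint P (fun w => `|X w| ^+ 1 * \I[0 < X w] - `|X w| ^+ 1 * \I[0 < - X w])).
  apply: eq_rint => w; rewrite expr1 oppr_gt0.
  have [X0|X0|->] := ltgtP (X w) 0; last by rewrite !mulr0 subr0.
    by rewrite mulr0 mulr1 sub0r ltr0_norm// opprK.
  by rewrite mulr0 mulr1 subr0 gtr0_norm.
rewrite rintB; last 2 first.
- by apply: I1; meas.
- by apply: I1; meas.
by rewrite /rint E subrr.
Qed.

Variables (H : R) (W : R -> {RV P >-> R}).
Hypotheses (HW : fractional_brownian_motion H W).
Implicit Type L : seq (R * R).

Lemma fbm_combo_scale (a : R) L w : fbm_combo W (fbm_combo_lin a 0 L [::]) w = a * fbm_combo W L w.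
Proof. by rewrite fbm_combo_linE mul0r addr0. Qed.

Lemma fbm_combo_scale_wf (a : R) L : fbm_combo_wf L -> fbm_combo_wf (fbm_combo_lin a 0 L [::]).
Proof. by move=> wL; apply: fbm_combo_lin_wf. Qed.

(** The second moment identifies the unnamed variance in the Gaussian law of a
    linear combination. *)
Lemma fbm_combo_law_rint L : fbm_combo_wf L ->
  has_gaussian_law P (rint P (fun w => fbm_combo W L w ^+ 2)) (fbm_combo W L).
Proof.
move=> wL; have [v v0 lv] := fbm_combo_law HW wL.
by rewrite /rint (gaussian_second_moment v0 lv).
Qed.

Lemma fbm_combo_mean0 L : fbm_combo_wf L -> rint P (fbm_combo W L) = 0.
Proof.
move=> wL; apply: (symmetric_mean0 (fbm_combo_law_rint wL)); last first.
  by apply: sqint_intble1; exact: fbm_combo_sqint HW _ wL.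
have := fbm_combo_law_rint (fbm_combo_scale_wf (-1) wL).
have -> : fbm_combo W (fbm_combo_lin (-1) 0 L [::]) = fun w => - fbm_combo W L w.
  by apply/funext => w; rewrite fbm_combo_scale mulN1r.
rewrite (_ : rint P (fun w => (- _) ^+ 2) = rint P (fun w => fbm_combo W L w ^+ 2)) //.
by apply: eq_rint => w; rewrite sqrrN.
Qed.

Lemma gauss_limit_mean0 X : gauss_limit W X -> rint P X = 0.
Proof.
move=> GX; have SX := gauss_limit_sqint HW GX; case: GX => [mX [L [wL CL]]].
have SL n := fbm_combo_sqint HW (wL n).
have := sqint_rint_cvg SL SX sqint1 CL.
rewrite (_ : (fun n => _) = fun=> 0); last first.
  apply/funext => n; rewrite -[RHS](fbm_combo_mean0 (wL n)).
  by apply: eq_rint => w; rewrite mulr1.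
move=> C; rewrite -(cvg_unique (@norm_hausdorff _ R^o) C (cvg_cst 0)).
by apply: eq_rint => w; rewrite mulr1.
Qed.

End gaussian_limits.

Section gaussian_limit_law.
Context d (Omega : measurableType d) (R : realType) (P : probability Omega R).
Implicit Types X Y : Omega -> R.
Variables (H : R) (W : R -> {RV P >-> R}).
Hypotheses (HW : fractional_brownian_motion H W).

Lemma sqint_int X : sqint P X -> (\int[P]_w (X w ^+ 2)%:E = (rint P (fun w => X w * X w))%:E)%E.
Proof.
move=> SX; rewrite -rintE; last exact: sqint_intble.
by apply: eq_integral => w _; rewrite expr2.
Qed.

Lemma rint_sqrB X Y (a : R) : sqint P X -> sqint P Y ->
  rint P (fun w => (a * X w - Y w) * (a * X w - Y w)) =
  a ^+ 2 * rint P (fun w => X w * X w) - 2 * a * rint P (fun w => X w * Y w) +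
  rint P (fun w => Y w * Y w).
Proof.
move=> SX SY; have IX := sqint_intble SX SX; have IY := sqint_intble SY SY.
have IXY := sqint_intble SX SY.
rewrite -!rintZ// -rintB; [|exact: intbleZ|exact: intbleZ].
rewrite -rintD//; last by apply: intbleB; exact: intbleZ.
by apply: eq_rint => w; ring.
Qed.

Section approximation.
Variables (X : Omega -> R) (L : nat -> seq (R * R)).
Hypotheses (mX : measurable_fun setT X) (wL : forall n, fbm_combo_wf (L n))
  (CL : (\int[P]_w ((fbm_combo W (L n) w - X w) ^+ 2)%:E)%E @[n --> \oo] --> 0%E).
Let Z n := fbm_combo W (L n).
Let SZ n : sqint P (Z n). Proof. exact: fbm_combo_sqint HW (L n) (wL n). Qed.
Let SX : sqint P X. Proof. exact: sqint_cvg SZ mX CL. Qed.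
Let sX := rint P (fun w => X w * X w).

Lemma approx_cross : rint P (fun w => Z n w * X w) @[n --> \oo] --> sX.
Proof. exact: sqint_rint_cvg. Qed.

Lemma approx_err : rint P (fun w => (Z n w - X w) * (Z n w - X w)) @[n --> \oo] --> 0.
Proof.
have E n : rint P (fun w => (Z n w - X w) * (Z n w - X w)) =
    fine (\int[P]_w ((Z n w - X w) ^+ 2)%:E)%E.
  by apply: eq_rint => w; rewrite expr2.
by rewrite (funext E); exact: fine_cvg.
Qed.

Lemma approx_sq : rint P (fun w => Z n w * Z n w) @[n --> \oo] --> sX.
Proof.
have E n : rint P (fun w => Z n w * Z n w) =
    rint P (fun w => (Z n w - X w) * (Z n w - X w)) + 2 * rint P (fun w => Z n w * X w) - sX.
  have := rint_sqrB 1 (SZ n) SX.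
  rewrite (@eq_rint _ _ _ _ _ (fun w => (Z n w - X w) * (Z n w - X w))) => [->|w].
    by rewrite /sX; move: (rint _ _) (rint _ _) (rint _ _) => p q r; ring.
  by rewrite mul1r.
rewrite (funext E) [X in _ --> X](_ : _ = 0 + 2 * sX - sX); last by ring.
apply: cvgB; last exact: cvg_cst.
apply: cvgD; first exact: approx_err.
by apply: cvgM; [exact: cvg_cst|exact: approx_cross].
Qed.

End approximation.

(** Markov's inequality for the fourth moment 3 v^2 of an approximating
    Gaussian at y / 2 gives 16 * 3 v^2 / y^4; the approximation error
    disappears in the limit. *)
Lemma gauss_limit_tail X y : gauss_limit W X -> 0 < y ->
  (P [set w | (y < `|X w|)%R] <= (48 * rint P (fun w => X w * X w) ^+ 2 / y ^+ 4)%:E)%E.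
Proof.
move=> [mX [L [wL CL]]] y0.
have SX : sqint P X by exact: gauss_limit_sqint HW _ (conj mX (ex_intro _ L (conj wL CL))).
have SZ n := fbm_combo_sqint HW (wL n).
pose Z n := fbm_combo W (L n).
have y20 : 0 < y / 2 by rewrite divr_gt0.
pose e n := rint P (fun w => (Z n w - X w) * (Z n w - X w)).
pose v n := rint P (fun w => Z n w * Z n w).
have mA : measurable [set w | (y < `|X w|)%R] by apply: measurable_event; meas.
have bound n : fine (P [set w | (y < `|X w|)%R]) <=
    ((y / 2) ^+ 4)^-1 * (3 * v n ^+ 2) + ((y / 2) ^+ 2)^-1 * e n.
  have mZ : measurable_fun setT (Z n) by exact: (SZ n).1.
  rewrite -lee_fin fineK ?fin_num_measure//.
  apply: (@le_trans _ _ (P [set w | (y / 2 < `|Z n w|)%R] +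
      P [set w | (y / 2 < `|Z n w - X w|)%R])%E).
    apply: prob_le => //.
    - by apply: measurable_event; meas.
    - by apply: measurable_event; meas.
    - move=> w /= yX; have [Zy|] := leP `|Z n w| (y / 2); [right|by left].
      have := ler_normB (Z n w) (Z n w - X w).
      by rewrite opprB addrC subrK; lra.
  rewrite EFinD; apply: leeD.
    apply: le_trans (chebyshev_pow P 4 mZ y20) _.
    have l := fbm_combo_law_rint HW (wL n).
    have E : rint P (fun w => fbm_combo W (L n) w ^+ 2) = v n.
      by apply: eq_rint => w; rewrite expr2.
    rewrite E in l; have v0 : 0 <= v n.
      by apply: rint_ge0 => w; rewrite -expr2 sqr_ge0.
    rewrite EFinM -(gaussian_fourth_moment v0 l) lee_pmul//.
    - by rewrite lee_fin invr_ge0 exprn_ge0// ltW.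
    - by apply: int_ge0 => w; exact: exprn_ge0.
    - rewrite le_eqVlt; apply/orP; left; apply/eqP; apply: eq_integral => w _.
      by rewrite (exprM `|_| 2 2) real_normK ?num_real// -exprM.
  have mZX : measurable_fun setT (fun w => Z n w - X w) by meas.
  apply: le_trans (chebyshev_pow P 2 mZX y20) _.
  rewrite EFinM /e -(sqint_int (sqintB (SZ n) SX)).
  rewrite lee_pmul//.
  - by rewrite lee_fin invr_ge0 exprn_ge0// ltW.
  - by apply: int_ge0 => w; exact: exprn_ge0.
  - rewrite le_eqVlt; apply/orP; left; apply/eqP; apply: eq_integral => w _.
    by rewrite real_normK ?num_real.
rewrite -[leLHS]fineK ?fin_num_measure// lee_fin.
set s := rint P (fun w => X w * X w).
have -> : 48 * s ^+ 2 / y ^+ 4 = ((y / 2) ^+ 4)^-1 * (3 * s ^+ 2) + ((y / 2) ^+ 2)^-1 * 0.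
  by field; rewrite gt_eqF.
have cv : v n @[n --> \oo] --> s by exact: approx_sq.
have ce : e n @[n --> \oo] --> 0 by exact: approx_err.
apply: (@ler_cvg_to _ \oo _ _ (fun=> fine (P [set w | (y < `|X w|)%R])) _ _ _ (cvg_cst _)).
  apply: cvgD; last by apply: cvgM; [exact: cvg_cst|exact: ce].
  apply: cvgM; first exact: cvg_cst.
  apply: cvgM; first exact: cvg_cst.
  exact: (@cvg_comp _ _ _ v (fun x : R => x ^+ 2) _ _ _ cv (@exprn_continuous R 2 s)).
by apply: nearW => n; exact: bound.
Qed.

(** Rescaling the approximations makes their variance exactly v without
    spoiling the convergence; [gaussian_approx] then applies to a fixed law. *)
Lemma gauss_limit_law X (v : R) : gauss_limit W X -> 0 < v -> rint P (fun w => X w * X w) = v ->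
  forall x, P [set w | X w <= x] = gaussian_law 0 v `]-oo, x]%classic.
Proof.
move=> GX v0 sX; have SX := gauss_limit_sqint HW GX; case: GX => [mX [L [wL CL]]].
apply: gaussian_approx => // e e0.
have SZ n := fbm_combo_sqint HW (wL n).
pose Z n := fbm_combo W (L n).
pose u n := rint P (fun w => Z n w * Z n w).
have cu : u n @[n --> \oo] --> v by rewrite -sX; exact: approx_sq.
have cc : rint P (fun w => Z n w * X w) @[n --> \oo] --> v by rewrite -sX; exact: approx_cross.
pose r n := Num.sqrt (v / u n).
have cr : r n @[n --> \oo] --> (1 : R).
  rewrite -[X in _ --> X](@sqrtr1 R) -[X in Num.sqrt X](divff (lt0r_neq0 v0)).
  have cq : v / u n @[n --> \oo] --> v / v.
    by apply: cvgM; [exact: cvg_cst|apply: cvgV => //; rewrite gt_eqF].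
  exact: (@cvg_comp _ _ _ (fun n => v / u n) Num.sqrt _ _ _ cq (@sqrt_continuous R _)).
have cerr : 2 * v - 2 * r n * rint P (fun w => Z n w * X w) @[n --> \oo] --> 0.
  rewrite [X in _ --> X](_ : _ = 2 * v - 2 * 1 * v); last by rewrite mulr1 subrr.
  apply: cvgB; first exact: cvg_cst.
  by apply: cvgM => //; apply: cvgM => //; exact: cvg_cst.
have nu : \forall n \near \oo, 0 < u n by exact: (cvgr_gt _ cu).
have ne : \forall n \near \oo, 2 * v - 2 * r n * rint P (fun w => Z n w * X w) <= e.
  by apply: (cvgr_le _ cerr).
near \oo => n.
have un0 : 0 < u n by near: n.
have rn2 : r n ^+ 2 * u n = v.
  by rewrite sqr_sqrtr ?divr_ge0 ?ltW// divfK// gt_eqF.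
exists (fbm_combo W (fbm_combo_lin (r n) 0 (L n) [::])).
have wJ : fbm_combo_wf (fbm_combo_lin (r n) 0 (L n) [::]) by exact: fbm_combo_scale_wf.
split.
  have := fbm_combo_law_rint HW wJ.
  rewrite (_ : rint P _ = v)// -rn2 /u -(rintZ _ (sqint_intble (SZ n) (SZ n))).
  by apply: eq_rint => w; rewrite fbm_combo_scale; rewrite /Z; ring.
rewrite (funext (fbm_combo_scale W (r n) (L n))) -/(Z n).
rewrite (sqint_int (sqintB (sqintZ (r n) (SZ n)) SX)).
rewrite lee_fin (rint_sqrB _ (SZ n) SX) -/(u n) rn2 sX.
have := (_ : 2 * v - 2 * r n * rint P (fun w => Z n w * X w) <= e).
by rewrite /Z; move=> /(_ ltac:(near: n; exact: ne)); lra.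
Unshelve. all: by end_near. Qed.

End gaussian_limit_law.

(** * Identification of the drift *)

Section density_uniqueness.
Variable R : realType.
Local Notation leb := (@lebesgue_measure R).
Implicit Types f g : R -> R.

(** Lebesgue's differentiation theorem. *)
Lemma zero_primitive f : intble leb f -> (forall x, rint leb (fun r => \I[r <= x] * f r) = 0) ->
  {ae leb, forall x, f x = 0}.
Proof.
move=> If f0.
have If' (y : R) : leb.-integrable `]-oo, y] (EFin \o f).
  by apply: (integrableS measurableT) => //; exact: measurable_itv.
have lf : locally_integrable setT f by exact: (open_integrable_locally openT If).
have := FTC1Ny If' lf.
apply: filterS; first exact: (ae_filter_ringOfSetsType leb).
move=> x [_ <-].
rewrite (_ : (fun x => _) = cst 0) ?derive1_cst//.
apply/funext => y; rewrite -[RHS](f0 y) /Rintegral /rint.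
congr fine; rewrite (@integral_ind R _ (measurableTypeR R) leb `]-oo, y]%classic)//.
Qed.

Lemma eq_rint_ae f g : intble leb f -> intble leb g -> {ae leb, forall x, f x = g x} ->
  rint leb f = rint leb g.
Proof.
move=> If Ig fg; congr fine; apply: ae_eq_integral => //.
- by case/integrableP: If.
- by case/integrableP: Ig.
- move: fg; apply: filterS; first exact: (ae_filter_ringOfSetsType leb).
  by move=> x -> _.
Qed.

Lemma eq_rint_off p q f g : measurable_fun setT f -> measurable_fun setT g ->
  (forall x, x != p -> x != q -> f x = g x) -> rint leb f = rint leb g.
Proof.
move=> mf mg fg; congr fine.
have mp : measurable_fun setT (fun x : R => x != p).
  rewrite (_ : (fun x => _) = fun x : R => ~~ ((x <= p) && (p <= x))); first by meas.
  by apply/funext => x; rewrite -eq_le.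
have mf' : measurable_fun setT (fun x : R => \I[x != p] * f x) by meas.
have mg' : measurable_fun setT (fun x : R => \I[x != p] * g x) by meas.
rewrite -(int_neq p mf) -(int_neq p mg) -(int_neq q mf') -(int_neq q mg').
apply: eq_integral => x _; congr EFin.
have [|xp] := eqVneq x p; first by rewrite !mul0r !mulr0.
by have [|xq] := eqVneq x q; [rewrite !mul0r|rewrite (fg x xp xq)].
Qed.

Lemma rint_powR c s : 0 < c -> 0 <= s ->
  intble leb (fun x => \I[0 < x < s] * x `^ (c - 1)) /\
  rint leb (fun x => \I[0 < x < s] * x `^ (c - 1)) = s `^ c / c.
Proof.
move=> c0 s0; split; last by rewrite /rint integral_powR0.
apply: intble_ge0; [by meas|by move=> x; rewrite mulr_ge0 ?powR_ge0|].
by rewrite integral_powR0// ltry.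
Qed.

Lemma intble_ind (D : set (measurableTypeR R)) (b : R -> bool) g : measurable D ->
  (forall x, D x <-> b x) -> leb.-integrable D (EFin \o g) ->
  intble leb (fun x => \I[b x] * g x).
Proof.
move=> mD Db /(integrable_mkcond _ mD).
rewrite /intble (_ : (EFin \o g) \_ D = fun x => (\I[b x] * g x)%:E)//.
apply/funext => x; rewrite patchE; case: ifPn => [/set_mem/Db ->|]; first by rewrite mul1r.
by move=> /negP xD; case: (boolP (b x)) => [/Db/mem_set//|_]; rewrite mul0r.
Qed.

(** The difference of g and the candidate, extended by 0 outside ]0, T[, has a
    vanishing primitive. *)
Lemma drift_identification g (A B c T : R) : 0 < c -> 0 < T ->
  leb.-integrable `[0, T] (EFin \o g) ->
  (forall s, 0 <= s <= T -> \int[leb]_(r in `[0, s]) g r = A * s + B * (s `^ c / c)) ->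
  {ae leb, forall x, \I[0 < x < T] * g x = \I[0 < x < T] * (A + B * x `^ (c - 1))}.
Proof.
move=> c0 T0 Ig gE.
have Igc s : s <= T -> intble leb (fun x => \I[0 <= x <= s] * g x).
  move=> sT; apply: (@intble_ind `[0, s]%classic).
  - exact: measurable_itv.
  - by move=> x; rewrite /= in_itv.
  - apply: integrableS Ig; [exact: measurable_itv|exact: measurable_itv|].
    by apply: subset_itvl; rewrite bnd_simp.
have Igo s : s <= T -> intble leb (fun x => \I[0 < x < s] * g x).
  move=> sT; apply: (@intble_ind `]0, s[%classic).
  - exact: measurable_itv.
  - by move=> x; rewrite /= in_itv.
  - apply: integrableS Ig; [exact: measurable_itv|exact: measurable_itv|].
    by apply: subset_itv; rewrite bnd_simp.
pose g0 s (x : R) := A * (\I[0 < x < s] * x `^ (1 - 1)) + B * (\I[0 < x < s] * x `^ (c - 1)).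
have Ig0 s : 0 <= s -> intble leb (g0 s) /\ rint leb (g0 s) = A * s + B * (s `^ c / c).
  move=> s0; have [I1 E1] := rint_powR ltr01 s0; have [Ic Ec] := rint_powR c0 s0.
  have IA := intbleZ A I1; have IB := intbleZ B Ic.
  split; first exact: intbleD.
  by rewrite rintD// !rintZ// E1 Ec powRr1// divr1.
have g0E s x : g0 s x = \I[0 < x < s] * (A + B * x `^ (c - 1)).
  by rewrite /g0 subrr powRr0; ring.
have gEo s : 0 <= s -> s <= T -> rint leb (fun x => \I[0 < x < s] * g x) = rint leb (g0 s).
  move=> s0 sT; rewrite (Ig0 s s0).2 -gE; last by rewrite s0.
  transitivity (rint leb (fun x => \I[0 <= x <= s] * g x)).
    apply: (eq_rint_off (p := 0) (q := s)).
    - exact: (intble_meas (Igo s sT)).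
    - exact: (intble_meas (Igc s sT)).
    - by move=> x x0 xs; rewrite !le_eqVlt (eq_sym 0) (negbTE x0) (negbTE xs).
  congr fine; rewrite (@integral_ind R _ (measurableTypeR R) leb `[0, s]%classic)//.
pose f x := \I[0 < x < T] * g x - g0 T x.
have If : intble leb f by apply: intbleB; [exact: (Igo T (lexx T))|exact: (Ig0 T (ltW T0)).1].
suff : {ae leb, forall x, f x = 0}.
  apply: filterS; first exact: (ae_filter_ringOfSetsType leb).
  by move=> x /eqP; rewrite subr_eq0 g0E => /eqP.
apply: (zero_primitive If) => x; have [x0|x0] := leP x 0.
  rewrite -[RHS](rint0 leb); apply: eq_rint => r; rewrite /f g0E.
  have [rx|_] := leP r x; last by rewrite mul0r.
  by rewrite (ltNge 0 r) (le_trans rx x0) !mul0r subrr mulr0.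
pose s := Num.min x T.
have s0 : 0 <= s by rewrite le_min (ltW x0) ltW.
have sT : s <= T by rewrite ge_min lexx orbT.
have mfx : measurable_fun setT (fun r : R => \I[r <= x] * f r).
  by have := intble_meas If => ?; meas.
transitivity (rint leb (fun r => \I[0 < r < s] * g r - g0 s r)).
  apply: (eq_rint_off (p := s) (q := s)) => //.
    exact: (intble_meas (intbleB (Igo s sT) (Ig0 s s0).1)).
  move=> r rs _; rewrite /f !g0E /s lt_min.
  have [rx|rx] := leP r x; last first.
    by rewrite mul0r (ltNge r) (ltW rx) andbF !mul0r subrr.
  rewrite mul1r; have [rx'|] := ltP r x; first by rewrite andTb.
  move=> xr; have rxE : r = x by apply/eqP; rewrite eq_le rx.
  have Tr : T < r.
    by rewrite ltNge; apply: contra rs => rT; rewrite /s -rxE (min_idPl rT).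
  by rewrite (ltNge r T) (ltW Tr) !andbF.
rewrite rintB; [|exact: Igo|exact: (Ig0 s s0).1].
by rewrite gEo// subrr.
Qed.

End density_uniqueness.

(** * The estimation error as a Wiener integral *)

Section representation.
Context d (Omega : measurableType d) (R : realType) (P : probability Omega R).
Local Notation leb := (@lebesgue_measure R).
Variables (H : R) (W : R -> {RV P >-> R}).
Hypotheses (H01 : 0 < H < 1) (HW : fractional_brownian_motion H W).

(** Its mean would make the constant 0, against E(W_T^2) = T^(2H). *)
Lemma fbm_not_constant T : 0 < T -> (forall w w', W T w = W T w') -> False.
Proof.
move=> T0 WE; have T0' := ltW T0.
have wf : fbm_combo_wf [:: (1 : R, T)] by rewrite /= T0'.
have WC w : W T w = W T point by exact: WE.
have m0 : W T point = 0.
  have E1 : rint P (fun=> 1) = 1 :> R.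
    by rewrite /rint integral_cst// mul1e; exact: (congr1 fine (probability_setT P)).
  rewrite -[LHS]mulr1 -E1 -rintZ; last exact: sqint_intble1 (sqint1 P).
  rewrite -[RHS](fbm_combo_mean0 HW wf).
  by apply: eq_rint => w; rewrite /fbm_combo big_cons big_nil addr0/= WC; ring.
have : rint P (fun w => W T w * W T w) = 0.
  by rewrite -[RHS](rint0 P); apply: eq_rint => w; rewrite WC m0 mulr0.
rewrite (fbm_rint HW T0' T0') /fbm_cov subrr normr0 powR0; last first.
  by rewrite mulf_neq0// gt_eqF//; case/andP: H01.
rewrite subr0 => /eqP; rewrite gt_eqF// mulr_gt0// addr_gt0 ?powR_gt0//.
Qed.

Lemma rint_l_H_powR T q : 0 < T -> 0 < q ->
  intble leb (fun x => l_H H T x * x `^ (q - 3 / 2 + H)) /\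
  rint leb (fun x => l_H H T x * x `^ (q - 3 / 2 + H)) =
  C_H H * Beta q (3 / 2 - H) * T `^ (q + (1 / 2 - H)).
Proof.
move=> T0 q0; have [H0 H1] := andP H01.
have p0 : 0 < 3 / 2 - H by lra.
pose f (x : R) := \I[0 < x < T] * (x `^ (q - 1) * (T - x) `^ (3 / 2 - H - 1)).
have f0 x : 0 <= f x by rewrite mulr_ge0 ?mulr_ge0 ?powR_ge0.
have mf : measurable_fun setT f by rewrite /f; meas.
have Ef : (\int[leb]_x (f x)%:E = (T `^ (q + (1 / 2 - H)) * Beta q (3 / 2 - H))%:E)%E.
  rewrite EFinM -(eBeta_fin q0 p0) /f (integral_Beta_scale _ _ T0).
  by rewrite (_ : q + (3 / 2 - H) - 1 = q + (1 / 2 - H)); [|field].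
have If : intble leb f by apply: intble_ge0 => //; rewrite Ef ltry.
have E x : l_H H T x * x `^ (q - 3 / 2 + H) = C_H H * f x.
  rewrite /l_H /f; case: ifPn => [/andP[x0 xT]|]; last by rewrite !mul0r mulr0.
  rewrite [in RHS]mul1r (_ : q - 1 = (1 / 2 - H) + (q - 3 / 2 + H)); last by field.
  rewrite (@powRD _ x (1 / 2 - H)); last by rewrite (gt_eqF x0) implybT.
  rewrite (_ : 3 / 2 - H - 1 = 1 / 2 - H); last by field.
  by move: (C_H H) => C; ring.
rewrite (funext E); split; first exact: intbleZ.
rewrite rintZ// /rint Ef /=.
by move: (C_H H) (Beta _ _) (T `^ _) => C B p; ring.
Qed.

Lemma log_fourier_coef th rho nu mu a t w : a != 0 ->
  ln (fourier_coef H W th rho nu mu a t w / a) =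
  (rho + th * nu) * t - 2^-1 * mu ^+ 2 * t `^ (2 * H) + mu * W t w.
Proof. by move=> a0; rewrite /fourier_coef mulrAC divff// mul1r expRK. Qed.

(** At time T the two decompositions of v differ by (c - mu) W_T and a
    constant, so c = mu; then g has the same primitive as the drift, and the
    integral of l_H against the drift consists of two Beta integrals. *)
Lemma integral_dv_representation th rho nu mu a T X : 0 < T -> a != 0 ->
  is_integral_dv H W T (l_H H T)
    (fun t w => ln (fourier_coef H W th rho nu mu a t w / a)) X ->
  exists2 I : {RV P >-> R}, is_wiener_integral H W (l_H H T) I &
    forall w, X w = (rho + th * nu) * (b1 H * T `^ (2 - 2 * H))
                    - mu ^+ 2 * H * (b2 H * T) + mu * I w.
Proof.
move=> T0 a0 [g [c [I [Ig Ilg vE WI XE]]]]; exists I => // w.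
have [H0 H1] := andP H01.
have vE' s w' : 0 <= s <= T -> (rho + th * nu) * s - 2^-1 * mu ^+ 2 * s `^ (2 * H) =
    \int[leb]_(r in `[0, s]) g r + (c - mu) * W s w'.
  by move=> sT; have := vE s w' sT; rewrite log_fourier_coef//; lra.
have TT : 0 <= T <= T by rewrite lexx ltW.
have cmu : c = mu.
  apply/eqP; rewrite -subr_eq0; apply/negP => /negP cm.
  apply: (fbm_not_constant T0) => w1 w2; apply: (mulfI cm).
  by have := vE' T w1 TT; rewrite (vE' T w2 TT) => /addrI.
have gE s : 0 <= s <= T -> \int[leb]_(r in `[0, s]) g r =
    (rho + th * nu) * s + (- (mu ^+ 2 * H)) * (s `^ (2 * H) / (2 * H)).
  move=> sT; have := vE' s w sT; rewrite cmu subrr mul0r addr0 => <-.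
  by field; rewrite gt_eqF.
have H20 : 0 < 2 * H by rewrite mulr_gt0.
have := drift_identification H20 T0 Ig gE => gae.
rewrite XE cmu; congr (_ + _).
have [I1 E1] := @rint_l_H_powR T (3 / 2 - H) T0 ltac:(lra).
have [I2 E2] := @rint_l_H_powR T (1 / 2 + H) T0 ltac:(lra).
have -> : \int[leb]_(s in `[0, T]) (l_H H T s * g s) =
    rint leb (fun x => \I[0 <= x <= T] * (l_H H T x * g x)).
  congr fine; rewrite (@integral_ind R _ (measurableTypeR R) leb `[0, T]%classic)//.
have Iind : intble leb (fun x => \I[0 <= x <= T] * (l_H H T x * g x)).
  apply: (@intble_ind R `[0, T]%classic); [exact: measurable_itv| |exact: Ilg].
  by move=> x; rewrite /= in_itv.
have IB := intbleB (intbleZ (rho + th * nu) I1) (intbleZ (mu ^+ 2 * H) I2).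
rewrite (eq_rint_ae Iind IB).
  rewrite rintB; [|exact: intbleZ|exact: intbleZ].
  rewrite !rintZ// E1 E2 /b1 /b2.
  rewrite (_ : 3 / 2 - H + (1 / 2 - H) = 2 - 2 * H); last by field.
  rewrite (_ : 1 / 2 + H + (1 / 2 - H) = 1); last by field.
  by rewrite powRr1 ?(ltW T0).
move: gae; apply: filterS; first exact: (ae_filter_ringOfSetsType leb).
move=> x; have [/andP[x0 xT]|nxT _] := boolP (0 < x < T); last first.
  by rewrite /l_H (negbTE nxT) !mul0r !mulr0 subrr.
rewrite [LHS]mul1r [RHS]mul1r => ->; rewrite (ltW x0) (ltW xT) [LHS]mul1r.
rewrite (_ : 3 / 2 - H - 3 / 2 + H = 0); last by ring.
rewrite (_ : 1 / 2 + H - 3 / 2 + H = 2 * H - 1); last by field.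
by rewrite powRr0; ring.
Qed.

(** The two normalizations in the estimator differ by a factor T, which is the
    power of T in the second drift term. *)
Lemma theta_hatE th rho nu mu a T X : 0 < T -> a != 0 -> nu != 0 ->
  is_integral_dv H W T (l_H H T)
    (fun t w => ln (fourier_coef H W th rho nu mu a t w / a)) X ->
  exists2 I : {RV P >-> R}, is_wiener_integral H W (l_H H T) I &
    forall w,
      X w = (rho + th * nu) * (b1 H * T `^ (2 - 2 * H))
            - mu ^+ 2 * H * (b2 H * T) + mu * I w /\
      theta_hat H rho nu mu T (X w) =
        th + mu / (nu * b1 H * T `^ (2 - 2 * H)) * I w.
Proof.
move=> T0 a0 nu0 /(integral_dv_representation T0 a0)[I WI XE]; exists I => // w.
split; first exact: XE.
rewrite /theta_hat XE.
have -> : T `^ (2 - 2 * H) = T * T `^ (1 - 2 * H).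
  transitivity (T `^ 1 * T `^ (1 - 2 * H)); last by rewrite powRr1// ltW.
  rewrite -powRD; last by rewrite (gt_eqF T0) implybT.
  by rewrite (_ : 1 + (1 - 2 * H) = 2 - 2 * H) //; ring.
have := powR_gt0 (1 - 2 * H) T0; have := b1_gt0 H01.
move: (b1 H) (b2 H) (T `^ _) (I w) T0 nu0 => b b' p i T0 nu0 b0 p0.
by field; rewrite nu0 !gt_eqF.
Qed.

End representation.

(** * Chaining over dyadic points *)

Section dyadic_chaining.
Variable R : realType.
Implicit Types (z : R -> R) (u c q : R).

(** The points of level j that divide [u, 2u] into 2^j equal parts. *)
Definition dyadic_pt u (j i : nat) : R := u + u * i%:R / 2 ^+ j.

Lemma dyadic_ptS u j i : dyadic_pt u j.+1 i.*2 = dyadic_pt u j i.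
Proof.
rewrite /dyadic_pt -muln2 natrM exprS; field.
by rewrite expf_neq0.
Qed.

(** A point of level j + 1 is a point of level j, or the right neighbour of
    one, so each level adds at most one increment. *)
Lemma dyadic_chain z u c q : 0 <= c -> 0 <= q ->
  (forall j i, (i < 2 ^ j)%N -> `|z (dyadic_pt u j i.+1) - z (dyadic_pt u j i)| <= c * q ^+ j) ->
  forall j i, (i <= 2 ^ j)%N ->
    `|z (dyadic_pt u j i) - z u| <= c * \sum_(k < j.+1) q ^+ k.
Proof.
move=> c0 q0 Hz.
have z0 : dyadic_pt u 0 0 = u by rewrite /dyadic_pt mulr0 mul0r addr0.
elim=> [[|[|i]]//= _|j IH i ij].
- by rewrite z0 subrr normr0 mulr_ge0// sumr_ge0// => k _; exact: exprn_ge0.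
- by have := Hz 0 0 isT; rewrite z0 big_ord1.
have evenB (i' : nat) : (i' <= 2 ^ j)%N ->
    `|z (dyadic_pt u j.+1 i'.*2) - z u| <= c * \sum_(k < j.+1) q ^+ k.
  by move=> ij'; rewrite dyadic_ptS IH.
have qj : 0 <= c * q ^+ j.+1 by rewrite mulr_ge0// exprn_ge0.
have ij2 : (i./2 <= 2 ^ j)%N.
  rewrite -leq_double -[leqRHS]mul2n -expnS; apply: leq_trans ij.
  by rewrite -{2}(odd_double_half i) leq_addl.
rewrite big_ord_recr mulrDr /=.
have := odd_double_half i; case: (odd i) => iE; last first.
  by rewrite -iE; apply: le_trans (evenB _ ij2) _; rewrite lerDl.
have ij' : (i./2.*2 < 2 ^ j.+1)%N by apply: leq_trans ij; rewrite -{2}iE.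
rewrite -iE; set e := i./2.*2.
have -> : z (dyadic_pt u j.+1 (true + e)) - z u =
    (z (dyadic_pt u j.+1 e) - z u) + (z (dyadic_pt u j.+1 e.+1) - z (dyadic_pt u j.+1 e)).
  by rewrite add1n; ring.
by apply: le_trans (ler_normD _ _) _; apply: lerD; [exact: evenB|exact: Hz].
Qed.

Lemma geometric_sum_le q m : 0 <= q < 1 -> \sum_(k < m) q ^+ k <= (1 - q)^-1.
Proof.
move=> /andP[q0 q1]; have q1' : 0 < 1 - q by rewrite subr_gt0.
rewrite -[leRHS]mul1r ler_pdivlMr//.
suff -> : (\sum_(k < m) q ^+ k) * (1 - q) = 1 - q ^+ m by rewrite gerBl exprn_ge0.
elim: m => [|m IH]; first by rewrite big_ord0 mul0r expr0 subrr.
by rewrite big_ord_recr /= mulrDl IH exprS; ring.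
Qed.

Lemma dyadic_dense z u M t : 0 < u -> u <= t <= 2 * u -> {for t, continuous z} ->
  (forall j i, (i <= 2 ^ j)%N -> `|z (dyadic_pt u j i)| <= M) -> `|z t| <= M.
Proof.
move=> u0 /andP[ut tu] cz Hz.
(* the index of the last point of level j to the left of t *)
pose i j := Num.truncn (2 ^+ j * (t / u - 1)).
have th0 : 0 <= t / u - 1 by rewrite subr_ge0 ler_pdivlMr// mul1r.
have th1 : t / u - 1 <= 1 by rewrite lerBlDr ler_pdivrMr// (_ : 1 + 1 = 2).
have p0 j : 0 < 2 ^+ j :> R by rewrite exprn_gt0.
have iP j : (i j)%:R <= 2 ^+ j * (t / u - 1) < (i j).+1%:R.
  by apply: truncn_itv; rewrite mulr_ge0// ltW.
have ij j : (i j <= 2 ^ j)%N.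
  rewrite -(ler_nat R) natrX; apply: (le_trans (proj1 (andP (iP j)))).
  by rewrite ler_piMr// ltW.
pose y j := dyadic_pt u j (i j).
have yt j : `|t - y j| <= u * (2^-1) ^+ j.
  have tE : t = u + u * (2 ^+ j * (t / u - 1)) / 2 ^+ j.
    by field; rewrite !gt_eqF.
  have -> : t - y j = u * (2 ^+ j * (t / u - 1) - (i j)%:R) / 2 ^+ j.
    rewrite {1}tE /y /dyadic_pt; move: (2 ^+ j * _) => q.
    by field; rewrite gt_eqF.
  have /andP[i1 i2] := iP j.
  rewrite exprVn ger0_norm; last by rewrite divr_ge0 ?(ltW (p0 j))// mulr_ge0 ?(ltW u0)// subr_ge0.
  rewrite ler_pM2r ?invr_gt0// ler_piMr ?(ltW u0)//.
  by move: i2; rewrite -natr1; lra.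
have cy : y j @[j --> \oo] --> t.
  apply/cvgrPdist_le => e e0.
  have := @cvg_expr R 2^-1; rewrite ger0_norm// invf_lt1// ltr1n => /(_ isT).
  move=> /cvgr0Pnorm_le /(_ (e / u) (divr_gt0 e0 u0)); apply: filterS => j.
  rewrite ger0_norm ?exprn_ge0// ler_pdivlMr// mulrC.
  exact: le_trans (yt j).
have czy : z (y j) @[j --> \oo] --> z t by exact: (@cvg_comp _ _ _ y z _ _ _ cy cz).
apply: (ler_cvg_to (cvg_norm czy) (cvg_cst M)).
by apply: nearW => j; exact: Hz.
Qed.

End dyadic_chaining.

(** * A strong law from fourth-power tails *)

(** On the block [2^n, 2^(n+1)] the increments of level j are compared with
    2^n q^n q^j, for q = 9/10. By hypothesis one such comparison fails with
    probability at most K r^(n+j), where r = 1/(4 q^4). There are 2^j of them,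
    and 2 r = 5000/6561 < 1. Collecting the events with n + j = l gives a
    summable sequence of finite unions, and if none occurs for n + j >= N then
    chaining bounds the process on the blocks n >= N by 11 * 2^n q^n. *)
Section strong_law.
Context d (Omega : measurableType d) (R : realType) (P : probability Omega R).
Variables (Z : R -> Omega -> R) (K : R).
Hypotheses (K0 : 0 <= K)
  (mZ : forall t : R, 0 < t -> measurable_fun setT (Z t))
  (tail : forall t y : R, 0 < t -> 0 < y ->
    (P [set w | (y < `|Z t w|)%R] <= (K * t ^+ 2 / y ^+ 4)%:E)%E)
  (increment : forall s t y : R, 0 < s -> s <= t -> 0 < y ->
    (P [set w | (y < `|Z t w - Z s w|)%R] <= (K * (t - s) ^+ 2 / y ^+ 4)%:E)%E).

Lemma boole_le (F : nat -> set Omega) (c : nat -> R) n : (forall i, measurable (F i)) ->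
  (forall i, (P (F i) <= (c i)%:E)%E) ->
  (P (\big[setU/set0]_(i < n) F i) <= (\sum_(i < n) c i)%:E)%E.
Proof.
move=> mF Fc; elim: n => [|n IH]; first by rewrite !big_ord0 measure0.
have mU : measurable (\big[setU/set0]_(i < n) F i) by exact: bigsetU_measurable.
rewrite !big_ord_recr /= EFinD; apply: le_trans (measureU2 P mU (mF n)) _.
exact: (leeD IH (Fc n)).
Qed.

Let q : R := 9 / 10.
Let r : R := (4 * q ^+ 4)^-1.
Let u n : R := 2 ^+ n.
Let thr n j : R := u n * q ^+ n * q ^+ j.
Let base n := [set w | (thr n 0 < `|Z (u n) w|)%R].
Let jump n j i :=
  [set w | (thr n j < `|Z (dyadic_pt (u n) j i.+1) w - Z (dyadic_pt (u n) j i) w|)%R].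
Let bad l := base l `|`
  \big[setU/set0]_(n < l.+1) \big[setU/set0]_(i < 2 ^ (l - n)) jump n (l - n) i.

Let q0 : 0 < q. Proof. by rewrite /q; lra. Qed.
Let u0 n : 0 < u n. Proof. by rewrite exprn_gt0. Qed.
Let thr0 n j : 0 < thr n j. Proof. by rewrite !mulr_gt0 ?exprn_gt0. Qed.
Let pt0 n j i : 0 < dyadic_pt (u n) j i.
Proof. by rewrite ltr_pwDl// divr_ge0 ?exprn_ge0// mulr_ge0// ltW. Qed.

Let mbase n : measurable (base n).
Proof. by apply: measurable_event; have := mZ (u0 n) => ?; meas. Qed.

Let mjump n j i : measurable (jump n j i).
Proof.
by apply: measurable_event; have := mZ (pt0 n j i); have := mZ (pt0 n j i.+1) => ? ?; meas.
Qed.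

Let mjumps n j k : measurable (\big[setU/set0]_(i < k) jump n j i).
Proof. by apply: bigsetU_measurable => i _; exact: mjump. Qed.

Let mbad l : measurable (bad l).
Proof.
by apply: measurableU; [exact: mbase|apply: bigsetU_measurable => n _; exact: mjumps].
Qed.

Let rE n : r ^+ n = ((2 ^+ n) ^+ 2 * (q ^+ n) ^+ 4)^-1.
Proof.
rewrite /r exprVn exprMn; congr (_ * _)^-1; last by rewrite -!exprM mulnC.
by rewrite -exprM mulnC exprM; congr (_ ^+ _); ring.
Qed.

Let Pbase n : (P (base n) <= (K * r ^+ n)%:E)%E.
Proof.
apply: le_trans (tail (u0 n) (thr0 n 0)) _.
rewrite lee_fin le_eqVlt; apply/orP; left; apply/eqP.
rewrite rE /thr /u expr0 mulr1.
have := exprn_gt0 n (ltr0n R 2); have := exprn_gt0 n q0.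
move: (2 ^+ n) (q ^+ n) => a b b0 a0.
by field; rewrite !gt_eqF.
Qed.

Let Pjump n j i : (P (jump n j i) <= (K * r ^+ (n + j))%:E)%E.
Proof.
have le_pt : dyadic_pt (u n) j i <= dyadic_pt (u n) j i.+1.
  rewrite /dyadic_pt lerD2l ler_pM2r ?invr_gt0 ?exprn_gt0// ler_pM2l//.
  by rewrite ler_nat.
apply: le_trans (increment (pt0 n j i) le_pt (thr0 n j)) _.
have -> : dyadic_pt (u n) j i.+1 - dyadic_pt (u n) j i = u n / 2 ^+ j.
  by rewrite /dyadic_pt -natr1; field; rewrite expf_neq0.
rewrite lee_fin le_eqVlt; apply/orP; left; apply/eqP.
rewrite exprD !rE /thr /u.
have := exprn_gt0 n (ltr0n R 2); have := exprn_gt0 n q0.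
have := exprn_gt0 j (ltr0n R 2); have := exprn_gt0 j q0.
move: (2 ^+ n) (q ^+ n) (2 ^+ j) (q ^+ j) => a b c e b0 a0 e0 c0.
by field; rewrite !gt_eqF.
Qed.

Let Pbad l : (P (bad l) <= (3 * K * (2 * r) ^+ l)%:E)%E.
Proof.
pose J n := \big[setU/set0]_(i < 2 ^ (l - n)) jump n (l - n) i.
have PJ n : (P (J n) <= (2 ^+ (l - n) * (K * r ^+ (n + (l - n))))%:E)%E.
  apply: le_trans (boole_le (2 ^ (l - n)) (mjump n (l - n)) (Pjump n (l - n))) _.
  by rewrite sumr_const card_ord -[_ *+ (2 ^ _)]mulr_natl natrX.
apply: le_trans (measureU2 P (mbase l) (bigsetU_measurable _ _)) _.
  by move=> n _; exact: mjumps.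
apply: le_trans (leeD (Pbase l) (boole_le l.+1 (fun n => mjumps n (l - n) (2 ^ (l - n))) PJ)) _.
rewrite -EFinD lee_fin.
have r0 : 0 <= r by rewrite invr_ge0 mulr_ge0// exprn_ge0// ltW.
have -> : \sum_(n < l.+1) 2 ^+ (l - n) * (K * r ^+ (n + (l - n))) =
    2 ^+ l * (K * r ^+ l) * \sum_(n < l.+1) 2^-1 ^+ n.
  rewrite mulr_sumr; apply: eq_bigr => n _; have nl : (n <= l)%N by rewrite -ltnS.
  have -> : 2 ^+ l = 2 ^+ (l - n) * 2 ^+ n :> R by rewrite -exprD subnK.
  rewrite subnKC// exprVn; move: (r ^+ _) (2 ^+ (l - n)) => x y.
  by field; rewrite expf_neq0.
have s2 : \sum_(n < l.+1) 2^-1 ^+ n <= 2 :> R.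
  apply: le_trans (geometric_sum_le l.+1 _) _; last first.
    by rewrite (_ : (1 - 2^-1)^-1 = 2 :> R) //; field.
  by apply/andP; split; lra.
have x0 : 0 <= K * r ^+ l by rewrite mulr_ge0// exprn_ge0.
have x1 : K * r ^+ l <= 2 ^+ l * (K * r ^+ l) by rewrite ler_peMl// exprn_ege1// ler1n.
have x2 : 2 ^+ l * (K * r ^+ l) * \sum_(n < l.+1) 2^-1 ^+ n <= 2 ^+ l * (K * r ^+ l) * 2.
  by rewrite ler_wpM2l// mulr_ge0// exprn_ge0.
apply: le_trans (lerD x1 x2) _; rewrite exprMn le_eqVlt; apply/orP; left; apply/eqP.
by move: (2 ^+ l) (r ^+ l) => a b; ring.
Qed.

Let s1 : 2 * r < 1.
Proof.
have -> : 2 * r = 5000 / 6561 by rewrite /r /q; field.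
by lra.
Qed.

Let r0 : 0 <= r.
Proof. by rewrite invr_ge0 mulr_ge0// exprn_ge0// ltW. Qed.

Let Pbad_summable : (\sum_(l <oo) P (bad l) < +oo)%E.
Proof.
apply: (@le_lt_trans _ _ (3 * K * (1 - 2 * r)^-1)%:E); last exact: ltry.
apply: lime_le; first by apply: is_cvg_nneseries => *; exact: measure_ge0.
apply: nearW => n; rewrite big_mkord.
apply: (@le_trans _ _ (\sum_(l < n) 3 * K * (2 * r) ^+ l)%:E).
  by rewrite -sumEFin; apply: lee_sum => l _; exact: Pbad.
rewrite lee_fin -mulr_sumr ler_wpM2l ?mulr_ge0//.
by apply: geometric_sum_le; rewrite mulr_ge0//= s1.
Qed.

Let good_bound w N : (forall l, (N <= l)%N -> ~ bad l w) ->
  (forall t, 0 < t -> {for t, continuous (Z ^~ w)}) ->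
  forall n t, (N <= n)%N -> u n <= t <= 2 * u n -> `|Z t w| <= 11 * (u n * q ^+ n).
Proof.
move=> Hw cw n t Nn tn.
have t0 : 0 < t by case/andP: tn => + _; exact: lt_le_trans.
apply: (dyadic_dense (u0 n) tn (cw t t0)) => j i ij.
have c0 : 0 <= u n * q ^+ n by rewrite mulr_ge0 ?exprn_ge0// ltW.
have base_le : `|Z (u n) w| <= u n * q ^+ n.
  rewrite leNgt; apply/negP => Hb; apply: (Hw n Nn); left.
  by rewrite /base /= /thr expr0 mulr1.
have jump_le (j' i' : nat) : (i' < 2 ^ j')%N ->
    `|Z (dyadic_pt (u n) j' i'.+1) w - Z (dyadic_pt (u n) j' i') w| <= u n * q ^+ n * q ^+ j'.
  move=> ij'; rewrite leNgt; apply/negP => Hb; apply: (Hw (n + j')%N (leq_trans Nn (leq_addr _ _))).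
  right; rewrite -(@bigcup_mkord _ (n + j').+1 (fun n' =>
    \big[setU/set0]_(i < 2 ^ (n + j' - n')) jump n' (n + j' - n') i)).
  exists n; first by rewrite /= ltnS leq_addr.
  by rewrite addKn -(@bigcup_mkord _ (2 ^ j') (jump n j')); exists i'.
have := dyadic_chain (z := Z ^~ w) c0 (ltW q0) jump_le ij.
have q1 : 0 <= q < 1 by rewrite (ltW q0) /q; lra.
have := geometric_sum_le j.+1 q1; have -> : (1 - q)^-1 = 10 by rewrite /q; field.
move=> /(ler_wpM2l c0) g10 chain.
rewrite -[X in `|X|](subrK (Z (u n) w)); apply: le_trans (ler_normD _ _) _.
have := le_trans chain g10; move: base_le.
move: `|_ - _| `|_| (u n * _) => a b c; lra.
Qed.

Let good_cvg w N : (forall l, (N <= l)%N -> ~ bad l w) ->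
  (forall t, 0 < t -> {for t, continuous (Z ^~ w)}) ->
  Z t w / t @[t --> +oo] --> 0.
Proof.
move=> Hw cw; apply/cvgr0Pnorm_le => e e0.
have q1 : `|q| < 1 by rewrite gtr0_norm// /q; lra.
have := cvg_expr q1; move=> /cvgr0Pnorm_le /(_ (e / 11) (divr_gt0 e0 (ltr0n _ 11))).
move=> [n0 _ /(_ (maxn n0 N) (leq_maxl _ _))] /=; set m := maxn n0 N.
rewrite gtr0_norm ?exprn_gt0// ler_pdivlMr// => qm.
near=> t.
have tm : u m <= t by near: t; apply: nbhs_pinfty_ge; rewrite num_real.
have t0 : 0 < t by exact: lt_le_trans (u0 m) tm.
(* n is the block that contains t *)
pose k := Num.truncn t; pose n := trunc_log 2 k.
have /andP[kt tk] := truncn_itv (ltW t0).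
have mk : (2 ^ m <= k)%N.
  rewrite -ltnS -(ltr_nat R) natrX; exact: le_lt_trans tm tk.
have k0 : (0 < k)%N by apply: leq_trans mk; rewrite expn_gt0.
have /andP[nk kn] := trunc_log_bounds (isT : 1 < 2)%N k0; rewrite -/n in nk kn.
have mn : (m <= n)%N by rewrite /n trunc_log_max.
have un : u n <= t by apply: le_trans kt; rewrite /u -natrX ler_nat.
have tn : t <= 2 * u n.
  by rewrite /u -exprS -natrX; apply: (le_trans (ltW tk)); rewrite ler_nat.
have := good_bound Hw cw (leq_trans (leq_maxr _ _) mn) (introT andP (conj un tn)).
move=> B; rewrite normrM normfV (gtr0_norm t0) ler_pdivrMr//.
apply: (le_trans B).
have qn : q ^+ n <= q ^+ m.
  by rewrite ler_wiXn2l// ?(ltW q0)// /q; lra.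
have -> : 11 * (u n * q ^+ n) = (11 * q ^+ n) * u n by ring.
apply: ler_pM => //.
- by rewrite mulr_ge0// exprn_ge0// ltW.
- exact: ltW (u0 n).
- by apply: le_trans qm; rewrite mulrC ler_wpM2r.
Unshelve. all: by end_near. Qed.

Theorem strong_law_of_increments :
  {ae P, forall w, forall t, 0 < t -> {for t, continuous (Z ^~ w)}} ->
  {ae P, forall w, Z t w / t @[t --> +oo] --> 0}.
Proof.
have bad0 : {ae P, forall w, ~ lim_sup_set bad w}.
  exists (lim_sup_set bad); split.
  - by apply: bigcap_measurable => // n _; apply: bigcup_measurable => l _; exact: mbad.
  - exact: lim_sup_set_cvg0.
  - by move=> w /= /contrapT.
have F := ae_filter_ringOfSetsType P.
move=> cont; near=> w.
have nb : ~ lim_sup_set bad w by near: w.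
have cw t : 0 < t -> {for t, continuous (Z ^~ w)} by move: t; near: w.
move: nb; rewrite /lim_sup_set => /existsNP[N /not_implyP[_ HN]].
apply: (good_cvg (N := N)) => // l Nl bl; apply: HN.
by exists l.
Unshelve. all: by end_near. Qed.

End strong_law.

(** * The Gaussian process of the integrals of l_H *)

Section wiener_processes.
Context d (Omega : measurableType d) (R : realType) (P : probability Omega R).
Variables (H : R) (W : R -> {RV P >-> R}).
Hypotheses (H01 : 0 < H < 1) (HW : fractional_brownian_motion H W).
Let p := 2 - 2 * H.
Let p0 : 0 < p. Proof. by rewrite /p; case/andP: H01 => _; lra. Qed.

Lemma scaled_wiener_limit f (I : {RV P >-> R}) (c : R) :
  is_wiener_integral H W f I -> gauss_limit W (fun w => c * I w).
Proof.
move=> /wiener_gauss_limit G; have := gauss_limit_lin HW c 0 G G.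
by under eq_fun do rewrite mul0r addr0.
Qed.

Lemma scaled_wiener_rint T (I : {RV P >-> R}) (c : R) : 0 < T ->
  is_wiener_integral H W (l_H H T) I ->
  rint P (fun w => c * I w * (c * I w)) = c ^+ 2 * T `^ p.
Proof.
move=> T0 WI; rewrite -(wiener_cov H01 HW T0 (lexx T) WI WI).
have SI := wiener_sqint HW WI.
rewrite -rintZ; last exact: sqint_intble.
by apply: eq_rint => w; ring.
Qed.

Lemma scaled_wiener_tail T (I : {RV P >-> R}) (c y : R) : 0 < T -> 0 < y ->
  is_wiener_integral H W (l_H H T) I ->
  (P [set w | (y < `|c * I w|)%R] <= (48 * c ^+ 4 * (T `^ p) ^+ 2 / y ^+ 4)%:E)%E.
Proof.
move=> T0 y0 WI; have := gauss_limit_tail HW (scaled_wiener_limit c WI) y0.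
rewrite (scaled_wiener_rint c T0 WI); congr (_ <= _%:E)%E.
by move: (T `^ p) => x; field; rewrite gt_eqF.
Qed.

(** The covariance s^p makes the variance of the increment t^p - s^p. *)
Lemma scaled_wiener_increment s t (X Y : {RV P >-> R}) (c y : R) : 0 < s -> s <= t -> 0 < y ->
  is_wiener_integral H W (l_H H s) X -> is_wiener_integral H W (l_H H t) Y ->
  (P [set w | (y < `|c * Y w - c * X w|)%R] <=
   (48 * c ^+ 4 * (t `^ p - s `^ p) ^+ 2 / y ^+ 4)%:E)%E.
Proof.
move=> s0 st y0 WX WY; have t0 : 0 < t by exact: lt_le_trans st.
have G := gauss_limit_lin HW c (- c) (wiener_gauss_limit WY) (wiener_gauss_limit WX).
have SX := wiener_sqint HW WX; have SY := wiener_sqint HW WY.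
have E : rint P (fun w => (c * Y w + - c * X w) * (c * Y w + - c * X w)) =
    c ^+ 2 * (t `^ p - s `^ p).
  transitivity (c ^+ 2 * rint P (fun w => (1 * X w - Y w) * (1 * X w - Y w))).
    rewrite -rintZ; first by apply: eq_rint => w; ring.
    by apply: sqint_intble; apply: sqintB SY; exact: sqintZ.
  rewrite (rint_sqrB 1 SX SY) (wiener_cov H01 HW s0 st WX WY).
  rewrite (wiener_cov H01 HW s0 (lexx s) WX WX) (wiener_cov H01 HW t0 (lexx t) WY WY) -/p.
  by ring.
have := gauss_limit_tail HW G y0; rewrite E.
under eq_set do rewrite mulNr.
by congr (_ <= _%:E)%E; move: (t `^ p - _) => x; field; rewrite gt_eqF.
Qed.

Lemma powR_cvgy : T `^ p @[T --> +oo] --> (+oo : set_system R).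
Proof.
apply/cvgryPge => A; near=> T.
have T0 : 0 < T by near: T; apply: nbhs_pinfty_gt; rewrite num_real.
have TA : `|A| `^ p^-1 <= T by near: T; apply: nbhs_pinfty_ge; rewrite num_real.
apply: (le_trans (ler_norm A)).
have -> : `|A| = (`|A| `^ p^-1) `^ p by rewrite -powRrM mulVf ?gt_eqF// powRr1.
by rewrite ge0_ler_powR ?nnegrE ?powR_ge0// ltW.
Unshelve. all: by end_near. Qed.

(** In the time t = T^p the variance of increments is linear, as for Brownian
    motion, which is the form required by [strong_law_of_increments]. *)
Lemma wiener_strong_law (I : R -> {RV P >-> R}) (c : R) :
  (forall T, 0 < T -> is_wiener_integral H W (l_H H T) (I T)) ->
  {ae P, forall w, forall T, 0 < T -> {for T, continuous (fun S => c * I S w)}} ->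
  {ae P, forall w, c * I T w / T `^ p @[T --> +oo] --> 0}.
Proof.
move=> WI cont.
have F := ae_filter_ringOfSetsType P.
pose Z (t : R) (w : Omega) := c * I (t `^ p^-1) w.
have root0 t : 0 < t -> 0 < t `^ p^-1 by exact: powR_gt0.
have rootK t : 0 < t -> (t `^ p^-1) `^ p = t.
  by move=> t0; rewrite -powRrM mulVf ?gt_eqF// powRr1// ltW.
have rootK' t : 0 < t -> (t `^ p) `^ p^-1 = t.
  by move=> t0; rewrite -powRrM mulfV ?gt_eqF// powRr1// ltW.
have K0 : 0 <= 48 * c ^+ 4 by rewrite mulr_ge0// (exprM _ 2 2) sqr_ge0.
have mZ t : 0 < t -> measurable_fun setT (Z t).
  by move=> t0; have := measurable_RV (I (t `^ p^-1)) => ?; rewrite /Z; meas.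
have tl t y : 0 < t -> 0 < y ->
    (P [set w | (y < `|Z t w|)%R] <= (48 * c ^+ 4 * t ^+ 2 / y ^+ 4)%:E)%E.
  move=> t0 y0; have r0 := root0 t t0.
  by have := scaled_wiener_tail c r0 y0 (WI _ r0); rewrite rootK.
have inc s t y : 0 < s -> s <= t -> 0 < y ->
    (P [set w | (y < `|Z t w - Z s w|)%R] <= (48 * c ^+ 4 * (t - s) ^+ 2 / y ^+ 4)%:E)%E.
  move=> s0 st y0; have t0 : 0 < t by exact: lt_le_trans st.
  have rs := root0 s s0; have rt := root0 t t0.
  have rst : s `^ p^-1 <= t `^ p^-1.
    by rewrite ge0_ler_powR ?nnegrE ?invr_ge0 ?(ltW p0) ?(ltW s0) ?(ltW t0).
  by have := scaled_wiener_increment c rs rst y0 (WI _ rs) (WI _ rt); rewrite !rootK.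
have cZ : {ae P, forall w, forall t, 0 < t -> {for t, continuous (Z ^~ w)}}.
  apply: filterS cont => w cw t t0.
  apply: (@continuous_comp _ _ _ (fun t : R => t `^ p^-1) (fun S => c * I S w)).
    exact: continuous_powR_gt0.
  exact: cw (root0 t t0).
have := strong_law_of_increments K0 mZ tl inc cZ.
apply: filterS => w Zw.
have C := @cvg_comp _ _ _ _ _ _ _ _ powR_cvgy Zw.
apply: cvg_trans C; apply: near_eq_cvg; near=> T.
have T0 : 0 < T by near: T; apply: nbhs_pinfty_gt; rewrite num_real.
by rewrite /= /Z rootK'.
Unshelve. all: by end_near. Qed.

(** For c = 0 the variable vanishes and the law is the Dirac mass. *)
Lemma scaled_wiener_law T (I : {RV P >-> R}) (c v : R) : 0 < T ->
  is_wiener_integral H W (l_H H T) I -> c ^+ 2 * T `^ p = v ->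
  forall x, P [set w | c * I w <= x] = gaussian_law 0 v `]-oo, x]%classic.
Proof.
move=> T0 WI cv x; have [c0|c0] := eqVneq c 0; last first.
  have v0 : 0 < v by rewrite -cv mulr_gt0 ?powR_gt0// exprn_even_gt0.
  apply: (gauss_limit_law HW (scaled_wiener_limit c WI) v0).
  by rewrite (scaled_wiener_rint c T0 WI).
have v0 : v = 0 by rewrite -cv c0 expr0n mul0r.
rewrite /gaussian_law v0 eqxx diracE.
have [x0|x0] := leP 0 x.
  rewrite mem_set; last by rewrite /= in_itv.
  apply: etrans (probability_setT P); congr (P _).
  by apply/seteqP; split=> w //= _; rewrite c0 mul0r.
rewrite memNset; last by rewrite /= in_itv/= leNgt x0.
apply: etrans (measure0 P); congr (P _).
by apply/seteqP; split=> w //=; rewrite c0 mul0r leNgt x0.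
Qed.

Lemma wiener_mean0 f (I : {RV P >-> R}) : is_wiener_integral H W f I -> rint P I = 0.
Proof. by move=> /wiener_gauss_limit /(gauss_limit_mean0 HW). Qed.

(** All the covariances are T^p, so E (I - J)^2 = 0. *)
Lemma wiener_unique T (I J : {RV P >-> R}) : 0 < T ->
  is_wiener_integral H W (l_H H T) I -> is_wiener_integral H W (l_H H T) J ->
  {ae P, forall w, I w = J w}.
Proof.
move=> T0 WI WJ; have SI := wiener_sqint HW WI; have SJ := wiener_sqint HW WJ.
have S := sqintB SI SJ.
have E : (\int[P]_w ((I w - J w) ^+ 2)%:E = 0)%E.
  rewrite (sqint_int S) -[RHS](_ : (0 : R)%:E = _)//; congr EFin.
  transitivity (rint P (fun w => (1 * I w - J w) * (1 * I w - J w))).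
    by apply: eq_rint => w; rewrite mul1r.
  rewrite (rint_sqrB 1 SI SJ) (wiener_cov H01 HW T0 (lexx T) WI WJ).
  rewrite (wiener_cov H01 HW T0 (lexx T) WI WI) (wiener_cov H01 HW T0 (lexx T) WJ WJ).
  by ring.
have mD : measurable_fun setT (fun w => ((I w - J w) ^+ 2)%:E).
  by have := S.1 => ?; meas.
have := (@ae_eq_integral_abs _ _ _ P setT measurableT _ mD).1.
have -> : (\int[P]_(x in setT) `|((I x - J x) ^+ 2)%:E| = 0)%E.
  by rewrite -[RHS]E; apply: eq_integral => w _; rewrite abse_EFin ger0_norm ?sqr_ge0.
have F := ae_filter_ringOfSetsType P.
move=> /(_ erefl); apply: filterS => w.
by move=>  /(_ Logic.I) [] /eqP; rewrite sqrf_eq0 subr_eq0 => /eqP.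
Qed.

End wiener_processes.

(** * The estimator *)

Theorem theorem6 (R : realType) (d : measure_display) (Omega : measurableType d)
    (P : probability Omega R) (H : R) (W : R -> {RV P >-> R})
    (V : completeNormedModType R) (ip : V -> V -> R)
    (Lam A0 A1 M : linear_operator V)
    (h : nat -> V) (lam rho nu mu : nat -> R)
    (Theta : set R) (theta0 gamma m : R) (u0 : nat -> R)
    (* the processes \tilde v_k *)
    (vt : nat -> R -> {RV P >-> R})
    (H01 : 0 < H < 1)
    (HW : fractional_brownian_motion H W)
    (HV : separable_hilbert ip)
    (HLam : densely_defined_bounded_below Lam)
    (Hlam : eigensystem Lam h lam)
    (lam_gt0 : forall k, 0 < lam k)
    (HTheta : open Theta)
    (bTheta : bounded_set Theta)
    (Htheta0 : Theta theta0)
    (Hdiag : diagonalizable_equation ip A0 A1 M h rho nu mu)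
    (m_gt0 : 0 < m)
    (Hpar : parabolic lam rho nu mu Theta m)
    (Hu0 : initial_condition ip h lam gamma u0)
    (u0_neq0 : forall k, u0 k != 0)
    (nu_neq0 : forall k, nu k != 0)
    (Hvt : forall k T, 0 < T ->
      is_integral_dv H W T (l_H H T)
        (fun t w =>
           ln (fourier_coef H W theta0 (rho k) (nu k) (mu k) (u0 k) t w / u0 k))
        (vt k T)) :
  let thetah k T w := theta_hat H (rho k) (nu k) (mu k) T (vt k T w) in
  [/\ (* (1) *)
      forall k T, 0 < T -> 'E_P[thetah k T]%E = theta0%:E,
      (* (2); the first claim is about continuous versions of \tilde v_k *)
      forall k,
        ({ae P, forall w, forall T, 0 < T ->
            {for T, continuous (fun S => vt k S w)}} ->
         {ae P, forall w, thetah k T w @[T --> +oo] --> theta0}) /\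
        cvg_in_distribution P +oo
          (fun T w => T `^ (1 - H) * (thetah k T w - theta0))
          (gaussian_law 0 (mu k ^+ 2 / (b1 H ^+ 2 * nu k ^+ 2))) &
      (* (3) *)
      `|mu k / nu k| @[k --> \oo] --> 0 ->
      forall T, 0 < T ->
        {ae P, forall w, thetah k T w @[k --> \oo] --> theta0} /\
        ((forall k, mu k != 0) ->
         cvg_in_distribution P \oo
           (fun k w => `|nu k / mu k| * (thetah k T w - theta0))
           (gaussian_law 0 (T `^ (2 * H - 2) / b1 H ^+ 2)))].

Proof.
move=> thetah; have [H0 H1] := andP H01.
have b0 := b1_gt0 H01; set b := b1 H in b0 *.
pose p := 2 - 2 * H.
have p0 : 0 < p by rewrite /p; lra.
have F := ae_filter_ringOfSetsType P.
have /choice[I HI] : forall kT : nat * R, exists I : {RV P >-> R}, 0 < kT.2 ->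
    is_wiener_integral H W (l_H H kT.2) I /\ forall w,
    vt kT.1 kT.2 w = (rho kT.1 + theta0 * nu kT.1) * (b * kT.2 `^ p)
      - mu kT.1 ^+ 2 * H * (b2 H * kT.2) + mu kT.1 * I w /\
    thetah kT.1 kT.2 w = theta0 + mu kT.1 / (nu kT.1 * b * kT.2 `^ p) * I w.
  move=> [k T] /=; have [T0|T0] := ltP 0 T; last by exists (W 0).
  have [I WI IE] := theta_hatE H01 HW T0 (u0_neq0 k) (nu_neq0 k) (Hvt k T T0).
  by exists I.
have WI k T : 0 < T -> is_wiener_integral H W (l_H H T) (I (k, T)).
  by move=> T0; exact: (HI (k, T) T0).1.
have vtE k T w : 0 < T -> vt k T w = (rho k + theta0 * nu k) * (b * T `^ p)
      - mu k ^+ 2 * H * (b2 H * T) + mu k * I (k, T) w.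
  by move=> T0; exact: ((HI (k, T) T0).2 w).1.
have thE k T w : 0 < T -> thetah k T w - theta0 = mu k / (nu k * b * T `^ p) * I (k, T) w.
  by move=> T0; rewrite ((HI (k, T) T0).2 w).2 addrC addKr.
have powp T : 0 < T -> 0 < T `^ p by exact: powR_gt0.
split.
- move=> k T T0; rewrite expectationE.
  have SI := sqint_intble1 (wiener_sqint HW (WI k T T0)).
  have S1 := sqint_intble1 (sqint1 P).
  have -> : (\int[P]_w (thetah k T w)%:E)%E =
      (\int[P]_w (theta0 * 1 + mu k / (nu k * b * T `^ p) * I (k, T) w)%:E)%E.
    by apply: eq_integral => w _; rewrite -(thE k T w T0) mulr1 addrC subrK.
  rewrite rintE; last by apply: intbleD; exact: intbleZ.
  rewrite rintD; [|exact: intbleZ|exact: intbleZ].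
  rewrite !rintZ// (wiener_mean0 HW (WI k T T0)) mulr0 addr0.
  rewrite /rint integral_cst// mul1e; congr EFin.
  by rewrite (congr1 fine (probability_setT P)) mulr1.
- move=> k; split.
  + move=> cont.
    have cI : {ae P, forall w, forall T, 0 < T ->
        {for T, continuous (fun S => mu k * I (k, S) w)}}.
      apply: filterS cont => w cw T T0.
      (* the noise is the observation minus its drift, hence continuous *)
      pose D (S : R) := (rho k + theta0 * nu k) * (b * S `^ p) - mu k ^+ 2 * H * (b2 H * S).
      have cD : D S @[S --> T] --> D T.
        apply: cvgB; apply: cvgM; try exact: cvg_cst; apply: cvgM; try exact: cvg_cst.
          exact: continuous_powR_gt0.
        exact: cvg_id.
      have nE S : 0 < S -> vt k S w - D S = mu k * I (k, S) w.
        by move=> S0; rewrite (vtE k S w S0) /D addrC addKr.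
      suff : mu k * I (k, S) w @[S --> T] --> mu k * I (k, T) w by [].
      rewrite -(nE T T0).
      apply: cvg_trans (cvgB (cw T T0) cD); apply: near_eq_cvg; near=> S.
      by apply: nE; near: S; exact: lt_nbhsr.
    have := wiener_strong_law H01 HW (WI k) cI.
    apply: filterS => w Nw.
    rewrite -[X in _ --> X]addr0.
    have C : theta0 + (nu k * b)^-1 * (mu k * I (k, T) w / T `^ p) @[T --> +oo]
        --> theta0 + (nu k * b)^-1 * 0.
      by apply: cvgD; [exact: cvg_cst|apply: cvgM; [exact: cvg_cst|exact: Nw]].
    rewrite mulr0 in C; apply: cvg_trans C; apply: near_eq_cvg; near=> T.
    have T0 : 0 < T by near: T; apply: nbhs_pinfty_gt; rewrite num_real.
    rewrite /= -[RHS](subrK theta0) (thE k T w T0) [RHS]addrC; congr (_ + _).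
    move: (nu_neq0 k) (powp T T0) b0; move: (T `^ p) (I _ w) => x y n0 x0 b0'.
    by field; rewrite n0 !gt_eqF.
  + move=> x _; apply: cvg_near_cst; near=> T.
    have T0 : 0 < T by near: T; apply: nbhs_pinfty_gt; rewrite num_real.
    under eq_set do rewrite thE// mulrA.
    apply: (scaled_wiener_law H01 HW T0 (WI k T T0)).
    have -> : T `^ (2 - 2 * H) = (T `^ (1 - H)) ^+ 2.
      by rewrite -powR_mulrn ?powR_ge0// -powRrM; congr (_ `^ _); ring.
    have x0 := powR_gt0 (1 - H) T0; move: (nu_neq0 k) b0 x0.
    move: (T `^ _) => y n0 b0' y0.
    by field; rewrite n0 !gt_eqF.
- move=> munu T T0; split.
  + have : {ae P, forall w, forall k, I (k, T) w = I (0%N, T) w}.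
      by apply: ae_foralln => k; exact: (wiener_unique H01 HW T0 (WI k T T0) (WI 0%N T T0)).
    apply: filterS => w IE.
    have C : theta0 + (mu k / nu k) * (I (0%N, T) w / (b * T `^ p)) @[k --> \oo]
        --> theta0 + 0 * (I (0%N, T) w / (b * T `^ p)).
      apply: cvgD; first exact: cvg_cst.
      by apply: cvgM; [exact/norm_cvg0P|exact: cvg_cst].
    rewrite mul0r addr0 in C; apply: cvg_trans C; apply: near_eq_cvg.
    apply: nearW => k /=.
    rewrite -[RHS](subrK theta0) (thE k T w T0) IE [RHS]addrC; congr (_ + _).
    move: (nu_neq0 k) (powp T T0) b0; move: (T `^ p) (I _ w) => x y n0 x0 b0'.
    by field; rewrite n0 !gt_eqF.
  + move=> mu0 x _; apply: cvg_near_cst; apply: nearW => k.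
    under eq_set do rewrite thE// mulrA.
    apply: (scaled_wiener_law H01 HW T0 (WI k T T0)).
    have -> : T `^ (2 * H - 2) = (T `^ p)^-1.
      by rewrite -powRN /p opprB.
    rewrite -/p exprMn normrM normfV exprMn exprVn !real_normK ?num_real//.
    move: (mu0 k) (nu_neq0 k) (powp T T0) b0; move: (T `^ p) => y m0 n0 y0 b0'.
    by field; rewrite m0 n0 !gt_eqF.
Unshelve. all: by end_near. Qed.
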